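(* Let $\Phi\equiv\Phi_-^*+\Phi_+\in L^\infty_{M_n}$ be of bounded type of the form $$\Phi_+=\theta^NA^*,\qquad \Phi_-=\theta^mB^*\qquad(N\ge m\ge1),$$ where $\theta$ is a scalar inner function and $A,B\in H^2_{M_n}$, and write $$A=A_0+\sum_{i=1}^{m-1}\theta^iA_i+\theta^mA_m,\qquad B=B_0+\sum_{i=1}^{m-1}\theta^iB_i,$$ where $A_m\in\mathcal K_{\theta^{N-m}}$ and $A_i,B_i\in\mathcal K_\theta$ $(i=0,1,\dots,m-1)$. Suppose that $A$ and $I_\theta$ are coprime. Then for $K\in H^\infty_{M_n}$, $$K\in\mathcal C(\Phi)\iff P_{\mathcal K_{\theta^N}}K=\theta^{N-m}\Bigl(K_0+\sum_{i=1}^{m-1}\theta^iK_i\Bigr),$$ where the $K_i\in\mathcal K_\theta$ satisfy $$\begin{pmatrix} B_0 \\ B_1 \\ \vdots \\ B_{m-1} \end{pmatrix}=\begin{pmatrix} K_0&0&\cdots&0 \\ K_1&K_0&\cdots&0 \\ \vdots&\vdots&\ddots&\vdots \\ K_{m-1}&K_{m-2}&\cdots&K_0 \end{pmatrix}\begin{pmatrix} A_0 \\ A_1 \\ \vdots \\ A_{m-1} \end{pmatrix}+\begin{pmatrix} G_0 \\ G_1 \\ \vdots \\ G_{m-1} \end{pmatrix},$$ with $$G_k=P_{H^2_{M_n}}\Bigl(\overline\theta\sum_{j=0}^{k-1}K_jA_{k-1-j}\Bigr)-P_{\theta H^2_{M_n}}\Bigl(\sum_{j=0}^kK_jA_{k-j}\Bigr)\qquad(k=0,1,\dots,m-1)$$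 (the first sum being empty, hence $0$, for $k=0$).
   Context: $L^\infty_{M_n},L^2_{M_n}$: $n\times n$ matrix functions on the unit circle $\mathbb T$ with entries in $L^\infty,L^2$; $H^\infty_{M_n},H^2_{M_n}$: those with entries in the Hardy spaces. $L^2_{M_n}$ has inner product $\langle F,G\rangle=\int_{\mathbb T}\operatorname{tr}(G^*F)\,d\mu$ ($\mu$ normalized Lebesgue measure). A matrix function is of bounded type if each entry equals a.e. a quotient of two $H^\infty$ functions. For $\Phi\in L^\infty_{M_n}$, $\Phi_+:=P(\Phi)\in H^2_{M_n}$ and $\Phi_-:=[P^\perp(\Phi)]^*\in zH^2_{M_n}$, where $P$ is the orthogonal projection of $L^2_{M_n}$ onto $H^2_{M_n}$ and $P^\perp=I-P$; it is assumed that $\Phi_\pm(0)=0$. $\mathcal C(\Phi):=\{K\in H^\infty_{M_n}:\Phi-K\Phi^*\in H^\infty_{M_n}\}$. For a scalar inner function $\omega$, $I_\omega=\omega I_n$ and $\mathcal K_\omega:=H^2_{M_n}\ominus\omega H^2_{M_n}$; $P_{\mathcal K_\omega}$ is the orthogonal projection onto it. Since $\Phi_\pm(0)=0$, one has $A\in\mathcal K_{\theta^N}$ and $B\in\mathcal K_{\theta^m}$, so the stated expansions of $A$ and $B$ exist and are unique. $A$ and $I_\theta$ are coprime if they have no common left (equivalently, no common right) inner divisor other than unitary constants, where an inner function $\Delta\in H^\infty_{M_n}$ ($\Delta^*\Delta=I_n$ a.e.) is a left inner divisor of $F\in H^2_{M_n}$ if $F=\Delta F'$, and a right inner divisor if $F=F'\Delta$,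 for some $F'\in H^2_{M_n}$. In the formula for $G_k$, $P_{H^2_{M_n}}$ and $P_{\theta H^2_{M_n}}=\theta P_{H^2_{M_n}}\overline\theta$ are the projections onto $H^2_{M_n}$ and $\theta H^2_{M_n}$; when applied to products of $L^2$ functions that lie only in $L^1$ they are understood through Fourier coefficients, i.e. $P_{H^2_{M_n}}F(z)=\sum_{j\ge0}\widehat F(j)z^j$. *)

(* Defs.v *)
From HB Require Import structures.
From mathcomp Require Import all_boot all_order all_algebra.
From mathcomp Require Import complex.
From mathcomp Require Import all_classical all_reals all_analysis.

Set Implicit Arguments.
Unset Strict Implicit.
Unset Printing Implicit Defensive.

Import Order.TTheory GRing.Theory Num.Theory.
Import numFieldNormedType.Exports.

Local Open Scope classical_set_scope.
Local Open Scope ring_scope.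
Local Open Scope complex_scope.
Local Open Scope sesquilinear_scope.

Lemma pi2_gt0 (R : realType) : (0 : R) < 2 * pi.
Proof. by rewrite mulr_gt0 // pi_gt0. Qed.

(* A function on the unit circle is a function of the angle t, where z = e^{it}
   and t ranges over [0, 2 pi] (values outside this interval are irrelevant);
   normalized Lebesgue measure on the circle is dt / (2 pi) on [0, 2 pi].
   Functions are Borel representatives; identities hold almost everywhere. *)
Notation circ R := (uniform_prob (pi2_gt0 R)).

Section Scalar.
Context {R : realType}.
Implicit Types f : R -> R[i].

Definition cintegral f : R[i] :=
  (\int[circ R]_t complex.Re (f t)) +i* (\int[circ R]_t complex.Im (f t)).

Definition Lp (p : \bar R) f : Prop :=
  (fun t => complex.Re (f t)) \in Lfun (circ R) p /\
  (fun t => complex.Im (f t)) \in Lfun (circ R) p.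

Definition zpow (j : int) (t : R) : R[i] := cos (j%:~R * t) +i* sin (j%:~R * t).

Definition fourier f (j : int) : R[i] :=
  cintegral (fun t => f t * zpow (- j) t).

Definition analytic f : Prop := forall j : int, j < 0 -> fourier f j = 0.

Definition Hp (p : \bar R) f : Prop := Lp p f /\ analytic f.

Definition inner_fun f : Prop :=
  Hp +oo f /\ {ae circ R, forall t, `|f t| = 1}.

End Scalar.

Section Matrix.
Context {R : realType} {n : nat}.
Implicit Types (F G Delta : R -> 'M[R[i]]_n) (S : set (R -> 'M[R[i]]_n)).
Implicit Types (w theta : R -> R[i]) (A K : nat -> R -> 'M[R[i]]_n).

Definition LpM (p : \bar R) : set (R -> 'M[R[i]]_n) :=
  [set F | forall a b, Lp p (fun t => F t a b)].

Definition HpM (p : \bar R) : set (R -> 'M[R[i]]_n) :=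
  [set F | forall a b, Hp p (fun t => F t a b)].

(* For F in H^2, [fourierM F 0] is the value F(0) of its analytic extension. *)
Definition fourierM F (j : int) : 'M[R[i]]_n :=
  \matrix_(a, b) fourier (fun t => F t a b) j.

Definition inner_prod F G : R[i] :=
  cintegral (fun t => \tr ((G t)^t* *m F t)).

(* G is the orthogonal projection of F onto the closed subspace S of L^2;
   it is determined up to equality almost everywhere. *)
Definition orth_proj S F G : Prop :=
  S G /\ forall H, S H -> inner_prod (fun t => F t - G t) H = 0.

Definition plus_part F Fp : Prop := orth_proj (HpM 2%:E) F Fp.

Definition minus_part F Fm : Prop :=
  LpM 2%:E Fm /\
  exists2 Fp, orth_proj (HpM 2%:E) F Fp &
    Fm = (fun t => (F t - Fp t)^t*) %[ae circ R].

Definition bounded_type F : Prop :=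
  forall a b, exists f g : R -> R[i],
    [/\ Hp +oo f, Hp +oo g &
        {ae circ R, forall t, g t != 0 /\ F t a b = f t / g t}].

Definition model_space w : set (R -> 'M[R[i]]_n) :=
  [set F | HpM 2%:E F /\
    forall G, HpM 2%:E G -> inner_prod F (fun t => w t *: G t) = 0].

Definition inner_mx Delta : Prop :=
  HpM +oo Delta /\ (fun t => (Delta t)^t* *m Delta t) = cst 1%:M %[ae circ R].

Definition left_inner_divisor Delta F : Prop :=
  inner_mx Delta /\
  exists2 F', HpM 2%:E F' & F = (fun t => Delta t *m F' t) %[ae circ R].

(* For G = theta I with theta scalar inner, left and right coprimeness agree. *)
Definition left_coprime F G : Prop :=
  forall Delta, left_inner_divisor Delta F -> left_inner_divisor Delta G ->
  exists2 U : 'M[R[i]]_n, U \is unitarymx & Delta = cst U %[ae circ R].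

Definition calC F : set (R -> 'M[R[i]]_n) :=
  [set K | HpM +oo K /\ HpM +oo (fun t => F t - K t *m (F t)^t*)].

Definition theta_expansion theta (m : nat) A (t : R) : 'M[R[i]]_n :=
  A 0%N t + \sum_(1 <= i < m) theta t ^+ i *: A i t.

(* The products K_j A_i of H^2 functions are only integrable, so projections
   are power series, given by their sequences of Taylor coefficients. *)
Definition proj_H2 F (j : nat) : 'M[R[i]]_n := fourierM F j%:Z.

(* theta P_{H^2} (conj theta F), as a Cauchy product of power series. *)
Definition proj_thetaH2 theta F (j : nat) : 'M[R[i]]_n :=
  \sum_(i < j.+1) fourier theta i%:Z *:
    proj_H2 (fun t => (theta t)^* *: F t) (j - i).

(* In the first sum i < k, so [k.-1] is k - 1. *)
Definition Gcoef theta A K (k j : nat) : 'M[R[i]]_n :=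
  proj_H2 (fun t => (theta t)^* *:
                    \sum_(0 <= i < k) K i t *m A (k.-1 - i)%N t) j
  - proj_thetaH2 theta (fun t => \sum_(0 <= i < k.+1) K i t *m A (k - i)%N t) j.

Definition toeplitz_block K (k l : nat) (t : R) : 'M[R[i]]_n :=
  if (l <= k)%N then K (k - l)%N t else 0.

(* The block rows k = 0, ..., m-1 of the Toeplitz system.  Every term lies in
   the analytic class, so equality is equality of all Taylor coefficients. *)
Definition toeplitz_system theta (m : nat) A (B : nat -> R -> 'M[R[i]]_n) K :=
  forall k, (k < m)%N -> forall j : nat,
    proj_H2 (B k) j =
    proj_H2 (fun t => \sum_(l < m) toeplitz_block K k l t *m A l t) j
    + Gcoef theta A K k j.

End Matrix.

(* Main.v *)
Require Import Defs.
From HB Require Import structures.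
From mathcomp Require Import all_boot all_order all_algebra.
From mathcomp Require Import complex.
From mathcomp Require Import all_classical all_reals all_analysis.
From mathcomp Require Import measurable_realfun ess_sup_inf ring lra zify.

Set Implicit Arguments.
Unset Strict Implicit.
Unset Printing Implicit Defensive.

Import Order.TTheory GRing.Theory Num.Theory.
Import numFieldNormedType.Exports.

Local Open Scope classical_set_scope.
Local Open Scope ring_scope.
Local Open Scope complex_scope.
Local Open Scope sesquilinear_scope.

(* With a = conj theta, K lies in C(Phi) iff a^m B - a^N K A is analytic, the
   other terms of Phi - K Phi^* being analytic.  Multiplying by theta^(N-p-1)
   shows that a^(p+1) K A is then analytic for p < N - m, so that the invariant
   subspace { F in H^2 : a (a^p K) F analytic } contains A and theta I.  By the
   Beurling-Lax theorem it is Q H^2 with Q inner, Q divides A and theta I, hence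
   is a unitary constant, and one more factor theta can be taken out of K.
   Therefore K = theta^(N-m) L, and the K_i are the first coefficients of the
   expansion of L in powers of theta.

   It remains to see when Q_m = a^m (B - L A) is analytic.  Put
   X_k = sum_(i<k) K_i A_(k-1-i).  Up to an H^1 function, Q_k equals
   e_k = a^k sum_(i<k) theta^i (B_i - X_(i+1)), with e_0 = 0 and
   theta e_(k+1) = B_k - X_(k+1) + e_k.  Since a e_k and a^2 X_(k+1) have no
   Fourier coefficient of index >= 0, the k-th row of the Toeplitz system says
   that P(theta e_(k+1)) = theta P(e_(k+1)), that is, given that Q_k is analytic,
   that Q_(k+1) is. *)

(** * Square-integrable functions on a probability space *)

Section RealLp.
Context {d : measure_display} {T : measurableType d} {R : realType}.
Variable P : probability T R.
Implicit Types f g : T -> R.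

(** Coprimeness is given only through inner divisors, so there is no Bezout identity to start from;
    the invariant subspace supplies the divisor instead. Beurling-Lax needs orthogonal projections,
    completeness of L^2 and uniqueness of Fourier coefficients. These are set up for functions
    rather than classes, so inner products are only semidefinite and identities hold almost
    everywhere. Uniqueness is proved in L^1, because Q^* Q' is merely integrable for two elements Q,
    Q' of the wandering subspace. An orthonormal basis of that subspace is packed into one matrix Q
    with Q^* Q = diag(1, ..., 1, 0, ..., 0) of maximal rank r <= n; that theta I lies in the
    invariant subspace forces r = n. In the Toeplitz half the products K_i A_j again lie only in
    L^1, outside the reach of orthogonal projection. There P is read on Taylor coefficients, and
    P(theta e) = theta P(e) becomes a Cauchy product formula, which forces e to be analytic once
    theta e is. *)

Lemma Lfun_measurable p f : f \in Lfun P p -> measurable_fun setT f.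
Proof. by rewrite inE => /andP[]; rewrite inE. Qed.

Lemma Lfun2P f : f \in Lfun P 2%:E <->
  measurable_fun setT f /\ P.-integrable setT (EFin \o (fun x => f x ^+ 2)).
Proof.
split=> [f2|[mf /integrableP[_ foo]]].
  by split; [exact: Lfun_measurable f2|exact: Lfun2_integrable_sqr].
rewrite inE; apply/andP; split; rewrite inE//= /finite_norm unlock.
rewrite poweR_lty// (le_lt_trans _ foo)// ge0_le_integral//.
- move=> x _; exact: poweR_ge0.
- apply/measurable_EFinP.
  apply/(@measurableT_comp _ _ _ _ _ _ (fun x : R => x `^ 2)%R) => //.
  exact/measurableT_comp.
- apply/measurableT_comp => //; apply/measurable_EFinP; exact: measurable_funX.
- by move=> t _/=; rewrite lee_fin normrX powR_mulrn.
Qed.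

Lemma LfunyP f : f \in Lfun P +oo%E <->
  measurable_fun setT f /\ exists M : R, {ae P, forall x, `|f x| <= M}.
Proof.
have P0 : (0 < P [set: T])%E by rewrite probability_setT.
split=> [|[mf [M fM]]].
  rewrite inE => /andP[]; rewrite !inE/= /finite_norm unlock P0 => mf.
  by move=> /ess_supr_bounded[M fM]; split=> //; exists M.
rewrite inE; apply/andP; split; rewrite inE//= /finite_norm unlock P0.
rewrite (@le_lt_trans _ _ M%:E) ?ltry//; apply/ess_supP.
by apply: filterS fM => x /=; rewrite lee_fin.
Qed.

Lemma LfunyM f g : f \in Lfun P +oo%E -> g \in Lfun P +oo%E ->
  f \* g \in Lfun P +oo%E.
Proof.
move=> /LfunyP[mf [M fM]] /LfunyP[mg [N gN]]; apply/LfunyP; split.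
  exact: measurable_funM.
by exists (M * N); apply: filterS2 fM gN => x ? ?; rewrite normrM ler_pM.
Qed.

Lemma LfunyM1 f g : f \in Lfun P +oo%E -> g \in Lfun P 1 ->
  f \* g \in Lfun P 1.
Proof.
move=> /LfunyP[mf [M fM]] g1.
have mg := Lfun_measurable g1.
move/Lfun1_integrable : g1 => gi; apply/Lfun1_integrable.
have /integrableP[_ Mi] : P.-integrable setT (fun x => (M * g x)%:E).
  by apply: (integrableZl measurableT M gi).
apply/integrableP; split; first exact/measurable_EFinP/measurable_funM.
apply: le_lt_trans Mi; apply: ae_ge0_le_integral => //.
- by apply/measurableT_comp => //; exact/measurable_EFinP/measurable_funM.
- by apply/measurableT_comp => //; exact/measurable_EFinP/measurable_funM.
- apply: filterS fM => x fx _ /=; rewrite lee_fin !normrM ler_wpM2r//.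
  by rewrite (le_trans fx)// ler_norm.
Qed.

Lemma LfunyM2 f g : f \in Lfun P +oo%E -> g \in Lfun P 2%:E ->
  f \* g \in Lfun P 2%:E.
Proof.
move=> fy /Lfun2P[mg g2]; have mf := Lfun_measurable fy.
apply/Lfun2P; split; first exact: measurable_funM.
rewrite (_ : (fun x => _) = (f \* f) \* (fun x => g x ^+ 2)); last first.
  by apply/funext => x /=; rewrite exprMn.
apply/Lfun1_integrable/LfunyM1; first exact: LfunyM.
exact/Lfun1_integrable.
Qed.

Lemma LfunyW2 f : f \in Lfun P +oo%E -> f \in Lfun P 2%:E.
Proof.
apply: (@Lfun_subset _ _ _ P 2%:E +oo%E).
- by rewrite lee1n.
- by rewrite leey.
- exact: fin_num_measure.
- by rewrite leey.
Qed.

Lemma Lfun2W1 f : f \in Lfun P 2%:E -> f \in Lfun P 1.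
Proof. by apply: Lfun_subset12; exact: fin_num_measure. Qed.

Lemma integral_cst_prob r : (\int[P]_x r%:E = r%:E)%E.
Proof.
transitivity (r%:E * P setT)%E; first exact: integral_cst.
by rewrite probability_setT mule1.
Qed.

Lemma Rintegral_eq0_ae f : P.-integrable setT (EFin \o f) ->
  (forall x, 0 <= f x) -> \int[P]_x f x = 0 -> {ae P, forall x, f x = 0}.
Proof.
move=> fi f0 h0; have mf := measurable_int _ fi.
have : (\int[P]_t `|(EFin \o f) t| = 0)%E.
  rewrite (eq_integral (EFin \o f)); last first.
    by move=> t _; rewrite /= ger0_norm// ge0.
  rewrite -[LHS]fineK; last exact: integrable_fin_num.
  by rewrite /Rintegral in h0; rewrite h0.
move=> /(ae_eq_integral_abs P measurableT mf).
by apply: filterS => t /(_ Logic.I) /= [].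
Qed.

Lemma integrable_sqr f : f \in Lfun P 2%:E ->
  P.-integrable setT (EFin \o (fun x => f x ^+ 2)).
Proof. by case/Lfun2P. Qed.

(* AM-GM: |f| <= (c f^2 + 1/c) / 2 *)
Lemma integral_abs_le_sqr f c : f \in Lfun P 2%:E -> 0 < c ->
  (\int[P]_x `|f x|%:E <= (c / 2)%:E * \int[P]_x (f x ^+ 2)%:E + (c^-1 / 2)%:E)%E.
Proof.
move=> f2 c0.
have mf := Lfun_measurable f2.
apply: (@le_trans _ _ (\int[P]_x (c / 2 * f x ^+ 2 + c^-1 / 2)%:E)%E).
  apply: ge0_le_integral => //.
  - by apply/measurable_EFinP; exact/measurableT_comp.
  - apply/measurable_EFinP/measurable_funD => //; apply/measurable_funM => //.
    exact: measurable_funX.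
  - move=> x _; rewrite lee_fin.
    rewrite -[f x ^+ 2]real_normK ?num_real//.
    have := sqr_ge0 (c * `|f x| - 1).
    have ci : c * c^-1 = 1 by rewrite divff// gt_eqF.
    have ci0 : 0 < c^-1 by rewrite invr_gt0.
    set a := `|f x|; set b := c^-1 in ci ci0 * => h.
    have : 0 <= b * (c * a - 1) ^+ 2 by rewrite mulr_ge0 // ltW.
    have -> : b * (c * a - 1) ^+ 2 = (c * b) * (c * a ^+ 2) - (c * b) * 2 * a + b.
      by ring.
    rewrite ci; lra.
under eq_integral do rewrite EFinD EFinM.
rewrite integralD//; last 2 first.
  - exact/integrableZl/integrable_sqr.
  - exact: finite_measure_integrable_cst.
rewrite integralZl//; last exact: integrable_sqr.
by rewrite integral_cst_prob.
Qed.

Lemma expn4_expr2 k : (4 ^- k : R) = 2 ^- k * 2 ^- k.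
Proof. by rewrite -invfM -exprMn -natrM. Qed.

Lemma geometric_nneseries :
  (\sum_(0 <= k <oo) (2 ^- k : R)%:E < +oo)%E.
Proof.
have h : cvgn (series (geometric (1 : R) 2^-1)).
  by apply: is_cvg_geometric_series; rewrite ger0_norm ?invr_ge0// invf_lt1 ?ltr1n.
rewrite (_ : (fun n => _) = EFin \o series (geometric (1 : R) 2^-1)); last first.
  apply/funext => n /=; rewrite sumEFin; congr EFin.
  by apply: eq_bigr => i _; rewrite /= mul1r exprVn.
by rewrite EFin_lim// ltry.
Qed.

Lemma measurable_limn_einf (u : nat -> T -> \bar R) :
  (forall k, measurable_fun setT (u k)) ->
  measurable_fun setT (fun x => limn_einf (u ^~ x)).
Proof.
move=> mu; apply: (@measurableT_comp _ _ _ _ _ _ -%E) => //.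
apply: measurable_fun_limn_esup => k.
exact: measurableT_comp.
Qed.

(** Riesz-Fischer. The rate 4^-i for squared distances makes the L^1 norms of successive differences
    at most 2^-k, so these are absolutely summable almost everywhere and [u] converges there.
    Fatou's lemma, applied to (u_j - u_i)^2 as j grows, passes the rate to the limit. *)
Lemma L2_complete (u : nat -> T -> R) :
  (forall k, u k \in Lfun P 2%:E) ->
  (forall i j, (i <= j)%N -> (\int[P]_x ((u j x - u i x) ^+ 2)%:E <= (4 ^- i : R)%:E)%E) ->
  exists2 v, v \in Lfun P 2%:E &
    forall i, (\int[P]_x ((v x - u i x) ^+ 2)%:E <= (4 ^- i : R)%:E)%E.
Proof.
move=> uL2 uC.
have mu k := Lfun_measurable (uL2 k).
pose w k x := u k.+1 x - u k x.
have wL2 k : w k \in Lfun P 2%:E.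
  by have -> : w k = u k.+1 - u k by []; rewrite rpredB ?lee1n.
have mw k := Lfun_measurable (wL2 k).
have w1 k : (\int[P]_x `|w k x|%:E <= (2 ^- k : R)%:E)%E.
  (* The weight c = 2^k balances the AM-GM bound: each of its two terms becomes at most 2^-k / 2. *)
  have c0 : 0 < (2 ^+ k : R) by rewrite exprn_gt0.
  apply: le_trans (integral_abs_le_sqr (wL2 k) c0) _.
  have := uC k k.+1 (leqnSn k).
  move=> /(@lee_wpmul2l _ (2 ^+ k / 2)%:E).
  rewrite lee_fin => /(_ (divr_ge0 (ltW c0) (ler0n _ 2))) h.
  apply: le_trans (leeD2r _ h) _.
  rewrite -EFinM -EFinD lee_fin expn4_expr2.
  have ci : (2 ^+ k : R) * 2 ^- k = 1 by rewrite divff// gt_eqF.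
  set a := 2 ^+ k in ci *; set b := a^-1 in ci *.
  have -> : a / 2 * (b * b) = (a * b) * b / 2 by ring.
  by rewrite ci mul1r -splitr.
pose s x := (\sum_(0 <= k <oo) `|w k x|%:E)%E.
have ms : measurable_fun setT s.
  apply: ge0_emeasurable_sum => [k x _ _|k _]; first by rewrite lee_fin.
  by apply/measurable_EFinP; exact/measurableT_comp.
have si : P.-integrable setT s.
  apply/integrableP; split => //.
  under eq_integral do rewrite gee0_abs ?nneseries_ge0//.
  rewrite integral_nneseries//; last first.
    by move=> k; apply/measurable_EFinP; exact/measurableT_comp.
  apply: le_lt_trans geometric_nneseries.
  by apply: lee_nneseries => // k *; apply: integral_ge0 => x _; rewrite lee_fin.
have sfin := integrable_ae measurableT si.
have ucvg : {ae P, forall x, cvgn (u ^~ x)}.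
  apply: filterS sfin => x /(_ Logic.I) sx.
  have : cvgn (series (fun k => w k x)).
    apply: normed_cvg.
    have nd : {homo [normed series (fun k => w k x)] : a b / (a <= b)%N >-> a <= b}.
      apply/nondecreasing_seqP => k.
      by rewrite /normed_series_of/= !seriesEnat/= big_nat_recr//= lerDl.
    apply: nondecreasing_is_cvgn => //.
    exists (fine (s x)) => _ [k _ <-].
    rewrite -lee_fin fineK// /= seriesEnat/= -sumEFin.
    apply: nneseries_lim_ge => //.
  move=> /cvg_ex[l hl]; apply/cvg_ex; exists (l + u 0%N x).
  have -> : u ^~ x = (fun n => series (fun k => w k x) n + u 0%N x).
    by apply/funext => n; rewrite seriesEnat/= telescope_sumr// subrK.
  by apply: cvgD => //; exact: cvg_cst.
(* The lower limit exists everywhere and is measurable; [fine] gives 0 where it is infinite, which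
   happens only on a null set. *)
pose ve x := limn_einf (fun k => (u k x)%:E).
have mve : measurable_fun setT ve.
  by apply: measurable_limn_einf => k; exact/measurable_EFinP.
pose v x := fine (ve x).
have mv : measurable_fun setT v.
  exact: measurableT_comp.
have uv : {ae P, forall x, u ^~ x @ \oo --> v x}.
  apply: filterS ucvg => x cx.
  have cE : (fun k => (u k x)%:E) @ \oo --> (limn (u ^~ x))%:E.
    by apply: cvg_EFin => //; exact: nearW.
  rewrite /v /ve.
  have -> : limn_einf (fun k => (u k x)%:E) = (limn (u ^~ x))%:E.
    by rewrite is_cvg_limn_einfE; [exact/cvg_lim|apply/cvg_ex; eexists; exact: cE].
  by [].
have bnd i : (\int[P]_x ((v x - u i x) ^+ 2)%:E <= (4 ^- i : R)%:E)%E.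
  pose fj j x := ((u j x - u i x) ^+ 2)%:E.
  have mfj j : measurable_fun setT (fj j).
    by apply/measurable_EFinP/measurable_funX/measurable_funB.
  apply: (@le_trans _ _ (\int[P]_x limn_einf (fj ^~ x))%E).
    apply: ae_ge0_le_integral => //.
    - by move=> x _; rewrite lee_fin sqr_ge0.
    - by apply/measurable_EFinP/measurable_funX/measurable_funB.
    - move=> x _; rewrite limn_einf_lim; apply: lime_ge; first exact: is_cvg_einfs.
      apply: nearW => k; apply: le_ereal_inf_tmp => _ [j /= _ <-].
      by rewrite lee_fin sqr_ge0.
    - exact: measurable_limn_einf.
    - apply: filterS uv => x ux _.
      have cE : fj ^~ x @ \oo --> ((v x - u i x) ^+ 2)%:E.
        apply: cvg_EFin; first exact: nearW.
        apply: (@cvg_comp _ _ _ _ (fun y => y ^+ 2)); last exact: exprn_continuous.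
        by apply: cvgB => //; exact: cvg_cst.
      rewrite is_cvg_limn_einfE; last by apply/cvg_ex; eexists; exact: cE.
      by rewrite (cvg_lim _ cE).
  have fj0 j x : [set: T] x -> (0 <= fj j x)%E.
    by move=> _; rewrite lee_fin sqr_ge0.
  apply: (le_trans (fatou P measurableT mfj fj0)).
  rewrite limn_einf_lim; apply: lime_le; first exact: is_cvg_einfs.
  (* The index [maxn i k] is at least k, as the tail infimum requires, and at least i, as the Cauchy
     bound requires. *)
  apply: nearW => k; apply: (@le_trans _ _ (\int[P]_x fj (maxn i k) x)%E).
    by apply: ereal_inf_lbound; exists (maxn i k) => //=; rewrite leq_maxr.
  by apply: uC; rewrite leq_maxl.
exists v => //.
have -> : v = (v - u 0%N) + u 0%N by rewrite subrK.
have p1 : (1 <= 2%:E :> \bar R)%E by rewrite lee1n.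
apply: (Lfun_addr_closed P p1).2 (uL2 0%N).
apply/Lfun2P; split; first exact: measurable_funB.
apply/integrableP; split.
  by apply/measurable_EFinP/measurable_funX/measurable_funB.
under eq_integral do rewrite gee0_abs ?lee_fin ?sqr_ge0//.
by apply: le_lt_trans (bnd 0%N) _; rewrite ltry.
Qed.

End RealLp.

(** * Complex-valued functions on the circle *)

Section CircleAe.
Context {R : realType}.
Local Notation mu := (circ R).
#[global] Instance circ_ae_filter : Filter (nbhs (almost_everywhere mu)).
Proof. exact: (@ae_filter_ringOfSetsType _ _ R mu).
Qed.
(** Properness, which comes from the total mass 1, is what lets [filter_ex] pick a point where
    several almost-everywhere identities hold at once. *)
#[global] Instance circ_ae_pfilter : ProperFilter (nbhs (almost_everywhere mu)).
Proof. 
apply: ae_properfilter_algebraOfSetsType.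
by rewrite [X in (_ < X)%E](@probability_setT _ _ _ mu).
Qed.
End CircleAe.

Section Conjugate.
Context {R : rcfType}.
Implicit Types x y : R[i].

Lemma conjcM x y : conjc (x * y) = conjc x * conjc y.
Proof. exact: (rmorphM (@conjc R)). Qed.

Lemma conjcD x y : conjc (x + y) = conjc x + conjc y.
Proof. exact: (rmorphD (@conjc R)). Qed.

Lemma conjcN x : conjc (- x) = - conjc x.
Proof. exact: (rmorphN (@conjc R)). Qed.

Lemma conjcX x n : conjc (x ^+ n) = conjc x ^+ n.
Proof. exact: (rmorphXn (@conjc R)). Qed.

End Conjugate.

Section ComplexLp.
Context {R : realType}.
Implicit Types (f g h : R -> R[i]) (c : R[i]) (p : \bar R).
Local Notation mu := (circ R).

Lemma le1_2 : (1 <= 2%:E :> \bar R)%E. Proof. by rewrite lee1n. Qed.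
Lemma le1_y : (1 <= +oo :> \bar R)%E. Proof. by rewrite leey. Qed.

Lemma LpD p f g : (1 <= p)%E -> Lp p f -> Lp p g -> Lp p (fun t => f t + g t).
Proof.
move=> p1 [fr fi] [gr gi].
split.
  rewrite (_ : (fun t => _) = (fun t => complex.Re (f t)) + (fun t => complex.Re (g t))).
    exact: (Lfun_addr_closed mu p1).2 _ _ fr gr.
  by apply/funext => t; rewrite raddfD.
rewrite (_ : (fun t => _) = (fun t => complex.Im (f t)) + (fun t => complex.Im (g t))).
  exact: (Lfun_addr_closed mu p1).2 _ _ fi gi.
by apply/funext => t; rewrite raddfD.
Qed.

Lemma LpN p f : (1 <= p)%E -> Lp p f -> Lp p (fun t => - f t).
Proof.
move=> p1 [fr fi]; split.
  rewrite (_ : (fun t => _) = - (fun t => complex.Re (f t))).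
    exact: (@Lfun_oppr_closed _ _ _ mu _).
  by apply/funext => t; rewrite raddfN.
rewrite (_ : (fun t => _) = - (fun t => complex.Im (f t))).
  exact: (@Lfun_oppr_closed _ _ _ mu _).
by apply/funext => t; rewrite raddfN.
Qed.

Lemma LpB p f g : (1 <= p)%E -> Lp p f -> Lp p g -> Lp p (fun t => f t - g t).
Proof. by move=> p1 Lf Lg; apply: LpD => //; exact: LpN. Qed.

Lemma Lp_conj p f : (1 <= p)%E -> Lp p f -> Lp p (fun t => conjc (f t)).
Proof.
move=> p1 [fr fi]; split.
  by rewrite (_ : (fun t => _) = (fun t => complex.Re (f t)))//; apply/funext => t; case: (f t).
rewrite (_ : (fun t => _) = - (fun t => complex.Im (f t))).
  exact: (@Lfun_oppr_closed _ _ _ mu _).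
by apply/funext => t; rewrite opprfctE; case: (f t).
Qed.

Lemma Lp_cst c : Lp +oo (fun=> c).
Proof.
have cst_y (x : R) : (fun=> x) \in Lfun mu +oo%E.
  apply/(LfunyP mu); split; first exact: measurable_cst.
  by exists `|x|; exact: nearW.
by split; exact: cst_y.
Qed.

Lemma ReM (x y : R[i]) : complex.Re (x * y) =
  complex.Re x * complex.Re y - complex.Im x * complex.Im y.
Proof. by case: x y => [a b] [x y]. Qed.

Lemma ImM (x y : R[i]) : complex.Im (x * y) =
  complex.Re x * complex.Im y + complex.Im x * complex.Re y.
Proof. by case: x y => [a b] [x y]; rewrite /= addrC. Qed.

(** Kept generic in the exponents so that the four product rules below reduce to their real
    counterparts. *)
Lemma LpM_gen (p q r : \bar R) f g : (1 <= r)%E ->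
  (forall u v : R -> R, u \in Lfun mu p -> v \in Lfun mu q -> u \* v \in Lfun mu r) ->
  Lp p f -> Lp q g -> Lp r (fun t => f t * g t).
Proof.
move=> r1 H [fr fi] [gr gi]; split.
  rewrite (_ : (fun t => _) =
    (fun t => complex.Re (f t)) \* (fun t => complex.Re (g t)) +
    - ((fun t => complex.Im (f t)) \* (fun t => complex.Im (g t)))).
    apply: (Lfun_addr_closed mu r1).2; first exact: H.
    by apply: (@Lfun_oppr_closed _ _ _ mu _); exact: H.
  by apply/funext => t; rewrite ReM.
rewrite (_ : (fun t => _) =
    (fun t => complex.Re (f t)) \* (fun t => complex.Im (g t)) +
    ((fun t => complex.Im (f t)) \* (fun t => complex.Re (g t)))).
  by apply: (Lfun_addr_closed mu r1).2; exact: H.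
by apply/funext => t; rewrite ImM.
Qed.

Lemma LpyM f g : Lp +oo f -> Lp +oo g -> Lp +oo (fun t => f t * g t).
Proof. by apply: (@LpM_gen +oo +oo +oo); [exact: le1_y|exact: (@LfunyM _ _ R mu)]. Qed.

Lemma LpyM1 f g : Lp +oo f -> Lp 1 g -> Lp 1 (fun t => f t * g t).
Proof. by apply: (@LpM_gen +oo 1 1); [exact: lexx|exact: (@LfunyM1 _ _ R mu)]. Qed.

Lemma LpyM2 f g : Lp +oo f -> Lp 2%:E g -> Lp 2%:E (fun t => f t * g t).
Proof. by apply: (@LpM_gen +oo 2%:E 2%:E); [exact: le1_2|exact: (@LfunyM2 _ _ R mu)]. Qed.

Lemma Lp2M f g : Lp 2%:E f -> Lp 2%:E g -> Lp 1 (fun t => f t * g t).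
Proof. by apply: (@LpM_gen 2%:E 2%:E 1); [exact: lexx|exact: (@Lfun2_mul_Lfun1 _ _ R mu)]. Qed.

Lemma LpyW2 f : Lp +oo f -> Lp 2%:E f.
Proof. by case=> fr fi; split; exact: LfunyW2. Qed.

Lemma Lp2W1 f : Lp 2%:E f -> Lp 1 f.
Proof. by case=> fr fi; split; exact: Lfun2W1. Qed.

Lemma LpyW1 f : Lp +oo f -> Lp 1 f.
Proof. by move=> /LpyW2 /Lp2W1. Qed.

Lemma Lp_sum p (I : Type) (r : seq I) (Q : pred I) (F : I -> R -> R[i]) :
  (1 <= p)%E -> (forall i, Q i -> Lp p (F i)) ->
  Lp p (fun t => \sum_(i <- r | Q i) F i t).
Proof.
move=> p1 HF; elim: r => [|i r IH].
  under eq_fun do rewrite big_nil.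
  split; rewrite (_ : (fun t => _) = 0) //; exact: (Lfun_addr_closed mu p1).1.
under eq_fun do rewrite big_cons.
case Qi: (Q i) => //; apply: LpD => //; exact: HF.
Qed.

Lemma Lp1_integrable f : Lp 1 f ->
  mu.-integrable setT (EFin \o (fun t => complex.Re (f t))) /\
  mu.-integrable setT (EFin \o (fun t => complex.Im (f t))).
Proof. by case=> /Lfun1_integrable fr /Lfun1_integrable fi. Qed.

Lemma cintegralD f g : Lp 1 f -> Lp 1 g ->
  cintegral (fun t => f t + g t) = cintegral f + cintegral g.
Proof.
move=> /Lp1_integrable[fr fi] /Lp1_integrable[gr gi].
rewrite /cintegral; under eq_Rintegral do rewrite raddfD.
under [X in _ +i* X]eq_Rintegral do rewrite raddfD.
by rewrite !RintegralD.
Qed.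

Lemma cintegralZ c f : Lp 1 f -> cintegral (fun t => c * f t) = c * cintegral f.
Proof.
move=> /Lp1_integrable[fr fi].
rewrite /cintegral; under eq_Rintegral do rewrite ReM.
under [X in _ +i* X]eq_Rintegral do rewrite ImM.
have Zi (x : R) (u : R -> R) : mu.-integrable setT (EFin \o u) ->
    mu.-integrable setT (EFin \o (fun t => x * u t)).
  by move=> ui; exact: (integrableZl measurableT x ui).
rewrite RintegralB ?RintegralD ?RintegralZl//; try exact: Zi.
by case: c => a b; rewrite /=; congr (_ +i* _); rewrite addrC.
Qed.

Lemma cintegralN f : Lp 1 f -> cintegral (fun t => - f t) = - cintegral f.
Proof.
move=> f1; rewrite -mulN1r -cintegralZ//.
by under [in RHS]eq_fun do rewrite mulN1r.
Qed.

Lemma cintegral0 : cintegral (fun=> 0 : R[i]) = 0.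
Proof.
by rewrite /cintegral /= !Rintegral_cst//= !mul0r.
Qed.

Lemma cintegral_sum (I : Type) (r : seq I) (Q : pred I) (F : I -> R -> R[i]) :
  (forall i, Q i -> Lp 1 (F i)) ->
  cintegral (fun t => \sum_(i <- r | Q i) F i t) =
  \sum_(i <- r | Q i) cintegral (F i).
Proof.
move=> HF; elim: r => [|i r IH].
  by under eq_fun do rewrite big_nil; rewrite big_nil cintegral0.
under eq_fun do rewrite big_cons; rewrite big_cons.
case Qi: (Q i) => //; rewrite cintegralD ?IH//; first exact: HF.
exact: Lp_sum.
Qed.

Lemma cintegral_conj f : Lp 1 f ->
  cintegral (fun t => conjc (f t)) = conjc (cintegral f).
Proof.
move=> /Lp1_integrable[fr fi]; rewrite /cintegral /=; congr (_ +i* _).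
  by apply: eq_Rintegral => t _; case: (f t).
rewrite -mulN1r -RintegralZl//.
by apply: eq_Rintegral => t _; case: (f t) => a b; rewrite mulN1r.
Qed.

Lemma ae_cintegral f g : Lp 1 f -> Lp 1 g -> f = g %[ae mu] ->
  cintegral f = cintegral g.
Proof.
move=> [/Lfun_measurable fr /Lfun_measurable fi] [/Lfun_measurable gr /Lfun_measurable gi] fg.
rewrite /cintegral /Rintegral; congr (fine _ +i* fine _).
  apply: ae_eq_integral => //; [exact/measurable_EFinP|exact/measurable_EFinP|].
  by apply: filterS fg => t /(_ Logic.I) -> .
apply: ae_eq_integral => //; [exact/measurable_EFinP|exact/measurable_EFinP|].
by apply: filterS fg => t /(_ Logic.I) -> .
Qed.

Lemma integrable_norm2 f : Lp 2%:E f ->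
  mu.-integrable setT (EFin \o (fun t => complex.Re (f t) ^+ 2 + complex.Im (f t) ^+ 2)).
Proof.
move=> [/Lfun2_integrable_sqr fr /Lfun2_integrable_sqr fi].
exact: (integrableD measurableT fr fi).
Qed.

Lemma cintegral_norm2 f : Lp 2%:E f -> cintegral (fun t => f t * conjc (f t)) =
  (\int[mu]_t (complex.Re (f t) ^+ 2 + complex.Im (f t) ^+ 2))%:C.
Proof.
move=> f2; rewrite /cintegral; congr (_ +i* _).
  by apply: eq_Rintegral => t _; rewrite ReM; case: (f t) => a b /=; rewrite mulrN opprK !expr2.
rewrite -[RHS](_ : \int[mu]_t (0 : R) = 0); last by rewrite Rintegral_cst//= mul0r.
by apply: eq_Rintegral => t _; rewrite ImM; case: (f t) => a b /=; rewrite mulrN mulrC addNr.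
Qed.

Lemma cintegral_norm2_ge0 f : Lp 2%:E f -> 0 <= cintegral (fun t => f t * conjc (f t)).
Proof.
move=> f2; rewrite cintegral_norm2// lecR; apply: Rintegral_ge0 => t _.
by rewrite addr_ge0// sqr_ge0.
Qed.

Lemma cintegral_norm2_eq0 f : Lp 2%:E f -> cintegral (fun t => f t * conjc (f t)) = 0 ->
  f = cst 0 %[ae mu].
Proof.
move=> f2; rewrite cintegral_norm2// => -[] h0.
have fi := integrable_norm2 f2.
have ge0 t : 0 <= complex.Re (f t) ^+ 2 + complex.Im (f t) ^+ 2.
  by rewrite addr_ge0 ?sqr_ge0.
have := Rintegral_eq0_ae fi ge0 h0.
apply: filterS => t /= /eqP; rewrite paddr_eq0 ?sqr_ge0// !sqrf_eq0 => /andP[/eqP a /eqP b] _.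
by move: a b; case: (f t) => a b /= -> ->.
Qed.

End ComplexLp.

(** * Uniqueness of Fourier coefficients *)

Section StepApproximation.
Context {R : realType}.
Implicit Types (u r s x : R) (k n : nat).

Lemma bernoulli_ge x n : 0 <= x -> 1 + n%:R * x <= (1 + x) ^+ n.
Proof.
move=> x0; elim: n => [|n IH]; first by rewrite mul0r addr0 expr0.
rewrite exprS (le_trans _ (ler_wpM2l _ IH)) ?addr_ge0//.
rewrite -natr1.
have : 0 <= n%:R * x * x by rewrite !mulr_ge0.
lra.
Qed.

Lemma bernoulli_le x n : 0 <= x <= 1 -> 1 - n%:R * x <= (1 - x) ^+ n.
Proof.
move=> /andP[x0 x1]; elim: n => [|n IH]; first by rewrite mul0r subr0 expr0.
rewrite exprS (le_trans _ (ler_wpM2l _ IH)) ?subr_ge0//.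
rewrite -natr1.
have : 0 <= n%:R * x * x by rewrite !mulr_ge0.
lra.
Qed.

(** The midpoint s = (1 + r) / 2 satisfies r <= s^2, so k r^k <= (k s^k) s^k, and Bernoulli's
    inequality for 1/s bounds k s^k by s / (1 - s). *)
Lemma cvg_natr_expr r : 0 <= r < 1 -> (fun k => k%:R * r ^+ k) @ \oo --> (0 : R).
Proof.
move=> /andP[r0 r1]; pose s := (1 + r) / 2.
have s0 : 0 < s by rewrite divr_gt0// ltr_wpDr.
have s1 : s < 1 by rewrite /s; lra.
have rs : r <= s * s.
  have := sqr_ge0 ((1 - r) / 2); rewrite /s expr2; lra.
apply: (@squeeze_cvgr _ _ _ _ (cst 0) (fun k => s / (1 - s) * s ^+ k)).
- apply: nearW => k; rewrite mulr_ge0 ?exprn_ge0//=.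
  apply: (@le_trans _ _ (k%:R * (s ^+ k * s ^+ k))).
    rewrite ler_wpM2l// -exprMn; apply: lerXn2r => //.
    by rewrite nnegrE mulr_ge0// ltW.
  rewrite mulrA ler_wpM2r ?(exprn_ge0 _ (ltW s0))//.
  have := @bernoulli_ge (s^-1 - 1) k.
  rewrite subr_ge0 invf_ge1// (ltW s1) => /(_ isT).
  rewrite [in leRHS]addrC subrK exprVn => h.
  have {}h : k%:R * (s^-1 - 1) <= (s ^+ k)^-1 by apply: le_trans h; lra.
  have sk : 0 < s ^+ k by rewrite exprn_gt0.
  have {}h : k%:R * (s^-1 - 1) * s ^+ k <= 1.
    by rewrite -[leRHS](mulVf (lt0r_neq0 sk)) ler_wpM2r// ltW.
  rewrite ler_pdivlMr ?subr_gt0//.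
  have -> : k%:R * s ^+ k * (1 - s) = s * (k%:R * (s^-1 - 1) * s ^+ k).
    by field; rewrite gt_eqF.
  by rewrite -[leRHS]mulr1 ler_wpM2l// ltW.
- exact: cvg_cst.
- rewrite -[X in _ --> X](mulr0 (s / (1 - s))).
  by apply: cvgMr; apply: cvg_expr; rewrite ger0_norm// ltW.
Qed.

(* Polynomials in [u] with values in [0, 1] that converge to the indicator of
   [u < 1/2], as in the proof of the Stone-Weierstrass theorem. *)
Lemma cvg_step u : 0 <= u <= 1 ->
  (fun k => (1 - u ^+ k) ^+ (k * 2 ^ k)) @ \oo --> ((u < 2^-1)%R%:R : R).
Proof.
move=> /andP[u0 u1].
have uk0 k : 0 <= u ^+ k by rewrite exprn_ge0.
have uk1 k : u ^+ k <= 1 by rewrite exprn_ile1.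
(* The exponent n = k 2^k makes n u^k equal to k (2u)^k, which tends to 0 for u < 1/2 and is at
   least k for u >= 1/2. In the first case Bernoulli bounds the power below by 1 - n u^k. In the
   second, with x = 2^-k, (1 - x)^n <= 1 / (1 + x)^n <= 1 / (1 + n x) = 1 / (k + 1). *)
case: ltP => [ult|uge].
  apply: (@squeeze_cvgr _ _ _ _ (fun k => 1 - k%:R * (2 * u) ^+ k) (cst 1)).
  - apply: nearW => k; apply/andP; split; last by rewrite exprn_ile1// ?subr_ge0// gerBl.
    apply: le_trans (bernoulli_le _ _); last by rewrite uk0 uk1.
    by rewrite natrM natrX exprMn mulrA.
  - rewrite -[X in _ --> X](subr0 1); apply: cvgB; first exact: cvg_cst.
    by apply: cvg_natr_expr; rewrite mulr_ge0//=; lra.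
  - exact: cvg_cst.
apply: (@squeeze_cvgr _ _ _ _ (cst 0) (fun k => (k.+1%:R)^-1)).
- apply: nearW => k; rewrite exprn_ge0 ?subr_ge0//=.
  set n := (k * 2 ^ k)%N; set x := (2^-1 : R) ^+ k.
  have x0 : 0 <= x by rewrite exprn_ge0// invr_ge0.
  have x1 : x <= 1 by rewrite exprn_ile1// ?invr_ge0// invf_le1// ler1n.
  have xu : x <= u ^+ k by apply: lerXn2r; rewrite ?nnegrE ?invr_ge0.
  have n1 : (1 - u ^+ k) ^+ n <= (1 - x) ^+ n.
    by apply: lerXn2r; rewrite ?nnegrE ?subr_ge0// lerD2l lerN2.
  apply: le_trans n1 _.
  have nx : n%:R * x = k%:R.
    by rewrite /n /x natrM natrX exprVn mulfK// expf_neq0.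
  rewrite -[leRHS]mul1r ler_pdivlMr ?ltr0Sn//.
  rewrite -nat1r -nx.
  apply: (@le_trans _ _ ((1 - x) ^+ n * (1 + x) ^+ n)).
    by rewrite ler_wpM2l ?bernoulli_ge// exprn_ge0// subr_ge0.
  rewrite -exprMn exprn_ile1//; first by rewrite mulr_ge0 ?subr_ge0 ?addr_ge0.
  have : 0 <= x * x by rewrite mulr_ge0.
  lra.
- exact: cvg_cst.
- exact: cvg_harmonic.
Qed.

(** The bound 2 pi - d stops x before the cosine rises above cos d again, so that the inequality
    singles out one arc. *)
Lemma cos_gt_cos x d : 0 < d <= pi -> `|x| <= 2 * pi - d ->
  (cos d < cos x) = (`|x| < d).
Proof.
move=> /andP[d0 dpi]; have -> : cos x = cos `|x|.
  by case: (ger0P x) => // _; rewrite cosN.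
move: `|x| (normr_ge0 x) => {}x x0 xd.
have [xpi|pix] := leP x pi.
  by rewrite ltr_cos// in_itv/= ?x0// (ltW d0).
have -> : cos x = cos (2 * pi - x).
  rewrite -[RHS]cosN opprB -[in LHS](subrK (2 * pi) x).
  by rewrite mulr_natl cosD2pi.
rewrite ltr_cos; last 2 first.
- rewrite in_itv/= subr_ge0; apply/andP; split.
    by rewrite (le_trans xd)// gerBl ltW.
  lra.
- by rewrite in_itv/= (ltW d0).
have -> : (x < d) = false by apply/negbTE; rewrite -leNgt (le_trans dpi)// ltW.
apply/negbTE; rewrite -leNgt; lra.
Qed.

End StepApproximation.

Section BoundedLimit.
Context {d : measure_display} {T : measurableType d} {R : realType}.
Variable P : probability T R.

(** Dominated convergence with majorant |f|. It carries the annihilation of trigonometric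
    polynomials over to indicators of arcs. *)
Lemma Rintegral_bounded_cvg (f : T -> R) (g : nat -> T -> R) (h : T -> R) :
  P.-integrable setT (EFin \o f) ->
  (forall k, measurable_fun setT (g k)) ->
  measurable_fun setT h ->
  (forall k x, `|g k x| <= 1) ->
  {ae P, forall x, g ^~ x @ \oo --> h x} ->
  (forall k, \int[P]_x (f x * g k x) = 0) ->
  \int[P]_x (f x * h x) = 0.
Proof.
move=> fi mg mh g1 gh fg0.
have mf : measurable_fun setT f by apply/measurable_EFinP; exact: (measurable_int _ fi).
have fabs : P.-integrable setT (fun x => `|f x|%:E).
  by move: (integrable_abse fi).
have fgi k : P.-integrable setT (EFin \o (fun x => f x * g k x)).
  apply: (le_integrable measurableT _ _ fi).
    by apply/measurable_EFinP; exact: measurable_funM.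
  by move=> x _; rewrite /= lee_fin normrM ler_piMr.
have mfh : measurable_fun setT (fun x => (f x * h x)%:E).
  by apply/measurable_EFinP; exact: measurable_funM.
have cfg : {ae P, forall x, setT x ->
    (fun k => (f x * g k x)%:E) @ \oo --> (f x * h x)%:E}.
  apply: filterS gh => x gx _; apply: cvg_EFin; first exact: nearW.
  by apply: cvgM => //; exact: cvg_cst.
have dfg : {ae P, forall x k, setT x -> (`|(f x * g k x)%:E| <= `|f x|%:E)%E}.
  by apply: nearW => x k _; rewrite /= lee_fin normrM ler_piMr.
have [_ _ ] := @dominated_convergence _ _ R P setT measurableT
  (fun k x => (f x * g k x)%:E) (fun x => (f x * h x)%:E) (fun x => `|f x|%:E)
  (fun k => measurable_int _ (fgi k)) mfh cfg fabs dfg.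
have -> : [sequence (\int[P]_(x in [set: T]) (f x * g n x)%:E)%E]_n = cst 0%E.
  apply/funext => k /=.
  rewrite -[LHS]fineK; last exact: (integrable_fin_num measurableT (fgi k)).
  by move: (fg0 k); rewrite /Rintegral => ->.
move=> H; rewrite /Rintegral.
have -> // : (\int[P]_x (f x * h x)%:E = 0)%E.
by apply: (cvg_unique _ H (cvg_cst _)).
Qed.

End BoundedLimit.

(** * Characters of the circle; normalized measure against Lebesgue measure *)

Section Characters.
Context {R : realType}.
Implicit Types (f g h : R -> R[i]) (i j k : int) (t : R).
Local Notation mu := (circ R).
Local Notation leb := (@lebesgue_measure R).

Lemma zpowD i j t : zpow (i + j) t = zpow i t * zpow j t.
Proof.
rewrite /zpow rmorphD /= mulrDl cosD sinD; congr (_ +i* _).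
by rewrite addrC.
Qed.

Lemma zpow0 t : zpow 0 t = 1.
Proof. by rewrite /zpow mul0r cos0 sin0. Qed.

Lemma zpow_conj j t : conjc (zpow j t) = zpow (- j) t.
Proof. by rewrite /zpow rmorphN /= mulNr cosN sinN. Qed.

Lemma zpowVr j t : zpow j t * zpow (- j) t = 1.
Proof. by rewrite -zpowD subrr zpow0. Qed.

Lemma Lpy_zpow j : Lp +oo (zpow j : R -> R[i]).
Proof.
have m (c : R -> R) : continuous c -> (forall x, `|c x| <= 1) ->
    (fun t => c (j%:~R * t)) \in Lfun mu +oo%E.
  move=> cc c1; apply/(LfunyP mu); split.
    apply: continuous_measurable_fun => x.
    apply: (@continuous_comp _ _ _ (fun t : R => j%:~R * t) c); last exact: cc.
    exact: mulrl_continuous.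
  by exists 1; apply: nearW => t.
split; first exact: (m _ (@continuous_cos R) (@cos_max R)).
exact: (m _ (@continuous_sin R) (@sin_max R)).
Qed.

Lemma circ_integrable (f : R -> R) : mu.-integrable setT (EFin \o f) ->
  leb.-integrable `[0, 2 * pi] (EFin \o f).
Proof.
move=> /integrableP[mf foo]; apply/integrableP; split.
  exact: measurable_funTS.
move: foo; rewrite integral_uniform//; last exact: measurableT_comp.
have c0 : (0 < (2 * pi - 0 : R)^-1).
  by rewrite subr0 invr_gt0 pi2_gt0.
rewrite muleC -lte_pdivlMr// => h; apply: (lt_le_trans h).
by rewrite leey.
Qed.

Lemma circ_Rintegral (f : R -> R) : mu.-integrable setT (EFin \o f) ->
  \int[mu]_t f t = (2 * pi)^-1 * \int[leb]_(t in `[0, 2 * pi]) f t.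
Proof.
move=> fi; have li := circ_integrable fi.
have mf := measurable_int _ fi.
rewrite /Rintegral integralE (@integralE _ _ _ leb).
rewrite !integral_uniform//; last 2 first.
- exact: measurable_funeneg.
- exact: measurable_funepos.
have /fineK <- : (\int[leb]_(x in `[0%R, (2 * pi)%R]) (fun x => (f x)%:E)^\+ x)%E \is a fin_num.
  by apply: integrable_fin_num => //; exact: integrable_funepos.
have /fineK <- : (\int[leb]_(x in `[0%R, (2 * pi)%R]) (fun x => (f x)%:E)^\- x)%E \is a fin_num.
  by apply: integrable_fin_num => //; exact: integrable_funeneg.
by rewrite subr0 /= mulrBr.
Qed.

Lemma circ_ae_itv : {ae mu, forall t, 0 <= t <= 2 * pi}.
Proof.
have E : [set t | 0 <= t <= 2 * pi] = `[0, 2 * pi : R]%classic.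
  by apply/seteqP; split => x /=; rewrite in_itv.
apply/negligibleP; rewrite E; first exact: measurableC.
transitivity (uniform_prob (pi2_gt0 R) (~` `[0, 2 * pi]%classic)) => //.
by rewrite /uniform_prob integral_uniform_pdf setICl integral_set0.
Qed.

Lemma ae_leb_circ (Q : R -> Prop) : {ae leb, forall t, Q t} -> {ae mu, forall t, Q t}.
Proof.
move=> [N [mN N0 QN]]; exists N; split => //.
have /null_content_dominatesP := @dominates_uniform_prob R _ _ (pi2_gt0 R).
exact.
Qed.

End Characters.

(** * Fourier coefficients of integrable functions *)

Section Fourier.
Context {R : realType}.
Implicit Types (f g h : R -> R[i]) (j k : int) (t : R).
Local Notation mu := (circ R).
Local Notation leb := (@lebesgue_measure R).

Lemma Rintegral_circ_derive (F f : R -> R) : (forall t, is_derive t 1 F (f t)) ->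
  continuous f -> mu.-integrable setT (EFin \o f) -> F (2 * pi) = F 0 ->
  \int[mu]_t f t = 0.
Proof.
move=> Ff cf fi F0; rewrite circ_Rintegral// /Rintegral.
rewrite (continuous_FTC2 (F := F)) ?F0 ?pi2_gt0//.
- by rewrite -EFinB subrr /= mulr0.
- exact: continuous_subspaceT.
- have cF t : {for t, continuous F}.
    by apply/differentiable_continuous/derivable1_diffP; case: (Ff t).
  split.
  + by move=> t _; case: (Ff t).
  + by apply: cvg_at_right_filter; exact: cF.
  + by apply: cvg_at_left_filter; exact: cF.
- by move=> t _; rewrite derive1E; case: (Ff t).
Qed.

Lemma cintegral1 : cintegral (fun=> 1 : R[i]) = 1.
Proof.
rewrite /cintegral /= /Rintegral !(@integral_cst_prob _ _ R mu).
by [].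
Qed.

Lemma cintegral_zpow j : cintegral (zpow j : R -> R[i]) = (j == 0)%:R.
Proof.
have [->|j0] := eqVneq j 0.
  by rewrite (_ : zpow 0 = fun=> 1) ?cintegral1//; apply/funext => t; exact: zpow0.
have jR : (j%:~R : R) != 0 by rewrite intr_eq0.
have [ri ii] := Lp1_integrable (LpyW1 (@Lpy_zpow R j)).
have dlin t : is_derive t 1 (fun t : R => j%:~R * t) (j%:~R).
  apply: is_derive_eq (is_deriveZ (f := id) (j%:~R : R) (is_derive_id t 1)) _.
  by rewrite /GRing.scale /= mulr1.
have per (c : R -> R) : periodic c (pi *+ 2) -> c (j%:~R * (2 * pi)) = c 0.
  move=> pc; have -> : (j%:~R : R) * (2 * pi) = pi *+ 2 *~ j.
    by rewrite mulrzl mulr_natl.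
  case: j {j0 jR ri ii dlin} => n /=; first by rewrite -(periodicn pc n 0) add0r -pmulrn.
  by rewrite NegzE mulrNz -pmulrn -[LHS](periodicn pc n.+1) addNr.
have cmul : continuous (fun t : R => j%:~R * t) by exact: mulrl_continuous.
have Zj (x : R) : (j%:~R)^-1 * (x * j%:~R) = x by rewrite mulrCA mulVf ?mulr1.
have cE : \int[mu]_t cos (j%:~R * t) = 0.
  apply: (@Rintegral_circ_derive (fun t => (j%:~R)^-1 * sin (j%:~R * t))).
  - move=> t; apply: is_derive_eq (is_deriveZ (j%:~R^-1 : R)
      (is_derive1_comp (is_derive_sin (j%:~R * t)) (dlin t))) _.
    by rewrite /GRing.scale /= Zj.
  - move=> t; apply: continuous_comp; [exact: cmul|exact: continuous_cos].
  - exact: ri.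
  - by rewrite (per _ (@sinD2pi R)) mulr0.
have sE : \int[mu]_t sin (j%:~R * t) = 0.
  apply: (@Rintegral_circ_derive (fun t => - (j%:~R)^-1 * cos (j%:~R * t))).
  - move=> t; apply: is_derive_eq (is_deriveZ (- j%:~R^-1 : R)
      (is_derive1_comp (is_derive_cos (j%:~R * t)) (dlin t))) _.
    by rewrite /GRing.scale /= mulNr mulNr mulrN opprK Zj.
  - move=> t; apply: continuous_comp; [exact: cmul|exact: continuous_sin].
  - exact: ii.
  - by rewrite (per _ (@cosD2pi R)) mulr0.
by rewrite /cintegral cE sE.
Qed.

Lemma Lp1_zpow f k : Lp 1 f -> Lp 1 (fun t => f t * zpow k t).
Proof.
move=> f1; under eq_fun do rewrite mulrC.
by apply: LpyM1 => //; exact: Lpy_zpow.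
Qed.

Lemma fourierD f g j : Lp 1 f -> Lp 1 g ->
  fourier (fun t => f t + g t) j = fourier f j + fourier g j.
Proof.
move=> f1 g1; rewrite /fourier; under eq_fun do rewrite mulrDl.
by rewrite cintegralD//; exact: Lp1_zpow.
Qed.

Lemma fourierZ (c : R[i]) f j : Lp 1 f ->
  fourier (fun t => c * f t) j = c * fourier f j.
Proof.
move=> f1; rewrite /fourier; under eq_fun do rewrite -mulrA.
by rewrite cintegralZ//; exact: Lp1_zpow.
Qed.

Lemma fourierN f j : Lp 1 f -> fourier (fun t => - f t) j = - fourier f j.
Proof.
move=> f1; rewrite /fourier; under eq_fun do rewrite mulNr.
by rewrite cintegralN//; exact: Lp1_zpow.
Qed.

Lemma fourierB f g j : Lp 1 f -> Lp 1 g ->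
  fourier (fun t => f t - g t) j = fourier f j - fourier g j.
Proof. by move=> f1 g1; rewrite fourierD ?fourierN//; apply: LpN. Qed.

Lemma fourier_sum (I : Type) (r : seq I) (Q : pred I) (F : I -> R -> R[i]) j :
  (forall i, Q i -> Lp 1 (F i)) ->
  fourier (fun t => \sum_(i <- r | Q i) F i t) j =
  \sum_(i <- r | Q i) fourier (F i) j.
Proof.
move=> HF; rewrite /fourier; under eq_fun do rewrite mulr_suml.
by rewrite cintegral_sum// => i Qi; apply: Lp1_zpow; exact: HF.
Qed.

Lemma fourier_conj f j : Lp 1 f -> fourier (fun t => conjc (f t)) j = conjc (fourier f (- j)).
Proof.
move=> f1; rewrite /fourier -cintegral_conj; last exact: Lp1_zpow.
congr cintegral; apply/funext => t.
by rewrite conjcM zpow_conj opprK.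
Qed.

Lemma fourier_zpow f k j : fourier (fun t => f t * zpow k t) j = fourier f (j - k).
Proof.
rewrite /fourier; under eq_fun do rewrite -mulrA -zpowD.
by rewrite opprB.
Qed.

Lemma fourier_zpow1 k j : fourier (zpow k : R -> R[i]) j = (j == k)%:R.
Proof.
rewrite /fourier; under eq_fun do rewrite -zpowD.
by rewrite cintegral_zpow subr_eq0 eq_sym.
Qed.

Lemma fourier_cst (c : R[i]) j : fourier (fun=> c : R[i]) j = if j == 0 then c else 0.
Proof.
have -> : (fun=> c) = (fun t => c * zpow 0 t).
  by apply/funext => t; rewrite zpow0 mulr1.
rewrite fourierZ; last exact/LpyW1/Lpy_zpow.
by rewrite fourier_zpow1; case: eqP => _; rewrite ?mulr1 ?mulr0.
Qed.

Lemma ae_fourier f g j : Lp 1 f -> Lp 1 g -> f = g %[ae mu] ->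
  fourier f j = fourier g j.
Proof.
move=> f1 g1 fg; apply: ae_cintegral; [exact: Lp1_zpow|exact: Lp1_zpow|].
by apply: filterS fg => t /= ->.
Qed.

End Fourier.

(** * From vanishing coefficients to vanishing integrals over arcs *)

Section Uniqueness.
Context {R : realType}.
Implicit Types (f g h : R -> R[i]) (j : int) (k : nat) (t b : R).
Local Notation mu := (circ R).
Local Notation leb := (@lebesgue_measure R).

Lemma Re_cintegral f (u : R -> R) : Lp 1 f ->
  complex.Re (cintegral (fun t => f t * (u t)%:C)) = \int[mu]_t (complex.Re (f t) * u t).
Proof.
move=> f1; rewrite /cintegral /=; apply: eq_Rintegral => t _.
by rewrite ReM /= mulr0 subr0.
Qed.

Lemma Im_cintegral f (u : R -> R) : Lp 1 f ->
  complex.Im (cintegral (fun t => f t * (u t)%:C)) = \int[mu]_t (complex.Im (f t) * u t).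
Proof.
move=> f1; rewrite /cintegral /=; apply: eq_Rintegral => t _.
by rewrite ImM /= mulr0 add0r.
Qed.

Lemma complexD (a b : R) : (a + b)%:C = a%:C + b%:C :> R[i].
Proof. exact: (rmorphD (real_complex R)). Qed.

Lemma complexM (a b : R) : (a * b)%:C = a%:C * b%:C :> R[i].
Proof. exact: (rmorphM (real_complex R)). Qed.

Lemma cos_zpow t : (cos t)%:C = 2^-1 * (zpow 1 t + zpow (- 1) t) :> R[i].
Proof.
have -> : zpow 1 t + zpow (- 1) t = (2 * cos t)%:C :> R[i].
  rewrite /zpow rmorphN /= mulN1r !mul1r cosN sinN /GRing.add /=.
  by congr (_ +i* _); rewrite ?subrr// mulr_natl mulr2n.
rewrite [RHS](_ : _ = (2^-1 * 2 : R[i]) * (cos t)%:C).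
  by rewrite mulVf ?mul1r// pnatr_eq0.
by rewrite complexM mulrA; congr (_ * _ * _); exact: (rmorph_nat (real_complex R) 2).
Qed.

Lemma zpow_addt j (s t : R) : zpow j (s + t) = zpow j s * zpow j t.
Proof.
by rewrite /zpow mulrDr cosD sinD; congr (_ +i* _); rewrite addrC.
Qed.

Section Annihilator.
Variable f : R -> R[i].
Hypotheses (f1 : Lp 1 f) (f0 : forall j, fourier f j = 0).

(** [Z] collects the bounded g such that all Fourier coefficients of f g vanish. It contains 1 and
    is a module over the trigonometric polynomials, hence contains the polynomials in cos(t - x)
    that approximate a step in [cvg_step]. *)
Let Z g := Lp +oo g /\ forall j, cintegral (fun t => f t * g t * zpow j t) = 0.

Let Z1 : Z (fun=> 1).
Proof.
split=> [|j]; first exact: Lp_cst.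
under eq_fun do rewrite mulr1.
by have := f0 (- j); rewrite /fourier opprK.
Qed.

Let ZD g h : Z g -> Z h -> Z (fun t => g t + h t).
Proof.
move=> [gy g0] [hy h0]; split=> [|j]; first by apply: LpD => //; exact: le1_y.
have L g' : Lp +oo g' -> Lp 1 (fun t => f t * g' t * zpow j t).
  move=> g'y; apply: Lp1_zpow; under eq_fun do rewrite mulrC; exact: LpyM1.
rewrite (_ : (fun t => _) = (fun t => f t * g t * zpow j t + f t * h t * zpow j t)).
  by rewrite cintegralD ?g0 ?h0 ?addr0//; exact: L.
by apply/funext => t; rewrite mulrDr mulrDl.
Qed.

Let ZZ (c : R[i]) g : Z g -> Z (fun t => c * g t).
Proof.
move=> [gy g0]; split=> [|j]; first by apply: LpyM => //; exact: Lp_cst.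
rewrite (_ : (fun t => _) = (fun t => c * (f t * g t * zpow j t))).
  rewrite cintegralZ ?g0 ?mulr0//; apply: Lp1_zpow.
  under eq_fun do rewrite mulrC; exact: LpyM1.
by apply/funext => t; rewrite !mulrA (mulrC (f t)).
Qed.

Let Zzpow (k : int) g : Z g -> Z (fun t => g t * zpow k t).
Proof.
move=> [gy g0]; split=> [|j]; first by apply: LpyM => //; exact: Lpy_zpow.
rewrite -[RHS](g0 (k + j)); congr cintegral; apply/funext => t.
by rewrite zpowD !mulrA.
Qed.

Let Zcos (a b x : R) g : Z g -> Z (fun t => g t * (a + b * cos (t - x))%:C).
Proof.
move=> Zg.
rewrite (_ : (fun t => _) = (fun t => a%:C * g t +
  ((b%:C * 2^-1 * zpow 1 (- x)) * (g t * zpow 1 t) +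
   (b%:C * 2^-1 * zpow (- 1) (- x)) * (g t * zpow (- 1) t)))).
  by apply: ZD; [exact: ZZ|apply: ZD; apply: ZZ; exact: Zzpow].
apply/funext => t; rewrite complexD complexM cos_zpow !zpow_addt.
ring.
Qed.

Let Zpow (a b x : R) k g : Z g -> Z (fun t => g t * ((a + b * cos (t - x)) ^+ k)%:C).
Proof.
move=> Zg; elim: k => [|k IH].
  by under eq_fun do rewrite expr0 mulr1.
under eq_fun do rewrite exprSr complexM mulrA.
exact: Zcos.
Qed.

Let Zstep (a b x : R) k (n : nat) :
  Z (fun t => ((1 - (a + b * cos (t - x)) ^+ k) ^+ n)%:C).
Proof.
elim: n => [|n IH]; first by under eq_fun do rewrite expr0; exact: Z1.
rewrite (_ : (fun t => _) = (fun t => ((1 - (a + b * cos (t - x)) ^+ k) ^+ n)%:C +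
  - 1 * (((1 - (a + b * cos (t - x)) ^+ k) ^+ n)%:C * ((a + b * cos (t - x)) ^+ k)%:C))).
  by apply: ZD => //; apply: ZZ; exact: Zpow.
apply/funext => t; set y := _ ^+ k; rewrite exprSr mulrBr mulr1.
by rewrite complexD mulN1r -complexM; congr (_ + _); exact: (rmorphN (real_complex R)).
Qed.

Let arc b t := \1_(`]0, b[%classic : set R) t : R.

Lemma annihilates_arc b : 0 < b <= 2 * pi ->
  \int[mu]_t (complex.Re (f t) * arc b t) = 0 /\ \int[mu]_t (complex.Im (f t) * arc b t) = 0.
Proof.
move=> /andP[b0 b2].
have [fr fi] := Lp1_integrable f1.
pose x := b / 2; pose c := cos x.
(* An affine function of cos(t - x), x being the midpoint of the arc, with values in [0, 1]. It is
   below 1/2 exactly when cos(t - x) > cos x, which on [0, 2 pi] means |t - x| < x, that is 0 < t <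
   b. *)
pose u t : R := (2 + c) / 4 + (- 4^-1) * cos (t - x).
have u01 t : 0 <= u t <= 1.
  have := cos_max x; have := cos_max (t - x); rewrite !ler_norml -/c /u; lra.
pose g k t := (1 - u t ^+ k) ^+ (k * 2 ^ k).
have cu : continuous u.
  move=> t; apply: cvgD; first exact: cvg_cst.
  apply: cvgM; first exact: cvg_cst.
  apply: (@continuous_comp _ _ _ (fun t => t - x) cos); last exact: continuous_cos.
  by apply: cvgB; [exact: cvg_id|exact: cvg_cst].
have mg k : measurable_fun setT (g k).
  apply: continuous_measurable_fun => t.
  apply: (@continuous_comp _ _ _ (fun t => 1 - u t ^+ k) (fun y => y ^+ (k * 2 ^ k))).
    apply: cvgB; first exact: cvg_cst.
    by apply: (@continuous_comp _ _ _ u (fun y => y ^+ k)); [exact: cu|exact: exprn_continuous].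
  exact: exprn_continuous.
have g1 k t : `|g k t| <= 1.
  have /andP[u0 u1] := u01 t.
  have uk0 : 0 <= u t ^+ k by rewrite exprn_ge0.
  have uk1 : u t ^+ k <= 1 by rewrite exprn_ile1.
  by rewrite ger0_norm ?exprn_ge0 ?exprn_ile1 ?subr_ge0// gerBl.
have ga : {ae mu, forall t, g ^~ t @ \oo --> arc b t}.
  apply: filterS (@circ_ae_itv R) => t /andP[t0 t2].
  have -> : arc b t = (u t < 2^-1)%R%:R; last exact: cvg_step.
  rewrite /arc indicE; congr (nat_of_bool _ )%:R.
  transitivity (cos x < cos (t - x)); last by rewrite /u -/c; apply/idP/idP => ?; lra.
  rewrite cos_gt_cos; last 2 first.
  - by rewrite /x; lra.
  - by rewrite ler_norml /x; lra.
  rewrite mem_setE in_itv/= ltr_norml /x.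
  by apply/idP/idP => ?; lra.
have gZ k : cintegral (fun t => f t * (g k t)%:C) = 0.
  have [_ /(_ 0)] := @Zstep ((2 + c) / 4) (- 4^-1) x k (k * 2 ^ k).
  by under eq_fun do rewrite zpow0 mulr1.
have ma : measurable_fun setT (arc b) by exact: measurable_indic.
split.
  apply: (Rintegral_bounded_cvg fr mg ma g1 ga) => k.
  by rewrite -Re_cintegral// gZ.
apply: (Rintegral_bounded_cvg fi mg ma g1 ga) => k.
by rewrite -Im_cintegral// gZ.
Qed.

End Annihilator.

(** The extension g of f by 0 outside [0, 2 pi] has an identically zero primitive, and by Lebesgue's
    differentiation theorem g is almost everywhere the derivative of that primitive. *)
Lemma ae_eq0_of_arcs (f : R -> R) : mu.-integrable setT (EFin \o f) ->
  (forall b, 0 < b <= 2 * pi -> \int[mu]_t (f t * \1_(`]0, b[%classic : set R) t) = 0) ->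
  {ae mu, forall t, f t = 0}.
Proof.
move=> fi farc.
pose g := f \_ `[0, 2 * pi].
have li := circ_integrable fi.
have gi : leb.-integrable setT (EFin \o g).
  by rewrite /g -restrict_EFin; apply/integrable_restrict => //; rewrite setTI.
have gloc : locally_integrable setT g by exact: integrable_locally.
have gy y : leb.-integrable `]-oo, y] (EFin \o g) by exact: integrableS gi.
have F0 y : \int[leb]_(t in `]-oo, y]) g t = 0.
  have flt : Filter (nbhs (almost_everywhere leb)).
    exact: (ae_filter_ringOfSetsType leb).
  have neq (b : R) : {ae leb, forall t, t != b}.
    exists [set b]; split; [exact: measurable_set1|exact: lebesgue_measure_set1|].
    by move=> t /= /negP; rewrite negbK => /eqP.
  (* For y > 0, integrating g up to y is, apart from the end points, integrating f over the arc ]0,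
     b[; for y <= 0 only the point 0 can contribute. *)
  pose b := Num.min y (2 * pi).
  have mg : measurable_fun setT g by apply/measurable_EFinP; exact: (measurable_int _ gi).
  have mf : measurable_fun setT f by apply/measurable_EFinP; exact: (measurable_int _ fi).
  rewrite Rintegral_mkcond /Rintegral.
  have [y0|y0] := leP y 0.
    rewrite (@ae_eq_integral _ _ _ leb setT (cst 0%E)) ?integral0//.
    - apply/measurable_EFinP; apply/(measurable_restrictT _ _).1 => //.
      exact: measurable_funTS.
    - apply: filterS (neq 0) => t t0 _.
      rewrite /g !patchE !mem_setE !in_itv/=; case: ifP => // ty.
      by rewrite ifF//; apply/negbTE/negP => /andP[t0' _]; move: t0; rewrite eq_le t0' (le_trans ty y0).
  have hb : 0 < b <= 2 * pi by rewrite /b lt_min y0 pi2_gt0/= ge_min lexx orbT.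
  have mfa : measurable_fun setT (fun t => f t * \1_(`]0, b[%classic : set R) t).
    by apply: measurable_funM => //; exact: measurable_indic.
  have := farc b hb; rewrite circ_Rintegral; last first.
    apply: (le_integrable measurableT _ _ fi); first exact/measurable_EFinP.
    move=> t _; rewrite /= lee_fin normrM ler_piMr// indicE.
    by case: (_ \in _); rewrite ?normr1 ?normr0.
  move=> /eqP; rewrite mulf_eq0 invr_eq0 gt_eqF ?pi2_gt0//= => /eqP.
  rewrite Rintegral_mkcond /Rintegral => <-; congr fine.
  apply: ae_eq_integral => //.
  - apply/measurable_EFinP; apply/(measurable_restrictT _ _).1 => //.
    exact: measurable_funTS.
  - apply/measurable_EFinP; apply/(measurable_restrictT _ _).1 => //.
    exact: measurable_funTS.
  - apply: filterS2 (neq 0) (neq b) => t t0 tb _; congr EFin.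
    rewrite /g !patchE !mem_setE !in_itv/= indicE mem_setE in_itv/=.
    have [t2|] := boolP (0 <= t <= 2 * pi); last by case: ifP.
    have [ty|ty] := boolP (t <= y).
      have /andP[t00 t2pi] := t2.
      have tleb : t <= b by rewrite /b le_min ty.
      by rewrite !lt_def t0 t00 eq_sym tb tleb mulr1.
    have by_ : b <= y by rewrite /b ge_min lexx.
    rewrite (_ : (0 < t < b) = false) ?mulr0//.
    apply/negbTE/negP => /andP[_ tltb].
    by move: ty; rewrite (ltW (lt_le_trans tltb by_)).
have := FTC1Ny gy gloc.
rewrite (_ : (fun x => _) = cst 0); last by apply/funext => x; exact: F0.
move=> /ae_leb_circ h.
apply: filterS2 h (@circ_ae_itv R) => t [_] + /andP[t0 t2].
by rewrite derive1_cst /g patchE mem_setE in_itv/= t0 t2 /= => <-.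
Qed.

(** Integrability is all that is assumed, since the lemma is applied to entries of Q^* Q' with Q and
    Q' only square-integrable. *)
Lemma fourier_unique f : Lp 1 f -> (forall j, fourier f j = 0) -> f = cst 0 %[ae mu].
Proof.
move=> f1 f0; have [fr fi] := Lp1_integrable f1.
have r0 := ae_eq0_of_arcs fr (fun b hb => (annihilates_arc f1 f0 hb).1).
have i0 := ae_eq0_of_arcs fi (fun b hb => (annihilates_arc f1 f0 hb).2).
by apply: filterS2 r0 i0 => t; case: (f t) => a b /= -> ->.
Qed.

End Uniqueness.

(** * Orthogonal projection *)

Section Projection.
Context {R : realType} {V : lmodType R[i]}.
Variables (D : set V) (ip : V -> V -> R[i]).
Hypotheses (DD : forall x y, D x -> D y -> D (x + y))
  (DZ : forall a x, D x -> D (a *: x))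
  (ipDl : forall x y z, D x -> D y -> D z -> ip (x + y) z = ip x z + ip y z)
  (ipZl : forall a x z, D x -> D z -> ip (a *: x) z = a * ip x z)
  (ipC : forall x y, D x -> D y -> ip y x = conjc (ip x y))
  (ip_ge0 : forall x, D x -> 0 <= ip x x).
Implicit Types (x y z w h : V) (a : R[i]) (s t : R).

Let N x := complex.Re (ip x x).
Let B x y := complex.Re (ip x y).

Let DN x : D x -> D (- x).
Proof. by move=> Dx; rewrite -scaleN1r; exact: DZ. Qed.

Let DB x y : D x -> D y -> D (x - y).
Proof. by move=> Dx Dy; apply: DD => //; exact: DN. Qed.

Let N_ge0 x : D x -> 0 <= N x.
Proof. by move=> /ip_ge0; rewrite lecE => /andP[]. Qed.

Let BC x y : D x -> D y -> B x y = B y x.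
Proof. by move=> Dx Dy; rewrite /B (ipC Dy Dx); case: (ip y x). Qed.

Let ND x y : D x -> D y -> N (x + y) = N x + N y + 2 * B x y.
Proof.
move=> Dx Dy; have Dxy := DD Dx Dy.
have Nl z : D z -> B (x + y) z = B x z + B y z.
  by move=> Dz; rewrite /B ipDl// raddfD.
rewrite -/(B _ _) -[N _]/(B _ _) Nl// -[N x]/(B x x) -[N y]/(B y y).
rewrite (BC Dx Dxy) (BC Dy Dxy) !Nl// (BC Dy Dx); ring.
Qed.

Let NZ s x : D x -> N (s%:C *: x) = s ^+ 2 * N x.
Proof.
move=> Dx; have Dsx := DZ s%:C Dx.
rewrite /N ipZl// (ipC Dsx Dx) ipZl// conjcM -(ipC Dx Dx) conjc_real.
by rewrite !ReM /= !mul0r !subr0 mulrA expr2.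
Qed.

Let BZ s x y : D x -> D y -> B x (s%:C *: y) = s * B x y.
Proof.
move=> Dx Dy; rewrite (BC Dx (DZ _ Dy)) /B ipZl// ReM /= mul0r subr0.
by rewrite -/(B _ _) BC.
Qed.

Let NN x : D x -> N (- x) = N x.
Proof.
move=> Dx; have -> : - x = (-1)%:C *: x.
  by rewrite (rmorphN (real_complex R)) /= rmorph1 scaleN1r.
by rewrite NZ// sqrrN expr1n mul1r.
Qed.

Let BN x y : D x -> D y -> B x (- y) = - B x y.
Proof.
move=> Dx Dy; have -> : - y = (-1)%:C *: y.
  by rewrite (rmorphN (real_complex R)) /= rmorph1 scaleN1r.
by rewrite BZ// mulN1r.
Qed.

Let NB x y : D x -> D y -> N (x - y) = N x + N y - 2 * B x y.
Proof. by move=> Dx Dy; rewrite ND ?NN ?BN ?mulrN//; exact: DN. Qed.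

Let sqc a := complex.Re a ^+ 2 + complex.Im a ^+ 2.

Let mulcJ a : a * conjc a = (sqc a)%:C.
Proof.
case: a => u v; rewrite /sqc /GRing.mul /=; congr (_ +i* _); first by rewrite mulrN opprK !expr2.
by rewrite mulrN mulrC addNr.
Qed.

Let N_step w h s : D w -> D h ->
  N (w - (s%:C * ip w h) *: h) = N w - 2 * s * sqc (ip w h) + s ^+ 2 * sqc (ip w h) * N h.
Proof.
move=> Dw Dh; set c := ip w h.
have Dch := DZ c Dh.
have Bc : B w (c *: h) = sqc c.
  by rewrite (BC Dw Dch) /B ipZl// (ipC Dw Dh) -/c mulcJ.
have Nc : N (c *: h) = sqc c * N h.
  rewrite /N ipZl// (ipC Dch Dh) ipZl// conjcM -(ipC Dh Dh) mulrA mulcJ ReM.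
  by rewrite /= mul0r subr0.
rewrite -scalerA NB ?NZ ?BZ ?Bc ?Nc//; last exact: DZ.
ring.
Qed.

(** This turns minimality of a distance into orthogonality. The step s = 1 / (1 + n) keeps s n <= 1,
    so the linear term beats the quadratic one, and no division by n, which may be 0, occurs. *)
Let sqc_eq0 a (n : R) : 0 <= n -> (forall s, 0 < s -> 2 * s * sqc a <= s ^+ 2 * sqc a * n) ->
  a = 0.
Proof.
move=> n0; set m := sqc a => H.
have m0 : 0 <= m by rewrite addr_ge0 ?sqr_ge0.
have n1 : 0 < 1 + n by rewrite ltr_pwDl.
have := H (1 + n)^-1; rewrite invr_gt0 => /(_ n1).
set s := (1 + n)^-1 => h.
have s0 : 0 < s by rewrite invr_gt0.
have sn : s * n <= 1.
  by rewrite /s mulrC ler_pdivrMr// mul1r lerDr.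
have {}h : s * m * (2 - s * n) <= 0.
  by move: h; rewrite -subr_le0; congr (_ <= _); ring.
have mE : m = 0.
  apply/eqP; rewrite eq_le m0 andbT.
  move: h; rewrite pmulr_lle0 ?pmulr_rle0//; lra.
move: mE => /eqP; rewrite /m /sqc paddr_eq0 ?sqr_ge0// !sqrf_eq0.
by case: (a) => u v /= /andP[/eqP -> /eqP ->].
Qed.

Let le_of_pow (a b K : R) : (forall k : nat, a <= b + K * 2 ^- k) -> a <= b.
Proof.
move=> H.
have c : (fun k : nat => b + K * 2 ^- k) @ \oo --> b.
  rewrite -[X in _ --> X]addr0; apply: cvgD; first exact: cvg_cst.
  rewrite -[X in _ --> X](mulr0 K); apply: cvgMr.
  under eq_fun do rewrite -exprVn.
  by apply: cvg_expr; rewrite ger0_norm ?invr_ge0// invf_lt1 ?ltr1n.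
rewrite -(cvg_lim (@Rhausdorff R) c); apply: limr_ge; last exact: nearW.
by apply/cvg_ex; exists b.
Qed.

(** Only sequences with Cauchy rate 4^-i are considered, and the limit may lose a constant C: it is
    2 for complex functions, from real and imaginary parts, and 2 n^2 for matrices. Limits are not
    unique, as [ip] need not be definite. *)
Hypothesis complete : forall u : nat -> V, (forall k, D (u k)) ->
  (forall i j, (i <= j)%N -> complex.Re (ip (u j - u i) (u j - u i)) <= 4 ^- i) ->
  exists l C, D l /\ forall i, complex.Re (ip (l - u i) (l - u i)) <= C * 4 ^- i.

(** The subspace is given as an annihilator, so its closedness comes for free: orthogonality to each
    g passes to limits. The projection is the limit of a minimizing sequence, which is Cauchy by the
    parallelogram law. *)
Lemma projection_annihilator (G : set V) x : G `<=` D -> D x ->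
  let S := [set y | D y /\ forall g, G g -> ip y g = 0] in
  exists2 y, S y & forall h, S h -> ip (x - y) h = 0.
Proof.
move=> GD Dx S.
have SD y : S y -> D y by case.
have S0 : S 0.
  have D0 : D 0 by rewrite -(scale0r x); exact: DZ.
  by split=> // g /GD Dg; rewrite -(scale0r x) ipZl// mul0r.
have SZ a y : S y -> S (a *: y).
  by case=> Dy Sy; split=> [|g Gg]; [exact: DZ|rewrite ipZl ?Sy ?mulr0//; exact: GD].
have SA y z : S y -> S z -> S (y + z).
  case=> Dy Sy [Dz Sz]; split=> [|g Gg]; first exact: DD.
  by rewrite ipDl ?Sy ?Sz ?addr0//; exact: GD.
pose E := [set N (x - y) | y in S].
have E0 : has_inf E.
  split; first by exists (N (x - 0)), 0.
  by exists 0 => _ [y Sy <-]; apply: N_ge0; apply: DB => //; exact: SD.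
pose d := inf E.
have dE y : S y -> d <= N (x - y) by move=> Sy; apply: ge_inf; [exact: E0.2|exists y].
have d0 : 0 <= d.
  by apply: lb_le_inf; [exact: E0.1|move=> _ [y Sy <-]; apply/N_ge0/DB => //; exact: SD].
(* The excess 4^-k / 4 is chosen so that the parallelogram law gives N(u_j - u_i) <= 2 (4^-i / 4) +
   2 (4^-j / 4) <= 4^-i. *)
have /choice[u uP] k : exists y, S y /\ N (x - y) < d + 4 ^- k / 4.
  have e0 : 0 < (4 ^- k / 4 : R) by rewrite divr_gt0// invr_gt0 exprn_gt0.
  by have [_ [y Sy <-] h] := inf_adherent e0 E0; exists y.
have uS k := (uP k).1; have uD k := SD _ (uS k).
have uC i j : (i <= j)%N -> N (u j - u i) <= 4 ^- i.
  move=> ij.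
  have Dxi := DB Dx (uD i); have Dxj := DB Dx (uD j).
  pose z := (2^-1)%:C *: (u i + u j).
  have Sz : S z by apply: SZ; exact: SA.
  have /dE hz := Sz.
  have xz : x - z = (2^-1)%:C *: ((x - u i) + (x - u j)).
    rewrite addrACA -opprD /z scalerBr; congr (_ - _).
    have -> : x + x = (1 + 1 : R)%:C *: x.
      by rewrite complexD scalerDl (rmorph1 (real_complex R)) scale1r.
    rewrite scalerA -complexM (_ : _ * _ = 1); first by rewrite (rmorph1 (real_complex R)) scale1r.
    by rewrite mulVf// pnatr_eq0.
  have uu : u j - u i = (x - u i) - (x - u j) by rewrite opprB [RHS]addrC addrA subrK.
  rewrite uu (NB Dxi Dxj).
  move: hz; rewrite xz NZ; last exact: DD.
  rewrite (ND Dxi Dxj) expr2.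
  have := (uP i).2; have := (uP j).2.
  have : (4 ^- j : R) <= 4 ^- i.
    by rewrite lef_pV2 ?posrE ?exprn_gt0// ler_weXn2l// ler1n.
  lra.
have [l [C [Dl lC]]] := complete uD uC.
have Dlu k : D (l - u k) by exact: DB.
(* Since u_k annihilates g, <l - u_k, g> = <l, g> for every k, while N(l - u_k) tends to 0. *)
have Sl : S l.
  split=> // g Gg; have Dg := GD _ Gg.
  apply: (@sqc_eq0 _ (N g)); first exact: N_ge0.
  move=> s s0; apply: (@le_of_pow _ _ C) => k.
  have lg : ip (l - u k) g = ip l g.
    by rewrite ipDl//; [rewrite -scaleN1r ipZl// (uS k).2// mulr0 addr0|exact: DN].
  have := N_ge0 (DB (Dlu k) (DZ (s%:C * ip (l - u k) g) Dg)).
  rewrite N_step// lg.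
  have C0 : 0 <= C.
    have := le_trans (N_ge0 (Dlu 0%N)) (lC 0%N).
    by rewrite expr0 invr1 mulr1.
  have : C * 4 ^- k <= C * 2 ^- k.
    rewrite ler_wpM2l// lef_pV2 ?posrE ?exprn_gt0// lerXn2r ?nnegrE//.
    by rewrite ler_nat.
  have := lC k; rewrite -/(N _); lra.
exists l => // h Sh; have Dh := SD _ Sh.
have Dxl := DB Dx Dl.
have Nd : N (x - l) <= d.
  apply: (@le_of_pow _ _ (d + 2 + 2 * C)) => k.
  have Dw := DB Dx (uD k).
  set e := (2 ^- k : R).
  have e0 : 0 < e by rewrite invr_gt0 exprn_gt0.
  have e1 : e <= 1 by rewrite invf_le1 ?exprn_gt0// exprn_ege1// ler1n.
  have e4 : (4 ^- k : R) = e * e by rewrite /e -invfM -exprMn -natrM.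
  have Dew := DZ e%:C Dw.
  (* Replaces Cauchy-Schwarz: positivity of N(e w + (l - u_k)) with w = x - u_k and e = 2^-k bounds
     minus the cross term of N(x - l) by e N(w) + C e, which vanishes in the limit. *)
  have := N_ge0 (DD Dew (Dlu k)).
  have xl : x - l = (x - u k) - (l - u k) by rewrite opprB addrA subrK.
  rewrite xl (NB Dw (Dlu k)) (ND Dew (Dlu k)) (NZ e Dw) (BC Dew (Dlu k)).
  rewrite (BZ e (Dlu k) Dw) (BC (Dlu k) Dw).
  have := (uP k).2; have := lC k; rewrite -/(N _) e4.
  have := N_ge0 (Dlu k); have := N_ge0 Dw.
  set w := N (x - u k); set z := N (l - u k); set b := B _ _.
  move=> w0 z0 zC wd hb.
  have C0 : 0 <= C.
    have := le_trans (N_ge0 (Dlu 0%N)) (lC 0%N).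
    by rewrite expr0 invr1 mulr1.
  have hb2 : - (2 * b) <= e * w + C * e.
    rewrite -(ler_pM2l e0) mulrDr.
    have -> : e * (C * e) = C * (e * e) by ring.
    have -> : e * - (2 * b) = - (2 * (e * b)) by ring.
    by rewrite mulrA -expr2; lra.
  have ee : e * e <= e by rewrite ler_piMr// ltW.
  have dd : e * (d + e * e) <= e * (d + 1).
    by rewrite ler_wpM2l ?lerD2l ?mulr_ile1// ltW.
  have ew : e * w <= e * (d + e * e).
    have e20 : 0 <= e * e by rewrite mulr_ge0// ltW.
    by rewrite ler_wpM2l ?(ltW e0)//; lra.
  have Ce : C * (e * e) <= C * e by rewrite ler_wpM2l.
  lra.
apply: (@sqc_eq0 _ (N h)); first exact: N_ge0.
move=> s s0.
have : d <= N (x - l - (s%:C * ip (x - l) h) *: h).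
  by rewrite -addrA -opprD; apply: dE; apply: SA => //; exact: SZ.
rewrite N_step//; lra.
Qed.

End Projection.

(** * Scalar Hardy spaces *)

Section HardyScalar.
Context {R : realType}.
Implicit Types (f g h r : R -> R[i]) (t : R).
Local Notation mu := (circ R).

Lemma cL2_complete (u : nat -> R -> R[i]) : (forall k, Lp 2%:E (u k)) ->
  (forall i j, (i <= j)%N ->
     complex.Re (cintegral (fun t => (u j t - u i t) * conjc (u j t - u i t))) <= 4 ^- i) ->
  exists2 v, Lp 2%:E v & forall i,
     complex.Re (cintegral (fun t => (v t - u i t) * conjc (v t - u i t))) <= 2 * 4 ^- i.
Proof.
move=> u2 uC.
have sq (f : R -> R[i]) : Lp 2%:E f ->
    complex.Re (cintegral (fun t => f t * conjc (f t))) =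
    \int[mu]_t (complex.Re (f t) ^+ 2) + \int[mu]_t (complex.Im (f t) ^+ 2).
  move=> f2; rewrite cintegral_norm2//= RintegralD//.
  - exact: (Lfun2_integrable_sqr f2.1).
  - exact: (Lfun2_integrable_sqr f2.2).
have EFin_int (w : R -> R) : w \in Lfun mu 2%:E ->
    (\int[mu]_t (w t ^+ 2)%:E = (\int[mu]_t (w t ^+ 2))%:E)%E.
  move=> w2; rewrite /Rintegral fineK//; apply: integrable_fin_num => //.
  exact: (Lfun2_integrable_sqr w2).
have uB i j : Lp 2%:E (fun t => u j t - u i t) by apply: LpB => //; exact: le1_2.
have ge0 (w : R -> R) : 0 <= \int[mu]_t (w t ^+ 2).
  by apply: Rintegral_ge0 => t _; exact: sqr_ge0.
have hr i j : (i <= j)%N ->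
    (\int[mu]_t ((complex.Re (u j t) - complex.Re (u i t)) ^+ 2)%:E <= (4 ^- i : R)%:E)%E.
  move=> ij; under eq_integral do rewrite -raddfB.
  rewrite EFin_int; last exact: (uB i j).1.
  rewrite lee_fin; apply: le_trans (uC i j ij); rewrite sq//.
  by rewrite lerDl.
have hi i j : (i <= j)%N ->
    (\int[mu]_t ((complex.Im (u j t) - complex.Im (u i t)) ^+ 2)%:E <= (4 ^- i : R)%:E)%E.
  move=> ij; under eq_integral do rewrite -raddfB.
  rewrite EFin_int; last exact: (uB i j).2.
  rewrite lee_fin; apply: le_trans (uC i j ij); rewrite sq//.
  by rewrite lerDr.
have [vr vr2 vrC] := L2_complete (fun k => (u2 k).1) hr.
have [vi vi2 viC] := L2_complete (fun k => (u2 k).2) hi.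
have v2 : Lp 2%:E (fun t => vr t +i* vi t) by [].
exists (fun t => vr t +i* vi t) => // i.
have vuB : Lp 2%:E (fun t => (vr t +i* vi t) - u i t) by apply: LpB => //; exact: le1_2.
rewrite sq// [leRHS]mulr_natl [leRHS]mulr2n; apply: lerD.
  rewrite -lee_fin -EFin_int; last exact: vuB.1.
  apply: le_trans (vrC i); rewrite le_eqVlt; apply/orP; left; apply/eqP.
  by apply: eq_integral => t _; rewrite raddfB.
rewrite -lee_fin -EFin_int; last exact: vuB.2.
apply: le_trans (viC i); rewrite le_eqVlt; apply/orP; left; apply/eqP.
by apply: eq_integral => t _; rewrite raddfB.
Qed.

Let ip f g := cintegral (fun t => f t * conjc (g t)).

Lemma Lp2_ip f g : Lp 2%:E f -> Lp 2%:E g -> Lp 1 (fun t => f t * conjc (g t)).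
Proof. by move=> f2 g2; apply: Lp2M => //; apply: Lp_conj => //; exact: le1_2. Qed.

Lemma projection_scalar (G : set (R -> R[i])) f : (forall g, G g -> Lp 2%:E g) ->
  Lp 2%:E f -> let S := [set h | Lp 2%:E h /\ forall g, G g -> ip h g = 0] in
  exists2 p, S p & forall h, S h -> ip (fun t => f t - p t) h = 0.
Proof.
move=> G2 f2 S.
apply: (@projection_annihilator R (R -> (R[i])^o) (Lp 2%:E) ip).
- by move=> x y x2 y2; apply: LpD => //; exact: le1_2.
- by move=> a x x2; apply: LpyM2 => //; exact: Lp_cst.
- move=> x y z x2 y2 z2; rewrite /ip -cintegralD; [|exact: Lp2_ip..].
  by congr cintegral; apply/funext => t; rewrite mulrDl.
- move=> a x z x2 z2; rewrite /ip -cintegralZ; last exact: Lp2_ip.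
  by congr cintegral; apply/funext => t; rewrite mulrA.
- move=> x y x2 y2; rewrite /ip -cintegral_conj; last exact: Lp2_ip.
  by congr cintegral; apply/funext => t; rewrite conjcM conjcK mulrC.
- by move=> x x2; exact: cintegral_norm2_ge0.
- move=> u u2 uC; have [v v2 vC] := cL2_complete u2 uC.
  by exists v, 2.
- exact: G2.
- exact: f2.
Qed.

Lemma ip_zpow f j : ip f (zpow j) = fourier f j.
Proof. by congr cintegral; apply/funext => t; rewrite zpow_conj. Qed.

Lemma Lp2_zpow j : Lp 2%:E (zpow j : R -> R[i]).
Proof. exact/LpyW2/Lpy_zpow. Qed.

(** The projection onto the annihilator of the z^j with j < 0. For j >= 0 the character z^j itself
    lies in that annihilator, so f - p has no coefficient there. *)
Lemma riesz_projection f : Lp 2%:E f ->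
  exists2 p, Hp 2%:E p & forall j : int, 0 <= j -> fourier p j = fourier f j.
Proof.
move=> f2; pose G := [set zpow j | j in [set j : int | j < 0]] : set (R -> R[i]).
have G2 g : G g -> Lp 2%:E g by move=> [j _ <-]; exact: Lp2_zpow.
have [p [p2 pG] pS] := projection_scalar G2 f2.
exists p => [|j j0].
  by split=> // j j0; rewrite -ip_zpow; apply: pG; exists j.
have := pS (zpow j); rewrite ip_zpow fourierB; [|exact: Lp2W1..].
move=> /(_ _)/eqP; rewrite subr_eq0 => h; apply/esym/eqP/h; split; first exact: Lp2_zpow.
move=> _ [k /= k0 <-]; rewrite ip_zpow fourier_zpow1.
by case: eqP => // kj; move: j0; rewrite -kj leNgt k0.
Qed.

(** Done without Parseval: let p be the projection of f onto the annihilator of all z^j with j >= 0.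
    All coefficients of p vanish, those of negative index because f has none, so p = 0 almost
    everywhere. Hence f = f - p is orthogonal to that annihilator, which contains g. *)
Lemma Hp2_orthogonal f g : Hp 2%:E f -> Lp 2%:E g ->
  (forall j : int, 0 <= j -> fourier g j = 0) -> cintegral (fun t => f t * conjc (g t)) = 0.
Proof.
move=> [f2 fA] g2 g0.
pose G := [set zpow j | j in [set j : int | 0 <= j]] : set (R -> R[i]).
have G2 h : G h -> Lp 2%:E h by move=> [j _ <-]; exact: Lp2_zpow.
have [p [p2 pG] pS] := projection_scalar G2 f2.
have p0 : p = cst 0 %[ae mu].
  apply: fourier_unique => [|j]; first exact: Lp2W1.
  have [j0|j0] := leP 0 j; first by rewrite -ip_zpow; apply: pG; exists j.
  have := pS (zpow j); rewrite ip_zpow fourierB; [|exact: Lp2W1..].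
  rewrite fA// sub0r => /(_ _)/eqP; rewrite oppr_eq0 => h; apply/eqP/h.
  split; first exact: Lp2_zpow.
  move=> _ [k /= k0 <-]; rewrite ip_zpow fourier_zpow1.
  by case: eqP => // kj; move: k0; rewrite kj leNgt j0.
have <- : ip (fun t => f t - p t) g = 0.
  by apply: pS; split=> // _ [j /= j0 <-]; rewrite ip_zpow g0.
apply: ae_cintegral; first exact: Lp2_ip.
  by apply: Lp2_ip => //; apply: LpB => //; exact: le1_2.
by apply: filterS p0 => t /= -> //; rewrite subr0.
Qed.

(** For j < 0 the j-th coefficient of f g is the inner product of f with conj(g) z^j, a function
    without coefficients of index >= 0. *)
Lemma analyticM f g : Hp 2%:E f -> Hp 2%:E g -> analytic (fun t => f t * g t).
Proof.
move=> f2 [g2 gA] j j0; rewrite /fourier.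
have gc : Lp 2%:E (fun t => conjc (g t)) by apply: Lp_conj => //; exact: le1_2.
have h2 : Lp 2%:E (fun t => conjc (g t) * zpow j t).
  by under eq_fun do rewrite mulrC; apply: LpyM2 => //; exact: Lpy_zpow.
rewrite -[RHS](Hp2_orthogonal f2 h2).
  by congr cintegral; apply/funext => t; rewrite conjcM conjcK zpow_conj mulrA.
move=> k k0; rewrite fourier_zpow fourier_conj; last exact: Lp2W1.
by rewrite gA ?conjc0// opprB subr_lt0 (lt_le_trans j0).
Qed.

Lemma HpW2 f : Hp +oo f -> Hp 2%:E f.
Proof. by case=> fy fA; split=> //; exact: LpyW2. Qed.

Lemma HpyM f g : Hp +oo f -> Hp +oo g -> Hp +oo (fun t => f t * g t).
Proof.
move=> fH gH; split; first by apply: LpyM; [exact: fH.1|exact: gH.1].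
by apply: analyticM; exact: HpW2.
Qed.

Lemma HpyM2 f g : Hp +oo f -> Hp 2%:E g -> Hp 2%:E (fun t => f t * g t).
Proof.
move=> fH gH; split; first by apply: LpyM2; [exact: fH.1|exact: gH.1].
by apply: analyticM => //; exact: HpW2.
Qed.

Lemma Hpy_cst (c : R[i]) : Hp +oo (fun=> c : R[i]).
Proof.
split; first exact: Lp_cst.
by move=> j j0; rewrite fourier_cst lt_eqF.
Qed.

Lemma HpyX f n : Hp +oo f -> Hp +oo (fun t => f t ^+ n).
Proof.
move=> fH; elim: n => [|n IH]; first exact: Hpy_cst.
by under eq_fun do rewrite exprS; exact: HpyM.
Qed.

Lemma Hpy_zpow (k : int) : 0 <= k -> Hp +oo (zpow k : R -> R[i]).
Proof.
move=> k0; split; first exact: Lpy_zpow.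
by move=> j j0; rewrite fourier_zpow1 lt_eqF// (lt_le_trans j0).
Qed.

Lemma analyticD f g : Lp 1 f -> Lp 1 g -> analytic f -> analytic g ->
  analytic (fun t => f t + g t).
Proof. by move=> f1 g1 fA gA j j0; rewrite fourierD// fA// gA// addr0. Qed.

Lemma analyticB f g : Lp 1 f -> Lp 1 g -> analytic f -> analytic g ->
  analytic (fun t => f t - g t).
Proof. by move=> f1 g1 fA gA j j0; rewrite fourierB// fA// gA// subr0. Qed.

Lemma analytic_sum (I : Type) (s : seq I) (Q : pred I) (F : I -> R -> R[i]) :
  (forall i, Q i -> Lp 1 (F i)) -> (forall i, Q i -> analytic (F i)) ->
  analytic (fun t => \sum_(i <- s | Q i) F i t).
Proof. by move=> F1 FA j j0; rewrite fourier_sum// big1// => i Qi; exact: FA. Qed.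

Lemma ae_analytic f g : Lp 1 f -> Lp 1 g -> f = g %[ae mu] -> analytic f -> analytic g.
Proof. by move=> f1 g1 fg fA j j0; rewrite -(ae_fourier _ f1 g1 fg) fA. Qed.

Lemma Hp2D f g : Hp 2%:E f -> Hp 2%:E g -> Hp 2%:E (fun t => f t + g t).
Proof.
move=> [f2 fA] [g2 gA]; split; first by apply: LpD => //; exact: le1_2.
by apply: analyticD => //; exact: Lp2W1.
Qed.

Lemma Hp2B f g : Hp 2%:E f -> Hp 2%:E g -> Hp 2%:E (fun t => f t - g t).
Proof.
move=> [f2 fA] [g2 gA]; split; first by apply: LpB => //; exact: le1_2.
by apply: analyticB => //; exact: Lp2W1.
Qed.

Lemma Hp2_sum (I : Type) (s : seq I) (Q : pred I) (F : I -> R -> R[i]) :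
  (forall i, Q i -> Hp 2%:E (F i)) -> Hp 2%:E (fun t => \sum_(i <- s | Q i) F i t).
Proof.
move=> FH; split; first by apply: Lp_sum => [|i /FH[]//]; exact: le1_2.
by apply: analytic_sum => i /FH[] // /Lp2W1.
Qed.

(* Stands for the Hardy space H^1, whose stability under multiplication by
   H^oo is built in. *)
Definition H1 r := Lp 1 r /\ forall h, Hp +oo h -> analytic (fun t => h t * r t).

Lemma H1_analytic r : H1 r -> analytic r.
Proof.
move=> [_ /(_ _ (Hpy_cst 1))].
by under [X in analytic X -> _]eq_fun do rewrite mul1r.
Qed.

Lemma H1_mul2 f g : Hp 2%:E f -> Hp 2%:E g -> H1 (fun t => f t * g t).
Proof.
move=> fH gH; split=> [|h hH]; first by apply: Lp2M; [exact: fH.1|exact: gH.1].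
under eq_fun do rewrite mulrA; apply: analyticM => //; exact: HpyM2.
Qed.

Lemma H1_Hp2 f : Hp 2%:E f -> H1 f.
Proof.
move=> fH; have -> : f = (fun t => 1 * f t) by apply/funext => t; rewrite mul1r.
by apply: H1_mul2 => //; exact/HpW2/Hpy_cst.
Qed.

Lemma H1M h r : Hp +oo h -> H1 r -> H1 (fun t => h t * r t).
Proof.
move=> hH [r1 rA]; split=> [|g gH]; first by apply: LpyM1 => //; exact: hH.1.
by under eq_fun do rewrite mulrA; apply: rA; exact: HpyM.
Qed.

Lemma H1D r s : H1 r -> H1 s -> H1 (fun t => r t + s t).
Proof.
move=> [r1 rA] [s1 sA]; split=> [|h hH]; first by apply: LpD => //; exact: lexx.
under eq_fun do rewrite mulrDr.
by apply: analyticD; [apply: LpyM1 => //; exact: hH.1..|exact: rA|exact: sA].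
Qed.

Lemma H1N r : H1 r -> H1 (fun t => - r t).
Proof.
move=> rH; rewrite (_ : (fun t => _) = (fun t => -1 * r t)).
  by apply: H1M => //; exact: Hpy_cst.
by apply/funext => t; rewrite mulN1r.
Qed.

Lemma H1_sum (I : Type) (s : seq I) (Q : pred I) (F : I -> R -> R[i]) :
  (forall i, Q i -> H1 (F i)) -> H1 (fun t => \sum_(i <- s | Q i) F i t).
Proof.
move=> FH; split=> [|h hH]; first by apply: Lp_sum => [|i /FH[]].
under eq_fun do rewrite mulr_sumr.
apply: analytic_sum => i Qi; first by apply: LpyM1; [exact: hH.1|exact: (FH i Qi).1].
exact: (FH i Qi).2.
Qed.

(* f = sum_(i <= j) f^(i) z^i + z^(j+1) f' with f' in H^oo. *)
Lemma fourierM_cauchy f r (j : nat) : Hp +oo f -> H1 r ->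
  fourier (fun t => f t * r t) j%:Z =
  \sum_(i < j.+1) fourier f i%:Z * fourier r (j%:Z - i%:Z).
Proof.
move=> [fy fA] [r1 rA].
have f1 := LpyW1 fy.
pose s t := \sum_(i < j.+1) fourier f i%:Z * zpow i%:Z t.
have sy : Lp +oo s.
  apply: Lp_sum => [|i _]; first exact: le1_y.
  by apply: LpyM; [exact: Lp_cst|exact: Lpy_zpow].
have s1 := LpyW1 sy.
pose f' t := (f t - s t) * zpow (- j.+1%:Z) t.
have f'y : Lp +oo f'.
  by apply: LpyM; [apply: LpB => //; exact: le1_y|exact: Lpy_zpow].
have sE k : fourier s k = \sum_(i < j.+1) fourier f i%:Z * (k == i%:Z)%:R.
  rewrite fourier_sum => [|i _]; last by apply: LpyM1; [exact: Lp_cst|exact/LpyW1/Lpy_zpow].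
  apply: eq_bigr => i _; rewrite fourierZ ?fourier_zpow1//.
  exact/LpyW1/Lpy_zpow.
have f'A : analytic f'.
  move=> k k0; rewrite fourier_zpow opprK fourierB// sE.
  have [kj|kj] := ltP (k + j.+1%:Z) 0.
    rewrite fA// big1 ?subr0// => i _.
    by case: eqP => [ki|_]; [move: kj; rewrite ki|rewrite mulr0].
  case lE: (k + j.+1%:Z) kj => [l|l] // _.
  have lj : (l < j.+1)%N by move: k0 lE; lia.
  rewrite (bigD1 (Ordinal lj))//= eqxx mulr1 big1 ?addr0 ?subrr// => i il.
  case: eqP => [[li]|_]; last by rewrite mulr0.
  by case/negP: il; apply/eqP/val_inj.
have fE t : f t * r t = s t * r t + (f' t * r t) * zpow j.+1%:Z t.
  rewrite /f' [X in _ + X]mulrAC -[X in _ + X * _]mulrA [X in _ + (_ * X) * _]mulrC.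
  by rewrite zpowVr mulr1 mulrBl addrC subrK.
under eq_fun do rewrite fE.
have sr i : Lp 1 (fun t => fourier f i * (r t * zpow i t)).
  by apply: LpyM1; [exact: Lp_cst|exact: Lp1_zpow].
have f'r : Lp 1 (fun t => f' t * r t) by exact: LpyM1.
rewrite fourierD; [|exact: LpyM1|exact: Lp1_zpow].
rewrite fourier_zpow (_ : fourier (fun t => f' t * r t) _ = 0) ?addr0; last first.
  by apply: rA => //; lia.
transitivity (fourier (fun t => \sum_(i < j.+1) fourier f i%:Z * (r t * zpow i%:Z t)) j%:Z).
  congr fourier; apply/funext => t; rewrite /s mulr_suml; apply: eq_bigr => i _.
  by rewrite -mulrA [r t * _]mulrC.
rewrite fourier_sum//; apply: eq_bigr => i _.
by rewrite fourierZ ?fourier_zpow//; exact: Lp1_zpow.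
Qed.

End HardyScalar.

(** * Matrix Hardy spaces *)

Section HardyMatrix.
Context {R : realType} {n : nat}.
Implicit Types (F G Q : R -> 'M[R[i]]_n) (t : R) (p : \bar R) (M X : 'M[R[i]]_n).
Local Notation mu := (circ R).

Lemma adjmxE M a b : (M^t*) a b = conjc (M b a).
Proof. by rewrite !mxE. Qed.

Lemma tr_adjmx X M : \tr (M^t* *m X) = \sum_b \sum_a X a b * conjc (M a b).
Proof.
apply: eq_bigr => b _; rewrite mxE; apply: eq_bigr => a _.
by rewrite adjmxE mulrC.
Qed.

Lemma LpM2_ip F G a b : LpM 2%:E F -> LpM 2%:E G ->
  Lp 1 (fun t => F t a b * conjc (G t a b)).
Proof. by move=> F2 G2; apply: Lp2_ip; [exact: F2|exact: G2]. Qed.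

Lemma inner_prodE F G : LpM 2%:E F -> LpM 2%:E G ->
  inner_prod F G = \sum_b \sum_a cintegral (fun t => F t a b * conjc (G t a b)).
Proof.
move=> F2 G2; rewrite /inner_prod.
under eq_fun do rewrite tr_adjmx.
rewrite cintegral_sum => [|b _]; last first.
  by apply: Lp_sum => [|a _]; [exact: lexx|exact: LpM2_ip].
by apply: eq_bigr => b _; rewrite cintegral_sum => // a _; exact: LpM2_ip.
Qed.

Lemma LpMD p F G : (1 <= p)%E -> LpM p F -> LpM p G -> LpM p (fun t => F t + G t).
Proof.
by move=> p1 F2 G2 a b; under eq_fun do rewrite mxE; apply: LpD; [exact: p1|exact: F2|exact: G2].
Qed.

Lemma LpMN p F : (1 <= p)%E -> LpM p F -> LpM p (fun t => - F t).
Proof.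
by move=> p1 F2 a b; under eq_fun do rewrite mxE; apply: LpN => //; exact: F2.
Qed.

Lemma LpMB p F G : (1 <= p)%E -> LpM p F -> LpM p G -> LpM p (fun t => F t - G t).
Proof. by move=> p1 F2 G2; apply: LpMD => //; exact: LpMN. Qed.

Lemma LpM2Z (c : R -> R[i]) F : Lp +oo c -> LpM 2%:E F -> LpM 2%:E (fun t => c t *: F t).
Proof. by move=> cy F2 a b; under eq_fun do rewrite mxE; apply: LpyM2 => //; exact: F2. Qed.

Lemma LpMyM2 F G : LpM +oo F -> LpM 2%:E G -> LpM 2%:E (fun t => F t *m G t).
Proof.
move=> Fy G2 a b; under eq_fun do rewrite mxE.
by apply: Lp_sum => [|c _]; [exact: le1_2|apply: LpyM2; [exact: Fy|exact: G2]].
Qed.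

Lemma LpMyM F G : LpM +oo F -> LpM +oo G -> LpM +oo (fun t => F t *m G t).
Proof.
move=> Fy G2 a b; under eq_fun do rewrite mxE.
by apply: Lp_sum => [|c _]; [exact: le1_y|apply: LpyM; [exact: Fy|exact: G2]].
Qed.

Lemma LpM2M F G a b : LpM 2%:E F -> LpM 2%:E G -> Lp 1 (fun t => (F t *m G t) a b).
Proof.
move=> F2 G2; under eq_fun do rewrite mxE.
by apply: Lp_sum => [|c _]; [exact: lexx|apply: Lp2M; [exact: F2|exact: G2]].
Qed.

Lemma LpM_adj p F : (1 <= p)%E -> LpM p F -> LpM p (fun t => (F t)^t*).
Proof. by move=> p1 F2 a b; under eq_fun do rewrite adjmxE; apply: Lp_conj => //; exact: F2. Qed.

Lemma LpMyW2 F : LpM +oo F -> LpM 2%:E F.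
Proof. by move=> Fy a b; apply: LpyW2; exact: Fy. Qed.

Lemma LpM_cst M : LpM +oo (fun=> M).
Proof. by move=> a b; exact: Lp_cst. Qed.

Lemma HpM_LpM p F : HpM p F -> LpM p F.
Proof. by move=> FH a b; case: (FH a b). Qed.

Lemma HpMyW2 F : HpM +oo F -> HpM 2%:E F.
Proof. by move=> FH a b; apply: HpW2; exact: FH. Qed.

Lemma HpM_cst M : HpM +oo (fun=> M).
Proof. by move=> a b; exact: Hpy_cst. Qed.

Lemma HpM2Z (c : R -> R[i]) F : Hp +oo c -> HpM 2%:E F -> HpM 2%:E (fun t => c t *: F t).
Proof. by move=> cy F2 a b; under eq_fun do rewrite mxE; apply: HpyM2 => //; exact: F2. Qed.

Lemma HpMyM2 F G : HpM +oo F -> HpM 2%:E G -> HpM 2%:E (fun t => F t *m G t).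
Proof.
move=> Fy G2 a b; under eq_fun do rewrite mxE.
by apply: Hp2_sum => c _; apply: HpyM2; [exact: Fy|exact: G2].
Qed.

Lemma HpM2D F G : HpM 2%:E F -> HpM 2%:E G -> HpM 2%:E (fun t => F t + G t).
Proof. by move=> F2 G2 a b; under eq_fun do rewrite mxE; apply: Hp2D; [exact: F2|exact: G2]. Qed.

Lemma HpM2B F G : HpM 2%:E F -> HpM 2%:E G -> HpM 2%:E (fun t => F t - G t).
Proof. by move=> F2 G2 a b; under eq_fun do rewrite !mxE; apply: Hp2B; [exact: F2|exact: G2]. Qed.

Lemma HpM2_sum (I : Type) (s : seq I) (q : pred I) (F : I -> R -> 'M[R[i]]_n) :
  (forall i, q i -> HpM 2%:E (F i)) -> HpM 2%:E (fun t => \sum_(i <- s | q i) F i t).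
Proof. by move=> FH a b; under eq_fun do rewrite summxE; apply: Hp2_sum => i /FH; exact. Qed.

Lemma inner_prod_conj F G : LpM 2%:E F -> LpM 2%:E G ->
  inner_prod G F = conjc (inner_prod F G).
Proof.
move=> F2 G2; rewrite !inner_prodE// (rmorph_sum (@conjc R)); apply: eq_bigr => b _.
rewrite (rmorph_sum (@conjc R)); apply: eq_bigr => a _.
rewrite -[RHS]/(conjc (cintegral (fun t => F t a b * conjc (G t a b)))).
rewrite -cintegral_conj; last exact: LpM2_ip.
by congr cintegral; apply/funext => t; rewrite conjcM conjcK mulrC.
Qed.

Lemma inner_prodDl F G H : LpM 2%:E F -> LpM 2%:E G -> LpM 2%:E H ->
  inner_prod (fun t => F t + G t) H = inner_prod F H + inner_prod G H.
Proof.
move=> F2 G2 H2; rewrite !inner_prodE//; last by apply: LpMD => //; exact: le1_2.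
rewrite -big_split; apply: eq_bigr => b _; rewrite -big_split; apply: eq_bigr => a _ /=.
rewrite -cintegralD; [|exact: LpM2_ip..].
by congr cintegral; apply/funext => t; rewrite mxE mulrDl.
Qed.

Lemma inner_prodZl (c : R[i]) F H : LpM 2%:E F -> LpM 2%:E H ->
  inner_prod (fun t => c *: F t) H = c * inner_prod F H.
Proof.
move=> F2 H2; rewrite !inner_prodE//; last by apply: LpM2Z => //; exact: Lp_cst.
rewrite mulr_sumr; apply: eq_bigr => b _; rewrite mulr_sumr; apply: eq_bigr => a _ /=.
rewrite -cintegralZ; last exact: LpM2_ip.
by congr cintegral; apply/funext => t; rewrite mxE mulrA.
Qed.

Lemma inner_prodBl F G H : LpM 2%:E F -> LpM 2%:E G -> LpM 2%:E H ->
  inner_prod (fun t => F t - G t) H = inner_prod F H - inner_prod G H.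
Proof.
move=> F2 G2 H2; rewrite inner_prodDl//; last by apply: LpMN => //; exact: le1_2.
have -> : (fun t => - G t) = (fun t => (-1 : R[i]) *: G t).
  by apply/funext => t; rewrite scaleN1r.
by rewrite inner_prodZl// mulN1r.
Qed.

Lemma inner_prod_ge0 F : LpM 2%:E F -> 0 <= inner_prod F F.
Proof.
move=> F2; rewrite inner_prodE//; apply: sumr_ge0 => b _; apply: sumr_ge0 => a _.
by apply: cintegral_norm2_ge0; exact: F2.
Qed.

Lemma inner_prod_eq0 F : LpM 2%:E F -> inner_prod F F = 0 -> F = cst 0 %[ae mu].
Proof.
move=> F2; rewrite inner_prodE// => /eqP; rewrite psumr_eq0; last first.
  move=> b _; apply: sumr_ge0 => a _; apply: cintegral_norm2_ge0; exact: F2.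
move=> /allP h.
have Fab a b : {ae mu, forall t, F t a b = 0}.
  have := h b (mem_index_enum b); rewrite /= psumr_eq0; last first.
    by move=> a' _; apply: cintegral_norm2_ge0; exact: F2.
  move=> /allP /(_ a (mem_index_enum a)) /eqP /(cintegral_norm2_eq0 (F2 a b)).
  by apply: filterS => t; exact.
have : {ae mu, forall t, forall ab : 'I_n * 'I_n, F t ab.1 ab.2 = 0}.
  by apply: filter_forall => ab; exact: Fab.
by apply: filterS => t Ft _; apply/matrixP => a b; rewrite mxE (Ft (a, b)).
Qed.

Lemma projection_matrix (S : set (R -> 'M[R[i]]_n)) F : S `<=` LpM 2%:E ->
  LpM 2%:E F -> let S' := [set H | LpM 2%:E H /\ forall G, S G -> inner_prod H G = 0] in
  exists2 H, S' H & forall G, S' G -> inner_prod (fun t => F t - H t) G = 0.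
Proof.
move=> S2 F2 S'.
apply: (@projection_annihilator R (R -> 'M[R[i]]_n) (LpM 2%:E) inner_prod) => //.
- by move=> x y x2 y2; apply: LpMD => //; exact: le1_2.
- by move=> a x x2; apply: LpM2Z => //; exact: Lp_cst.
- by move=> x y z; exact: inner_prodDl.
- by move=> a x z; exact: inner_prodZl.
- by move=> x y; exact: inner_prod_conj.
- by move=> x; exact: inner_prod_ge0.
move=> u u2 uC.
have uB i j : LpM 2%:E (u i - u j) by apply: LpMB => //; exact: le1_2.
have ge0 (H : R -> 'M[R[i]]_n) a b : LpM 2%:E H ->
    0 <= complex.Re (cintegral (fun t => H t a b * conjc (H t a b))).
  by move=> H2; have := cintegral_norm2_ge0 (H2 a b); rewrite lecE => /andP[].
have Re_sum (H : R -> 'M[R[i]]_n) : LpM 2%:E H -> complex.Re (inner_prod H H) =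
    \sum_b \sum_a complex.Re (cintegral (fun t => H t a b * conjc (H t a b))).
  by move=> H2; rewrite inner_prodE// raddf_sum; apply: eq_bigr => b _; rewrite raddf_sum.
have le_term (f : 'I_n -> R) i : (forall k, 0 <= f k) -> f i <= \sum_k f k.
  by move=> f0; rewrite (bigD1 i)//= lerDl sumr_ge0.
have uCab a b i j : (i <= j)%N -> complex.Re (cintegral (fun t =>
    (u j t a b - u i t a b) * conjc (u j t a b - u i t a b))) <= 4 ^- i.
  move=> ij; apply: le_trans (uC i j ij); rewrite Re_sum//.
  have -> : (fun t => (u j t a b - u i t a b) * conjc (u j t a b - u i t a b)) =
      (fun t => (u j - u i) t a b * conjc ((u j - u i) t a b)).
    by apply/funext => t; rewrite !mxE.
  have ge0' b' a' := ge0 (u j - u i) a' b' (uB j i).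
  pose f b' a' := complex.Re
    (cintegral (fun t => (u j - u i) t a' b' * conjc ((u j - u i) t a' b'))).
  apply: (@le_trans _ _ (\sum_a0 f b a0)); first exact: (le_term (f b) a (ge0' b)).
  apply: (le_term (fun b' => \sum_a0 f b' a0) b) => b'.
  by apply: sumr_ge0 => a' _; exact: ge0'.
have vex (ab : 'I_n * 'I_n) : exists v : R -> R[i], Lp 2%:E v /\ forall i,
    complex.Re (cintegral (fun t => (v t - u i t ab.1 ab.2) * conjc (v t - u i t ab.1 ab.2)))
    <= 2 * 4 ^- i.
  have [v v2 vC] := cL2_complete (fun k => u2 k ab.1 ab.2) (uCab ab.1 ab.2).
  by exists v.
have [v vP] := choice vex.
exists (fun t => \matrix_(a, b) v (a, b) t), (\sum_(b < n) \sum_(a < n) 2).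
have v2 : LpM 2%:E (fun t => \matrix_(a, b) v (a, b) t).
  by move=> a b; under eq_fun do rewrite mxE; exact: (vP (a, b)).1.
split=> // i; rewrite Re_sum; last by apply: LpMB => //; exact: le1_2.
rewrite mulr_suml; apply: ler_sum => b _; rewrite mulr_suml; apply: ler_sum => a _.
have := (vP (a, b)).2 i; congr (_ <= _); congr complex.Re; congr cintegral.
by apply/funext => t; rewrite !mxE.
Qed.

End HardyMatrix.

(** * Invariant subspaces and coprimeness *)

Section Adjoint.
Context {R : realType} {n : nat}.
Implicit Types (M N X : 'M[R[i]]_n).

Lemma adjmxM M N : (M *m N)^t* = N^t* *m M^t*.
Proof. by rewrite trmx_mul map_mxM. Qed.

Lemma adjmxK M : (M^t*)^t* = M.
Proof. by apply/matrixP => a b; rewrite !adjmxE conjcK. Qed.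

Lemma adjmxD M N : (M + N)^t* = M^t* + N^t*.
Proof. by rewrite linearD /= map_mxD. Qed.

Lemma adjmxZ (c : R[i]) M : (c *: M)^t* = conjc c *: M^t*.
Proof. by rewrite linearZ /= map_mxZ. Qed.

Lemma adjmx_delta (a b : 'I_n) : (delta_mx a b : 'M[R[i]]_n)^t* = delta_mx b a.
Proof. by rewrite trmx_delta map_delta_mx. Qed.

Lemma mulmx_delta M (a b i j : 'I_n) : (M *m delta_mx a b) i j = M i a * (j == b)%:R.
Proof.
rewrite mxE (bigD1 a)//= big1 => [|k ka]; last by rewrite mxE (negbTE ka) mulr0.
by rewrite mxE eqxx addr0.
Qed.

Lemma delta_mulmx M (a b i j : 'I_n) : (delta_mx a b *m M) i j = (i == a)%:R * M b j.
Proof.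
rewrite mxE (bigD1 b)//= big1 => [|k kb]; last by rewrite mxE (negbTE kb) andbF mul0r.
by rewrite mxE eqxx andbT addr0.
Qed.

Lemma mxtrace_mulmx_delta M (a b : 'I_n) : \tr (M *m delta_mx a b) = M b a.
Proof.
rewrite /mxtrace (bigD1 b)//= big1 => [|i ib]; first by rewrite mulmx_delta eqxx mulr1 addr0.
by rewrite mulmx_delta (negbTE ib) mulr0.
Qed.

Lemma adjmx_mul_eq0 M : M^t* *m M = 0 -> M = 0.
Proof.
move=> h; apply/matrixP => a b; rewrite mxE.
have /matrixP/(_ b b) := h; rewrite !mxE => /eqP.
rewrite psumr_eq0 => [|c _]; last by rewrite adjmxE mulrC mulcJ_ge0.
move=> /allP /(_ a (mem_index_enum a)); rewrite adjmxE mulf_eq0 conjc_eq0 orbb.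
by move=> /eqP.
Qed.

End Adjoint.

(** * The Beurling-Lax theorem for the subspace of all F such that conj(theta) K F is analytic *)

Section Beurling.
Context {R : realType} {n : nat}.
Variables (theta : R -> R[i]) (K : R -> 'M[R[i]]_n).
Hypotheses (thI : inner_fun theta) (KH : HpM +oo K).
Implicit Types (F G Q : R -> 'M[R[i]]_n) (t : R) (M X : 'M[R[i]]_n).
Local Notation mu := (circ R).

(** Writes Fourier coefficients as inner products with explicit functions: w = 1 and L = I give
    those of F, w = theta and L = K those of conj(theta) K F. Conditions on these coefficients
    therefore define annihilators, onto which projections exist. *)
Lemma inner_prod_test (w : R -> R[i]) (L F : R -> 'M[R[i]]_n) (a b : 'I_n) (j : int) :
  inner_prod F (fun t => (w t * zpow j t) *: ((L t)^t* *m delta_mx a b)) =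
  fourier (fun t => conjc (w t) * (L t *m F t) a b) j.
Proof.
congr cintegral; apply/funext => t.
rewrite adjmxZ adjmxM adjmxK adjmx_delta -scalemxAl mxtraceZ -mulmxA mxtrace_mulC.
by rewrite mxtrace_mulmx_delta conjcM zpow_conj mulrAC.
Qed.

Let kap F a b t := conjc (theta t) * (K t *m F t) a b.
Let S F := HpM 2%:E F /\ forall a b, analytic (kap F a b).
(** The subspace z S. Its conditions at negative indices already contain analyticity, so [LpM]
    suffices and T is an annihilator. *)
Let T F := LpM 2%:E F /\ forall a b (j : int), j < 1 ->
  fourier (fun t => F t a b) j = 0 /\ fourier (kap F a b) j = 0.

Let thy : Lp +oo theta. Proof. by case: thI => -[]. Qed.
Let cthy : Lp +oo (fun t => conjc (theta t)).
Proof. by apply: Lp_conj => //; exact: le1_y. Qed.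

Let Ky : LpM +oo K. Proof. exact: HpM_LpM. Qed.

Let kap2 F a b : LpM 2%:E F -> Lp 2%:E (kap F a b).
Proof. by move=> F2; apply: LpyM2 => //; exact: LpMyM2. Qed.

Let kap1 F a b : LpM 2%:E F -> Lp 1 (kap F a b).
Proof. by move=> /kap2 F2; apply: Lp2W1. Qed.

Let ent1 F a b : LpM 2%:E F -> Lp 1 (fun t => F t a b).
Proof. by move=> F2; apply: Lp2W1; exact: F2. Qed.

Let TS F : T F -> S F.
Proof.
move=> [F2 FT]; split=> a b; first split; first exact: F2.
  by move=> j j0; exact: (FT a b j (lt_trans j0 ltr01)).1.
by move=> j j0; exact: (FT a b j (lt_trans j0 ltr01)).2.
Qed.

Let kapZ (c : R -> R[i]) F a b :
  kap (fun t => c t *: F t) a b = (fun t => c t * kap F a b t).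
Proof. by apply/funext => t; rewrite /kap -scalemxAr mxE mulrCA. Qed.

Let kapR F (G : R -> 'M[R[i]]_n) a b :
  kap (fun t => F t *m G t) a b = (fun t => \sum_c kap F a c t * G t c b).
Proof.
by apply/funext => t; rewrite /kap mulmxA mxE mulr_sumr; apply: eq_bigr => c _; rewrite mulrA.
Qed.

Let kapB F G a b :
  kap (fun t => F t - G t) a b = (fun t => kap F a b t - kap G a b t).
Proof. by apply/funext => t; rewrite /kap mulmxBr !mxE mulrBr. Qed.

Let SB F G : S F -> S G -> S (fun t => F t - G t).
Proof.
move=> [FH FA] [GH GA]; split=> [|a b]; first exact: HpM2B.
by rewrite kapB; apply: analyticB => //; apply: kap1; exact: HpM_LpM.
Qed.

Let SM Q F : S Q -> LpM +oo Q -> HpM 2%:E F -> S (fun t => Q t *m F t).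
Proof.
move=> [QH QA] Qy FH.
have QHy : HpM +oo Q by move=> a b; split; [exact: Qy|exact: (QH a b).2].
split=> [|a b]; first exact: HpMyM2.
rewrite kapR; apply: analytic_sum => c _.
  by apply: Lp2M; [apply: kap2; exact: HpM_LpM|exact: (HpM_LpM FH)].
by apply: analyticM; [split; [apply: kap2; exact: HpM_LpM|exact: QA]|exact: FH].
Qed.

Let SX F X : S F -> S (fun t => F t *m X).
Proof.
move=> [FH FA]; split=> a b.
  under eq_fun do rewrite mxE; apply: Hp2_sum => c _.
  by under eq_fun do rewrite mulrC; apply: HpyM2; [exact: Hpy_cst|exact: FH].
rewrite kapR; apply: analytic_sum => c _.
  by under eq_fun do rewrite mulrC; apply: LpyM1; [exact: Lp_cst|apply: kap1; exact: HpM_LpM].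
move=> j j0; under eq_fun do rewrite mulrC.
by rewrite fourierZ ?FA ?mulr0//; apply: kap1; exact: HpM_LpM.
Qed.

Let fou_zpow k F a b j :
  fourier (fun t => (zpow k t *: F t) a b) j = fourier (fun t => F t a b) (j - k).
Proof. by rewrite -fourier_zpow; congr fourier; apply/funext => t; rewrite mxE mulrC. Qed.

Let kap_zpow k F a b j :
  fourier (kap (fun t => zpow k t *: F t) a b) j = fourier (kap F a b) (j - k).
Proof.
rewrite kapZ (_ : (fun t => _) = (fun t => kap F a b t * zpow k t)) ?fourier_zpow//.
by apply/funext => t; rewrite mulrC.
Qed.

Let STz k F : 1 <= k -> S F -> T (fun t => zpow k t *: F t).
Proof.
move=> k1 [FH FA]; split=> [|a b j j1].
  by apply: LpM2Z; [exact: Lpy_zpow|exact: HpM_LpM].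
rewrite fou_zpow kap_zpow; split; first by apply: (FH a b).2; rewrite subr_lt0 (lt_le_trans j1).
by apply: FA; rewrite subr_lt0 (lt_le_trans j1).
Qed.

Let TSz F : T F -> S (fun t => zpow (- 1) t *: F t).
Proof.
move=> [F2 FT]; split=> a b; first split.
- by apply: LpM2Z => //; exact: Lpy_zpow.
- move=> j j0; rewrite fou_zpow opprK; apply: (FT a b _ _).1.
  by rewrite -ltrBrDr subrr.
- move=> j j0; rewrite kap_zpow opprK; apply: (FT a b _ _).2.
  by rewrite -ltrBrDr subrr.
Qed.

Let TX F X : T F -> T (fun t => F t *m X).
Proof.
move=> [F2 FT]; split=> [|a b j j1].
  move=> a b; under eq_fun do rewrite mxE; apply: Lp_sum => [|c _]; first exact: le1_2.
  by under eq_fun do rewrite mulrC; apply: LpyM2; [exact: Lp_cst|exact: F2].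
split.
  under eq_fun do rewrite mxE.
  rewrite fourier_sum => [|c _]; last first.
    by under eq_fun do rewrite mulrC; apply: LpyM1; [exact: Lp_cst|exact: ent1].
  apply: big1 => c _; under eq_fun do rewrite mulrC.
  by rewrite fourierZ ?(FT a c j j1).1 ?mulr0//; exact: ent1.
rewrite kapR fourier_sum => [|c _]; last first.
  by under eq_fun do rewrite mulrC; apply: LpyM1; [exact: Lp_cst|exact: kap1].
apply: big1 => c _; under eq_fun do rewrite mulrC.
by rewrite fourierZ ?(FT a c j j1).2 ?mulr0//; exact: kap1.
Qed.

Let proj_T F : LpM 2%:E F ->
  exists2 H, T H & forall G, T G -> inner_prod (fun t => F t - H t) G = 0.
Proof.
move=> F2.
pose test (w : R -> R[i]) (L : R -> 'M[R[i]]_n) (a b : 'I_n) (j : int) t : 'M[R[i]]_n :=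
  (w t * zpow j t) *: ((L t)^t* *m delta_mx a b).
pose Gen G := exists a b, exists2 j : int, j < 1 &
  G = test (fun=> 1) (fun=> 1%:M) a b j \/ G = test theta K a b j.
have test2 w L a b j : Lp +oo w -> LpM +oo L -> LpM 2%:E (test w L a b j).
  move=> wy Ly; apply: LpM2Z; first by apply: LpyM => //; exact: Lpy_zpow.
  by apply/LpMyW2/LpMyM; [apply: LpM_adj => //; exact: le1_y|exact: LpM_cst].
have GenT G : (LpM 2%:E G /\ forall H, Gen H -> inner_prod G H = 0) <-> T G.
  have e1 a b j : fourier (fun t => conjc 1 * (1%:M *m G t) a b) j = fourier (fun t => G t a b) j.
    by congr fourier; apply/funext => t; rewrite mul1mx conjc1 mul1r.
  split=> -[G2 h]; split=> //.
    move=> a b j j1; split.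
      by rewrite -e1 -(inner_prod_test (fun=> 1)); apply: h; exists a, b, j => //; left.
    by rewrite -inner_prod_test; apply: h; exists a, b, j => //; right.
  move=> _ [a [b [j j1 [->|->]]]]; rewrite inner_prod_test.
    by rewrite e1; exact: (h a b j j1).1.
  exact: (h a b j j1).2.
have Gen2 : Gen `<=` LpM 2%:E.
  move=> _ [a [b [j _ [->|->]]]]; apply: test2 => //; [exact: Lp_cst|exact: LpM_cst].
have [H [H2 HG] Hp] := projection_matrix Gen2 F2.
exists H; first exact/GenT.
by move=> G /GenT TG; exact: Hp.
Qed.

(** The wandering subspace, the orthogonal complement of z S in S. *)
Let W Q := S Q /\ forall F, T F -> inner_prod F Q = 0.

Let fourier_adjmul Q F a b j :
  fourier (fun t => ((Q t)^t* *m F t) a b) j =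
  inner_prod (fun t => (zpow (- j) t *: F t) *m delta_mx b a) Q.
Proof.
congr cintegral; apply/funext => t.
by rewrite mulmxA mxtrace_mulmx_delta -scalemxAr [RHS]mxE mulrC.
Qed.

(** Coefficients of negative index of Q^* F pair Q with z^k F, k >= 1, which lies in z S. Stability
    of z S under right multiplication by constant matrices turns the single trace condition into one
    for each entry. *)
Let adjW_analytic Q F a b : W Q -> S F -> analytic (fun t => ((Q t)^t* *m F t) a b).
Proof.
move=> [_ WQ] SF j j0; rewrite fourier_adjmul; apply/WQ/TX/STz => //.
by rewrite lerNr -ltzD1 -subr_gt0; lia.
Qed.

Let adjW_T Q F a b : W Q -> T F -> fourier (fun t => ((Q t)^t* *m F t) a b) 0 = 0.
Proof.
move=> [_ WQ] TF; rewrite fourier_adjmul; apply/WQ/TX.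
by rewrite (_ : (fun t => _) = F)//; apply/funext => t; rewrite oppr0 zpow0 scale1r.
Qed.

(** Both Q^* Q' and its adjoint Q'^* Q are analytic, so only the coefficient of index 0 survives. *)
Let adjW_cst Q Q' : W Q -> W Q' ->
  (fun t => (Q t)^t* *m Q' t) = cst (fourierM (fun t => (Q t)^t* *m Q' t) 0) %[ae mu].
Proof.
move=> WQ WQ'; set C := fourierM _ _.
have Q2 := HpM_LpM WQ.1.1; have Q'2 := HpM_LpM WQ'.1.1.
have L1 (P P' : R -> 'M[R[i]]_n) a b : LpM 2%:E P -> LpM 2%:E P' -> Lp 1 (fun t => ((P t)^t* *m P' t) a b).
  by move=> P2 P'2; apply: LpM2M => //; apply: LpM_adj => //; exact: le1_2.
have ab a b : {ae mu, forall t, ((Q t)^t* *m Q' t) a b = C a b}.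
  have : (fun t => ((Q t)^t* *m Q' t) a b - C a b) = cst 0 %[ae mu].
    apply: fourier_unique => [|j].
      by apply: LpB; [exact: lexx|exact: L1|exact/LpyW1/Lp_cst].
    rewrite fourierB; [|exact: L1|exact/LpyW1/Lp_cst].
    rewrite fourier_cst; have [->|j0] := eqVneq j 0; first by rewrite mxE subrr.
    rewrite subr0; have [jn|jp] := ltP j 0; first exact: adjW_analytic WQ WQ'.1 _ jn.
    rewrite (_ : (fun t => _) = (fun t => conjc (((Q' t)^t* *m Q t) b a))); last first.
      by apply/funext => t; rewrite -adjmxE adjmxM adjmxK.
    rewrite fourier_conj; last exact: L1.
    by rewrite (@adjW_analytic Q' Q b a WQ' WQ.1 (- j)) ?conjc0// oppr_lt0 lt_def j0.
  by apply: filterS => t /(_ Logic.I)/eqP; rewrite subr_eq0 => /eqP.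
have : {ae mu, forall t, forall ab : 'I_n * 'I_n, ((Q t)^t* *m Q' t) ab.1 ab.2 = C ab.1 ab.2}.
  by apply: filter_forall => -[a b]; exact: ab.
by apply: filterS => t h _; apply/matrixP => a b; exact: (h (a, b)).
Qed.

Let WD Q Q' : W Q -> W Q' -> W (fun t => Q t + Q' t).
Proof.
move=> [SQ WQ] [SQ' WQ'].
have Q2 := HpM_LpM SQ.1; have Q'2 := HpM_LpM SQ'.1.
have QQ' : LpM 2%:E (fun t => Q t + Q' t) by apply: LpMD => //; exact: le1_2.
split=> [|F TF].
  rewrite (_ : (fun t => _) = (fun t => Q t - Q' t *m (-1)%:M)); first exact/SB/SX.
  by apply/funext => t; rewrite mul_mx_scalar scaleN1r opprK.
rewrite (inner_prod_conj QQ' TF.1) (inner_prodDl Q2 Q'2 TF.1).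
rewrite (inner_prod_conj TF.1 Q2) (inner_prod_conj TF.1 Q'2) WQ// WQ'//.
by rewrite conjc0 addr0 conjc0.
Qed.

Let WX Q X : W Q -> W (fun t => Q t *m X).
Proof.
move=> [SQ WQ]; split=> [|F TF]; first exact: SX.
rewrite -(WQ _ (@TX F (X^t*) TF)); congr cintegral; apply/funext => t.
by rewrite adjmxM mulmxA [RHS]mxtrace_mulC !mulmxA.
Qed.

Let W0 : W (fun=> 0).
Proof.
split=> [|F TF].
  split=> a b; first by under eq_fun do rewrite mxE; exact/HpW2/Hpy_cst.
  move=> j j0; rewrite (_ : kap _ a b = fun=> 0).
    by rewrite fourier_cst; case: eqP.
  by apply/funext => t; rewrite /kap mulmx0 mxE mulr0.
rewrite -[RHS]cintegral0; congr cintegral; apply/funext => t.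
by rewrite trmx0 map_mx0 mul0mx mxtrace0.
Qed.

(* A unit vector of the wandering subspace orthogonal to Q adds one to the rank. *)
Let W_extend Q w r : W Q -> W w -> (r <= n)%N ->
  (fun t => (Q t)^t* *m Q t) = cst (pid_mx r) %[ae mu] ->
  (fun t => (Q t)^t* *m w t) = cst 0 %[ae mu] ->
  ~ (w = cst 0 %[ae mu]) ->
  (r < n)%N /\ exists2 Q', W Q' & (fun t => (Q' t)^t* *m Q' t) = cst (pid_mx r.+1) %[ae mu].
Proof.
move=> WQ Ww rn QQ Qw w0.
have [C ww] : exists C, (fun t => (w t)^t* *m w t) = cst C %[ae mu].
  by eexists; apply: (adjW_cst Ww Ww).
have [b Cb] : exists b, C b b != 0.
  apply: contrapT => /forallNP h; apply: w0; apply: filterS ww => t /(_ Logic.I) wC _.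
  apply/matrixP => a b; rewrite mxE.
  have := h b => /negP; rewrite negbK -[C]/(cst C t) -wC mxE psumr_eq0 => [|c _]; last first.
    by rewrite adjmxE mulrC mulcJ_ge0.
  move=> /allP /(_ a (mem_index_enum a)); rewrite adjmxE mulf_eq0 conjc_eq0 orbb.
  by move=> /eqP.
(* The matrices C and [pid_mx r] are constant, so facts about them can be read at one point where
   all three identities hold. *)
have [t0 [[QQ0 Qw0] ww0]] : exists t, (((Q t)^t* *m Q t = pid_mx r) /\ ((Q t)^t* *m w t = 0)) /\
    (w t)^t* *m w t = C.
  have /filter_ex[t h] : {ae mu, forall t, (((Q t)^t* *m Q t = pid_mx r) /\
      ((Q t)^t* *m w t = 0)) /\ (w t)^t* *m w t = C}.
    by apply: filterS3 QQ Qw ww => t /(_ Logic.I) ? /(_ Logic.I) ? /(_ Logic.I) ?.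
  by exists t.
have Cge0 : 0 <= C b b.
  by rewrite -ww0 mxE sumr_ge0// => c _; rewrite adjmxE mulrC mulcJ_ge0.
(* If r = n, then Q(t0) is unitary and its adjoint kills w(t0); hence w(t0) = 0 and C = 0, against
   the choice of b. *)
have rltn : (r < n)%N.
  rewrite ltn_neqAle rn andbT; apply/eqP => rE; move: QQ0; rewrite rE pid_mx_1 => QQ1.
  have QQ2 := mulmx1C QQ1.
  case/negP: Cb; rewrite -ww0 -[w t0]mul1mx -QQ2 -mulmxA Qw0 mulmx0 mulmx0 mxE//.
split=> //.
pose i0 := Ordinal rltn; pose s := sqrtC (C b b).
have s0 : s != 0 by rewrite sqrtC_eq0.
have sJ : conjc s = s.
  rewrite -[conjc s]/(Num.conj s); apply: CrealP.
  by rewrite ger0_real// sqrtC_ge0.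
(* Right multiplication by D moves the normalized b-th column of w into column r, the first one
   missing in Q. *)
pose D := s^-1 *: delta_mx b i0 : 'M[R[i]]_n.
exists (fun t => Q t + w t *m D); first exact: (WD WQ (@WX w D Ww)).
apply: filterS3 QQ Qw ww => t /(_ Logic.I) /= QQt /(_ Logic.I) /= Qwt /(_ Logic.I) /= wwt _.
have wQt : (w t)^t* *m Q t = 0.
  by rewrite -[LHS]adjmxK adjmxM adjmxK Qwt trmx0 map_mx0.
rewrite adjmxD mulmxDl !mulmxDr QQt mulmxA Qwt mul0mx addr0 adjmxM -!mulmxA wQt mulmx0 add0r.
rewrite [(w t)^t* *m _]mulmxA wwt.
have -> : D^t* *m (C *m D) = delta_mx i0 i0.
  rewrite /D adjmxZ adjmx_delta conjc_inv sJ -scalemxAr -scalemxAr -scalemxAl scalerA.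
  apply/matrixP => i j; rewrite [LHS]mxE delta_mulmx mulmx_delta [RHS]mxE.
  rewrite -invfM -expr2 sqrtCK; case: (i == i0); rewrite ?(mul1r, mul0r, mulr0)//=.
  by rewrite mulrA mulVf// mul1r.
apply/matrixP => i j; rewrite !mxE.
have [<-|ij] := eqVneq i j.
  rewrite eqxx andbb /= -val_eqE /= [in RHS]ltnS [in RHS]leq_eqVlt.
  by case: ltngtP => _; rewrite ?addr0 ?add0r.
rewrite (_ : (i == j :> nat) = false) ?andFb ?add0r; last exact/negbTE.
case: eqP => // iE; case: eqP => // jE.
by case/eqP: ij; rewrite iE jE.
Qed.

Let W_bounded Q M : W Q -> (fun t => (Q t)^t* *m Q t) = cst M %[ae mu] -> LpM +oo Q.
Proof.
move=> [[QH _] _] QQ a b; have [Q2r Q2i] := (QH a b).1.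
have mr := Lfun_measurable Q2r; have mi := Lfun_measurable Q2i.
have bnd : {ae mu, forall t, complex.Re (Q t a b) ^+ 2 + complex.Im (Q t a b) ^+ 2 <=
    complex.Re (M b b)}.
  apply: filterS QQ => t /(_ Logic.I) /matrixP/(_ b b); rewrite mxE /cst => <-.
  have h c : 0 <= ((Q t)^t*) b c * Q t c b by rewrite adjmxE mulrC mulcJ_ge0.
  have : Q t a b * conjc (Q t a b) <= \sum_c ((Q t)^t*) b c * Q t c b.
    rewrite (bigD1 a)//= adjmxE mulrC lerDl sumr_ge0//.
  rewrite lecE => /andP[_]; congr (_ <= _); case: (Q t a b) => x y /=.
  by rewrite mulrN opprK !expr2.
have sq (x m : R) : x ^+ 2 <= m -> `|x| <= 1 + m.
  move=> xm; have : 0 <= (`|x| - 1) ^+ 2 by rewrite sqr_ge0.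
  have := normr_ge0 x; rewrite sqrrB1 real_normK ?num_real//.
  have : 0 <= x ^+ 2 by rewrite sqr_ge0.
  lra.
split; apply/(LfunyP mu); split => //; exists (1 + complex.Re (M b b)); apply: filterS bnd => t.
  by move=> h; apply: sq; apply: le_trans h; rewrite lerDl sqr_ge0.
by move=> h; apply: sq; apply: le_trans h; rewrite lerDr sqr_ge0.
Qed.

(** A column-orthonormal Q of maximal rank. Maximality says that an element of W annihilated by Q^*
    is 0, which replaces completeness of an orthonormal basis of W. *)
Let W_max : exists r Q, [/\ (r <= n)%N, W Q, (fun t => (Q t)^t* *m Q t) = cst (pid_mx r) %[ae mu] &
  forall w, W w -> (fun t => (Q t)^t* *m w t) = cst 0 %[ae mu] -> w = cst 0 %[ae mu]].
Proof.
pose P r := `[< (r <= n)%N /\ exists2 Q, W Q &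
  (fun t => (Q t)^t* *m Q t) = cst (pid_mx r) %[ae mu] >].
have P0 : P 0%N.
  apply/asboolP; split=> //; exists (fun=> 0); first exact: W0.
  by apply: nearW => t _; rewrite mulmx0 pid_mx_0.
have Pn r : P r -> (r <= n)%N by move=> /asboolP[].
have exP : exists r, P r by exists 0%N.
case: (ex_maxnP exP Pn) => r /asboolP[rn [Q WQ QQ]] rmax.
exists r, Q; split=> // w Ww Qw; apply: contrapT => w0.
have [rltn [Q' WQ' QQ']] := W_extend WQ Ww rn QQ Qw w0.
have : P r.+1 by apply/asboolP; split=> //; exists Q'.
by move=> /rmax; rewrite ltnn.
Qed.

(** For F in S, the remainder G = F - Q Q^* F lies in S and satisfies Q^* G = 0. Such a G vanishes
    because it belongs to z^k S for every k, as in the Wold decomposition. Hence F = Q F' with F' =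
    Q^* F in H^2. Applied to theta I, this shows that Q has full rank. *)
Lemma beurling : exists Q, [/\ inner_mx Q,
  HpM 2%:E Q /\ forall a b, analytic (fun t => conjc (theta t) * (K t *m Q t) a b) &
  forall F, HpM 2%:E F ->
    (forall a b, analytic (fun t => conjc (theta t) * (K t *m F t) a b)) ->
    left_inner_divisor Q F].
Proof.
have [r [Q [rn WQ QQ Qmax]]] := W_max.
have Qy := W_bounded WQ QQ.
have SQ := WQ.1; have Q2 := HpM_LpM SQ.1.
have QHy : HpM +oo Q by move=> a b; split; [exact: Qy|exact: (SQ.1 a b).2].
have QF0 G : S G -> (fun t => (Q t)^t* *m G t) = cst 0 %[ae mu] -> G = cst 0 %[ae mu].
  move=> SG QG.
  (* The component of z^-k G in W is annihilated by Q^*, hence is 0 by maximality; so z^-k G lies in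
     z S and one more z can be divided out. *)
  have SGk (k : nat) : S (fun t => zpow (- k%:Z) t *: G t).
    elim: k => [|k SGk].
      by rewrite (_ : (fun t => _) = G)//; apply/funext => t; rewrite oppr0 zpow0 scale1r.
    set Gk := (fun t => _) in SGk.
    have Gk2 := HpM_LpM SGk.1.
    have [p Tp Gp] := proj_T Gk2.
    have Ww : W (fun t => Gk t - p t).
      split=> [|F TF]; first by apply: SB => //; exact: TS.
      rewrite inner_prod_conj ?Gp ?conjc0 ?TF.1//; last exact: TF.1.
      by apply: LpMB; [exact: le1_2|exact: Gk2|exact: Tp.1].
    have Qw : (fun t => (Q t)^t* *m (Gk t - p t)) = cst 0 %[ae mu].
      have QGk : {ae mu, forall t, (Q t)^t* *m Gk t = 0}.
        apply: filterS QG => t /(_ Logic.I) h.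
        by rewrite /Gk -scalemxAr h scaler0.
      (* The constant Q^* w is its own coefficient of index 0. As Q^* Gk = 0, that is minus the one
         of Q^* p, and it vanishes because p lies in z S. *)
      have := adjW_cst WQ Ww; apply: filterS => t h /h ->.
      apply/matrixP => a b; rewrite /cst !mxE.
      rewrite (@ae_fourier _ _ (fun t => - ((Q t)^t* *m p t) a b)).
      - rewrite fourierN ?(adjW_T _ _ WQ Tp) ?oppr0//.
        by apply: LpM2M; [apply: LpM_adj => //; exact: le1_2|exact: Tp.1].
      - apply: LpM2M; first by apply: LpM_adj => //; exact: le1_2.
        by apply: LpMB; [exact: le1_2|exact: Gk2|exact: Tp.1].
      - apply: LpN; first exact: lexx.
        by apply: LpM2M; [apply: LpM_adj => //; exact: le1_2|exact: Tp.1].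
      - by apply: filterS QGk => u hu _; rewrite mulmxBr hu sub0r mxE.
    have w0 := Qmax _ Ww Qw.
    have TGk : T Gk.
      split=> // a b j j1; have [h1 h2] := Tp.2 a b j j1; split.
        rewrite -h1; apply: ae_fourier; [exact: ent1|exact: (ent1 _ _ Tp.1)|].
        by apply: filterS w0 => t /(_ Logic.I)/eqP; rewrite subr_eq0 => /eqP ->.
      rewrite -h2; apply: ae_fourier; [exact: kap1|exact: (kap1 _ _ Tp.1)|].
      by apply: filterS w0 => t /(_ Logic.I)/eqP; rewrite subr_eq0 /kap => /eqP ->.
    have := TSz TGk; congr S; apply/funext => t.
    by rewrite /Gk scalerA -zpowD; congr (zpow _ _ *: _); lia.
  have G0 a b : {ae mu, forall t, G t a b = 0}.
    have Gf j : fourier (fun t => G t a b) j = 0.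
      have [j0|j0] := ltP j 0; first exact: (SG.1 a b).2.
      (* For j >= 0, the j-th coefficient of G is the coefficient of index -1 of z^-(j+1) G, which
         is analytic. *)
      have /(_ (- 1)) := ((SGk `|j|.+1%N).1 a b).2.
      rewrite fou_zpow => h; rewrite -[RHS]h//; congr fourier; lia.
    apply: filterS (fourier_unique (ent1 a b (HpM_LpM SG.1)) Gf) => t h.
    exact: h.
  have : {ae mu, forall t, forall ab : 'I_n * 'I_n, G t ab.1 ab.2 = 0}.
    by apply: filter_forall => ab; exact: G0.
  by apply: filterS => t Gt _; apply/matrixP => a b; rewrite mxE (Gt (a, b)).
have fact F : S F -> exists2 F', HpM 2%:E F' & F = (fun t => Q t *m F' t) %[ae mu].
  move=> SF; have F2 := HpM_LpM SF.1.
  pose F' t := (Q t)^t* *m F t.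
  have F'H : HpM 2%:E F'.
    move=> a b; split; last exact: adjW_analytic.
    by apply: (LpMyM2 _ F2); apply: LpM_adj => //; exact: le1_y.
  exists F' => //.
  have SG : S (fun t => F t - Q t *m F' t) by apply: SB => //; exact: SM.
  have QG : (fun t => (Q t)^t* *m (F t - Q t *m F' t)) = cst 0 %[ae mu].
    apply: filterS QQ => t /(_ Logic.I) QQt _; rewrite /= in QQt *.
    (* The difference Q E - Q, with E = [pid_mx r], has zero Gram matrix. Hence E Q^* = Q^*, which
       makes Q^* annihilate the remainder. *)
    have QE : Q t *m pid_mx r = Q t.
      apply/eqP; rewrite -subr_eq0; apply/eqP/adjmx_mul_eq0.
      have adjB (X Y : 'M[R[i]]_n) : (X - Y)^t* = X^t* - Y^t*.
        by rewrite linearB /= map_mxB.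
      rewrite adjB adjmxM !mulmxBr !mulmxBl -!mulmxA QQt.
      have -> : ((pid_mx r : 'M[R[i]]_n)^t*) = pid_mx r by rewrite tr_pid_mx map_pid_mx.
      have QQE : (Q t)^t* *m (Q t *m pid_mx r) = pid_mx r *m (pid_mx r : 'M[R[i]]_n).
        by rewrite mulmxA QQt.
      by rewrite !QQE !pid_mx_id// !subrr.
    have EQ : pid_mx r *m (Q t)^t* = (Q t)^t*.
      rewrite -[in RHS]QE adjmxM; congr (_ *m _).
      by rewrite tr_pid_mx map_pid_mx.
    by rewrite mulmxBr mulmxA QQt /F' mulmxA EQ subrr.
  apply: filterS (QF0 _ SG QG) => t /(_ Logic.I) /eqP.
  by rewrite subr_eq0 => /eqP.
have th1 : {ae mu, forall t, theta t * conjc (theta t) = 1}.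
  apply: filterS thI.2 => t h.
  by rewrite -sqr_normc h expr1n.
have Sth : S (fun t => (theta t)%:M).
  have H2 : HpM 2%:E (fun t => (theta t)%:M : 'M[R[i]]_n).
    move=> a b; under eq_fun do rewrite mxE.
    rewrite (_ : (fun t => _) = (fun t => (a == b)%:R * theta t)).
      by apply: HpyM2; [exact: Hpy_cst|apply: HpW2; exact: thI.1].
    by apply/funext => t; rewrite mulr_natl.
  split=> // a b; apply: (ae_analytic (f := fun t => K t a b)).
  - by apply: ent1; exact: HpM_LpM (HpMyW2 KH).
  - by apply: kap1; exact: HpM_LpM.
  - apply: filterS th1 => t h _; rewrite /kap mul_mx_scalar mxE mulrA.
    by rewrite [conjc _ * _]mulrC h mul1r.
  - exact: (KH a b).2.
have [Th ThH ThE] := fact _ Sth.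
(* At some point theta I = Q Th with theta of modulus 1, so Q is invertible there, and with it Q^* Q
   = [pid_mx r]; an invertible idempotent is the identity. *)
have r1 : pid_mx r = 1%:M :> 'M[R[i]]_n.
  have /filter_ex[t [[QQt thE] tht]] : {ae mu, forall t, ((Q t)^t* *m Q t = pid_mx r /\
      (theta t)%:M = Q t *m Th t) /\ theta t * conjc (theta t) = 1}.
    by apply: filterS3 QQ ThE th1 => t /(_ Logic.I) ? /(_ Logic.I) ? ?.
  have Qu : Q t *m (conjc (theta t) *: Th t) = 1%:M.
    rewrite -scalemxAr -thE scale_scalar_mx; congr (_%:M).
    by rewrite mulrC.
  have [Qunit _] := mulmx1_unit Qu.
  have Eunit : pid_mx r \in @unitmx (R[i]) n.
    rewrite -QQt unitmx_mul Qunit andbT.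
    have QuJ : (conjc (theta t) *: Th t)^t* *m (Q t)^t* = 1%:M.
      by rewrite -adjmxM Qu trmx1 map_mx1.
    by case: (mulmx1_unit QuJ).
  by rewrite -[LHS]mul1mx -(mulVmx Eunit) -mulmxA pid_mx_id// mulVmx.
exists Q; split.
- by split=> //; rewrite -r1.
- exact: SQ.
- move=> F FH FA; split; first by split=> //; rewrite -r1.
  exact: fact.
Qed.

End Beurling.

(** * Cancelling a factor theta by coprimeness *)

Section Coprime.
Context {R : realType} {n : nat}.
Variables (theta : R -> R[i]) (A : R -> 'M[R[i]]_n).
Hypotheses (thI : inner_fun theta) (AH : HpM 2%:E A).
Hypothesis coprA : left_coprime A (fun t => (theta t)%:M).
Local Notation mu := (circ R).

Lemma inner_mulJ : {ae mu, forall t, theta t * conjc (theta t) = 1}.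
Proof. by apply: filterS thI.2 => t h; rewrite -sqr_normc h expr1n. Qed.

Lemma Lpy_inner : Lp +oo theta. Proof. by case: thI => -[]. Qed.

Lemma Lpy_innerJ : Lp +oo (fun t => conjc (theta t)).
Proof. by apply: Lp_conj; [exact: le1_y|exact: Lpy_inner]. Qed.

Lemma HpM_inner : HpM +oo (fun t => (theta t)%:M : 'M[R[i]]_n).
Proof.
move=> a b; under eq_fun do rewrite mxE.
rewrite (_ : (fun t => _) = (fun t => (a == b)%:R * theta t)).
  by apply: HpyM; [exact: Hpy_cst|exact: thI.1].
by apply/funext => t; rewrite mulr_natl.
Qed.

Lemma LpMyZ (c : R -> R[i]) (F : R -> 'M[R[i]]_n) : Lp +oo c -> LpM +oo F ->
  LpM +oo (fun t => c t *: F t).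
Proof. by move=> cy Fy a b; under eq_fun do rewrite mxE; apply: LpyM => //; exact: Fy. Qed.

(** Since Q itself belongs to the subspace, conj(theta) K Q is analytic. Once Q is a constant U, the
    entries of conj(theta) K are combinations of its entries with coefficients from the inverse of
    U. *)
Lemma coprime_cancel (K : R -> 'M[R[i]]_n) : HpM +oo K ->
  (forall a b, analytic (fun t => conjc (theta t) * (K t *m A t) a b)) ->
  HpM +oo (fun t => conjc (theta t) *: K t).
Proof.
move=> KH KA.
have [Q [Qin [QH QA] Qdiv]] := beurling thI KH.
have thdiv : left_inner_divisor Q (fun t => (theta t)%:M).
  apply: Qdiv; first exact/HpMyW2/HpM_inner.
  move=> a b; apply: (ae_analytic (f := fun t => K t a b)).
  - exact/LpyW1/(HpM_LpM KH).
  - apply: LpyM1; first exact: Lpy_innerJ.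
    by apply/LpyW1/LpMyM; [exact: HpM_LpM|exact/HpM_LpM/HpM_inner].
  - apply: filterS inner_mulJ => t h _; rewrite mul_mx_scalar mxE mulrA.
    by rewrite [conjc _ * _]mulrC h mul1r.
  - exact: (KH a b).2.
have [U Uu QU] := coprA (Qdiv A AH KA) thdiv.
have Ku : U \in unitmx by exact: unitarymx_unit.
move=> a b; split; first by apply: LpMyZ; [exact: Lpy_innerJ|exact: HpM_LpM].
have L1 F c : LpM +oo F -> Lp 1 (fun t => conjc (theta t) * (F t) a c).
  by move=> Fy; apply: LpyM1; [exact: Lpy_innerJ|exact/LpyW1/Fy].
have KQy : LpM +oo (fun t => K t *m Q t).
  by apply: LpMyM; [exact: HpM_LpM|exact: (HpM_LpM Qin.1)].
apply: (ae_analytic (f := fun t => \sum_c (invmx U) c b * (conjc (theta t) * (K t *m Q t) a c))).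
- by apply: Lp_sum => [|c _]; [exact: lexx|apply: LpyM1; [exact: Lp_cst|exact: L1]].
- by apply/LpyW1/LpMyZ; [exact: Lpy_innerJ|exact: HpM_LpM].
- apply: filterS QU => t /(_ Logic.I) -> _.
  rewrite /cst -[in RHS](mulmxK Ku (K t)) scalemxAl mxE; apply: eq_bigr => c _.
  by rewrite mulrC [in RHS]mxE.
- apply: analytic_sum => c _; first by apply: LpyM1; [exact: Lp_cst|exact: L1].
  by move=> j j0; rewrite fourierZ ?QA ?mulr0//; exact: L1.
Qed.

End Coprime.

(** * Antianalytic functions and model spaces *)

Section Antianalytic.
Context {R : realType}.
Implicit Types (f g h r : R -> R[i]) (t : R).
Local Notation mu := (circ R).

Lemma ae_H1 r r' : Lp 1 r' -> r = r' %[ae mu] -> H1 r -> H1 r'.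
Proof.
move=> r'1 rr' [r1 rA]; split=> // h hH.
apply: (ae_analytic _ _ _ (rA h hH)); [exact: LpyM1 hH.1 r1|exact: LpyM1 hH.1 r'1|].
by apply: filterS rr' => t /(_ Logic.I) -> .
Qed.

(* Boundary functions of the class z^-1 conj(H^1): no Fourier coefficient of
   index j >= 0. *)
Definition coH1 g := H1 (fun t => conjc (g t) * zpow (- 1) t).

Lemma coH1_fourier g (j : int) : Lp 1 g -> coH1 g -> 0 <= j -> fourier g j = 0.
Proof.
move=> g1 /H1_analytic gA j0.
rewrite -[fourier g j]conjcK -[fourier g j]/(fourier g j) -{1}[j]opprK -fourier_conj//.
have := gA (- j - 1); rewrite fourier_zpow subrK => -> //; first by rewrite conjc0.
by rewrite -opprD oppr_lt0 ltr_wpDl.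
Qed.

Lemma coH1_of_fourier g : Lp 2%:E g -> (forall j : int, 0 <= j -> fourier g j = 0) ->
  Hp 2%:E (fun t => conjc (g t) * zpow (- 1) t).
Proof.
move=> g2 g0; have gc : Lp 2%:E (fun t => conjc (g t)) by apply: Lp_conj => //; exact: le1_2.
split; first by under eq_fun do rewrite mulrC; apply: LpyM2 => //; exact: Lpy_zpow.
move=> j j0; rewrite fourier_zpow opprK fourier_conj; last exact: Lp2W1.
by rewrite g0 ?conjc0// oppr_ge0; lia.
Qed.

Lemma coH1D g g' : coH1 g -> coH1 g' -> coH1 (fun t => g t + g' t).
Proof.
move=> gH g'H; rewrite /coH1; under eq_fun do rewrite conjcD mulrDl.
exact: H1D.
Qed.

Lemma coH1N g : coH1 g -> coH1 (fun t => - g t).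
Proof.
move=> gH; rewrite /coH1; under eq_fun do rewrite conjcN mulNr.
exact: H1N.
Qed.

Lemma coH1_sum (I : Type) (s : seq I) (q : pred I) (F : I -> R -> R[i]) :
  (forall i, q i -> coH1 (F i)) -> coH1 (fun t => \sum_(i <- s | q i) F i t).
Proof.
move=> FH; rewrite /coH1.
rewrite (_ : (fun t => _) =
  (fun t => \sum_(i <- s | q i) (conjc (F i t) * zpow (- 1) t))); first exact: H1_sum.
by apply/funext => t; rewrite (rmorph_sum (@conjc R)) mulr_suml.
Qed.

Lemma coH1M h g : Hp +oo h -> coH1 g -> coH1 (fun t => conjc (h t) * g t).
Proof.
move=> hH gH; rewrite /coH1; under eq_fun do rewrite conjcM conjcK -mulrA.
exact: H1M.
Qed.

(** The product carries z^-2, one factor more than the class demands; the surplus is absorbed by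
    multiplying an H^1 function by z. *)
Lemma coH1_mul2 f g : Hp 2%:E (fun t => conjc (f t) * zpow (- 1) t) ->
  Hp 2%:E (fun t => conjc (g t) * zpow (- 1) t) -> coH1 (fun t => f t * g t).
Proof.
move=> fH gH; rewrite /coH1.
have := H1M (@Hpy_zpow R 1 ler01) (H1_mul2 fH gH); congr H1; apply/funext => t.
rewrite conjcM; have := zpowVr 1 t.
move: (zpow 1 t) (zpow (- 1) t) => z z' zz'.
have -> : z * (conjc (f t) * z' * (conjc (g t) * z')) = (z * z') * (conjc (f t) * conjc (g t) * z') by ring.
by rewrite zz' mul1r.
Qed.

Lemma ae_coH1 g g' : Lp 1 g' -> g = g' %[ae mu] -> coH1 g -> coH1 g'.
Proof.
move=> g'1 gg'; apply: ae_H1.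
  by apply: Lp1_zpow; apply: Lp_conj => //; exact: lexx.
by apply: filterS gg' => t /(_ Logic.I) -> .
Qed.

Lemma fourier_adj_orth h g (j : int) : Hp +oo h -> Lp 2%:E g ->
  (forall i : int, 0 <= i -> fourier g i = 0) -> 0 <= j ->
  fourier (fun t => conjc (h t) * g t) j = 0.
Proof.
move=> hH g2 g0 j0; have hz := HpW2 (HpyM hH (@Hpy_zpow R j j0)).
have := Hp2_orthogonal hz g2 g0 => /(congr1 (@conjc R)).
rewrite conjc0 -cintegral_conj; last exact: Lp2_ip hz.1 g2.
move=> <-; congr cintegral; apply/funext => t.
by rewrite !conjcM conjcK zpow_conj mulrAC.
Qed.

(* If the positive part of theta Q is theta times the positive part of Q, then
   theta Q = theta P(Q), so that Q = P(Q). *)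
Lemma analytic_of_cauchy theta Q W : inner_fun theta -> Lp 2%:E Q -> H1 W ->
  analytic (fun t => theta t * Q t) ->
  (forall j : nat, fourier (fun t => theta t * (Q t - W t)) j%:Z =
     \sum_(i < j.+1) fourier theta i%:Z * fourier (fun t => Q t - W t) (j%:Z - i%:Z)) ->
  analytic Q.
Proof.
move=> thI Q2 WH thQ H.
have thH := thI.1; have thy := thH.1.
have [p pH pE] := riesz_projection Q2.
have Q1 := Lp2W1 Q2; have p2 := pH.1; have p1 := Lp2W1 p2; have W1 := WH.1.
have E : (fun t => theta t * Q t - theta t * p t) = cst 0 %[ae mu].
  apply: fourier_unique => [|j].
    by apply: LpB; [exact: lexx|exact: LpyM1|exact: LpyM1].
  rewrite fourierB; [|exact: LpyM1|exact: LpyM1].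
  case: j => j; last first.
    by rewrite thQ// (HpyM2 thH pH).2// subrr.
  rewrite (fourierM_cauchy j thH (H1_Hp2 pH)).
  (* W obeys the Cauchy product formula by itself, so it drops out of both sides and leaves the
     formula for the square-integrable Q alone. *)
  have := H j.
  under eq_fun do rewrite mulrBr.
  rewrite fourierB; [|exact: LpyM1|exact: LpyM1].
  rewrite (fourierM_cauchy j thH WH).
  have -> : \sum_(i < j.+1) fourier theta i%:Z * fourier (fun t => Q t - W t) (j%:Z - i%:Z) =
      \sum_(i < j.+1) fourier theta i%:Z * fourier Q (j%:Z - i%:Z) -
      \sum_(i < j.+1) fourier theta i%:Z * fourier W (j%:Z - i%:Z).
    by rewrite -sumrB; apply: eq_bigr => i _; rewrite fourierB// mulrBr.
  move=> /addIr ->.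
  apply/eqP; rewrite subr_eq0; apply/eqP; apply: eq_bigr => i _.
  by rewrite pE// subr_ge0 lez_nat -ltnS.
apply: (ae_analytic p1 Q1 _ pH.2).
have th1 := inner_mulJ thI.
apply: filterS2 E th1 => t /(_ Logic.I) + th _.
rewrite -mulrBr => /(congr1 (fun x => conjc (theta t) * x)).
by rewrite mulrA [conjc _ * _]mulrC th mul1r mulr0 => /eqP; rewrite subr_eq0 => /eqP.
Qed.

End Antianalytic.

(** * Model spaces through Fourier coefficients *)

Section ModelSpace.
Context {R : realType} {n : nat}.
Implicit Types (F G : R -> 'M[R[i]]_n) (w : R -> R[i]) (t : R).
Local Notation mu := (circ R).

Lemma inner_prod_char F a b j :
  inner_prod F (fun t => zpow j t *: delta_mx a b) = fourier (fun t => F t a b) j.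
Proof.
rewrite (_ : (fun t => zpow j t *: delta_mx a b) = (fun t =>
    ((fun=> 1) t * zpow j t) *: (((fun=> 1%:M) t)^t* *m delta_mx a b))).
  rewrite (inner_prod_test (fun=> 1) (fun=> 1%:M)).
  by under eq_fun do rewrite conjc1 mul1r mul1mx.
by apply/funext => t; rewrite mul1r trmx1 map_mx1 mul1mx.
Qed.

(** Testing against G = z^j E_ab isolates the coefficients; conversely the entries of conj(w) F are
    orthogonal to H^2. This form says that conj(w) F is antianalytic, the property used later. *)
Lemma model_spaceP w F : Hp +oo w -> model_space w F <-> HpM 2%:E F /\
  forall a b (j : int), 0 <= j -> fourier (fun t => conjc (w t) * F t a b) j = 0.
Proof.
move=> wH; split=> -[FH h]; split=> //.
  move=> a b j j0; have F2 := HpM_LpM FH.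
  rewrite (_ : (fun t => _) = (fun t => (conjc (w t) *: F t) a b)); last first.
    by apply/funext => t; rewrite mxE.
  rewrite -inner_prod_char.
  have := h (fun t => zpow j t *: delta_mx a b); rewrite /inner_prod => <-.
    congr cintegral; apply/funext => t.
    rewrite !adjmxZ adjmx_delta -!scalemxAl -!scalemxAr !mxtraceZ.
    by rewrite mulrCA.
  by apply: HpM2Z; [exact: Hpy_zpow|exact/HpMyW2/HpM_cst].
move=> G GH; rewrite inner_prodE; last 2 first.
- exact: HpM_LpM.
- by apply: LpM2Z; [exact: wH.1|exact: HpM_LpM].
apply: big1 => b _; apply: big1 => a _.
have wF : Lp 2%:E (fun t => conjc (w t) * F t a b).
  by apply: LpyM2; [apply: Lp_conj; [exact: le1_y|exact: wH.1]|exact: (FH a b).1].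
have := Hp2_orthogonal (GH a b) wF (h a b) => /(congr1 (@conjc R)).
rewrite conjc0 -cintegral_conj; last by apply: Lp2_ip => //; exact: (GH a b).1.
move=> <-; congr cintegral; apply/funext => t.
by rewrite mxE !conjcM !conjcK; ring.
Qed.

Lemma riesz_matrix F : LpM 2%:E F -> exists2 G, HpM 2%:E G &
  forall a b (j : int), 0 <= j -> fourier (fun t => G t a b) j = fourier (fun t => F t a b) j.
Proof.
move=> F2.
have ex (ab : 'I_n * 'I_n) : exists p, Hp 2%:E p /\ forall j : int, 0 <= j ->
    fourier p j = fourier (fun t => F t ab.1 ab.2) j.
  by have [p ? ?] := riesz_projection (F2 ab.1 ab.2); exists p.
have [p pP] := choice ex.
exists (fun t => \matrix_(a, b) p (a, b) t).
  by move=> a b; under eq_fun do rewrite mxE; exact: (pP (a, b)).1.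
by move=> a b j j0; under eq_fun do rewrite mxE; exact: (pP (a, b)).2.
Qed.

Lemma inner_funX w k : inner_fun w -> inner_fun (fun t => w t ^+ k).
Proof.
move=> [wH w1]; split; first exact: HpyX.
by apply: filterS w1 => t wt; rewrite normrX wt expr1n.
Qed.

(** F' is P(conj(w) F), and k is defined as the difference F - w F', so that the splitting holds at
    every point. *)
Lemma model_split w F : inner_fun w -> HpM 2%:E F ->
  exists k F', [/\ model_space w k, HpM 2%:E F' & forall t, F t = k t + w t *: F' t].
Proof.
move=> wI FH; have wH := wI.1.
have cwy := Lpy_innerJ wI.
have F2 := HpM_LpM FH.
have [G GH GE] := riesz_matrix (LpM2Z cwy F2).
have G2 := HpM_LpM GH.
exists (fun t => F t - w t *: G t), G; split=> // [|t]; last by rewrite subrK.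
apply/model_spaceP => //; split=> [|a b j j0].
  by apply: HpM2B => //; exact: HpM2Z.
have cwF : Lp 1 (fun t => conjc (w t) * F t a b) by exact/LpyM1/Lp2W1/F2.
have G1 : Lp 1 (fun t => G t a b) by exact/Lp2W1/G2.
rewrite (@ae_fourier _ _ (fun t => conjc (w t) * F t a b - G t a b)).
- rewrite fourierB// GE// (_ : (fun t => (_ *: F t) a b) = (fun t => conjc (w t) * F t a b)).
    by rewrite subrr.
  by apply/funext => t; rewrite mxE.
- apply: LpyM1 => //; under eq_fun do rewrite !mxE.
  by apply: LpB; [exact: lexx|exact/Lp2W1/F2|exact/LpyM1/G1/wH.1].
- by apply: LpB; [exact: lexx| |].
- apply: filterS (inner_mulJ wI) => t h _; rewrite !mxE mulrBr mulrA.
  by rewrite [conjc _ * w t]mulrC h mul1r.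
Qed.

Lemma model_coana w F a b : inner_fun w -> model_space w F ->
  Hp 2%:E (fun t => conjc (conjc (w t) * F t a b) * zpow (- 1) t).
Proof.
move=> wI /(model_spaceP _ wI.1)[FH Fw]; apply: coH1_of_fourier; last exact: Fw.
by apply: LpyM2; [exact: Lpy_innerJ|exact: (FH a b).1].
Qed.

End ModelSpace.

(** * Expansions in powers of theta and their tails *)

Section Tails.
Context {R : realType} {n : nat}.
Variables (theta : R -> R[i]) (m : nat).
Hypothesis thI : inner_fun theta.
Implicit Types (C : nat -> R -> 'M[R[i]]_n) (Z : R -> 'M[R[i]]_n) (t : R).

(** What remains of the expansion with m digits C_i and final remainder Z after k digits are removed
    and theta^k is divided out, for k <= m. *)
Definition tail C Z k t :=
  \sum_(k <= i < m) theta t ^+ (i - k) *: C i t + theta t ^+ (m - k) *: Z t.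

Lemma tailS C Z k t : (k < m)%N -> tail C Z k t = C k t + theta t *: tail C Z k.+1 t.
Proof.
move=> km; rewrite /tail big_ltn// subnn expr0 scale1r -addrA; congr (_ + _).
rewrite scalerDr scaler_sumr scalerA -exprS; congr (_ + _ *: _); last first.
  by rewrite subnSK.
by apply: eq_big_nat => i /andP[ki _]; rewrite scalerA -exprS subnSK.
Qed.

Lemma tail0 C Z t : tail C Z 0 t = \sum_(0 <= i < m) theta t ^+ i *: C i t + theta t ^+ m *: Z t.
Proof. by rewrite /tail subn0; congr (_ + _); apply: eq_bigr => i _; rewrite subn0. Qed.

Lemma theta_expansionE C t : (0 < m)%N ->
  theta_expansion theta m C t = \sum_(0 <= i < m) theta t ^+ i *: C i t.
Proof. by move=> m0; rewrite /theta_expansion [RHS]big_ltn// expr0 scale1r. Qed.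

Lemma HpM2_bignat k C : (forall i, (i < m)%N -> HpM 2%:E (C i)) ->
  HpM 2%:E (fun t => \sum_(k <= i < m) theta t ^+ (i - k) *: C i t).
Proof.
move=> CH; rewrite (_ : (fun t => _) = (fun t =>
    \sum_(k <= i < m | (i < m)%N) theta t ^+ (i - k) *: C i t)).
  by apply: HpM2_sum => i im; apply: HpM2Z; [exact/HpyX/thI.1|exact: CH].
apply/funext => t; rewrite big_nat_cond [RHS]big_nat_cond; apply: eq_bigl => i.
by case: (k <= i)%N; case: (i < m)%N.
Qed.

Lemma tailH C Z k : (forall i, (i < m)%N -> HpM 2%:E (C i)) -> HpM 2%:E Z ->
  HpM 2%:E (tail C Z k).
Proof.
move=> CH ZH; apply: HpM2D; first exact: HpM2_bignat.
by apply: HpM2Z => //; exact/HpyX/thI.1.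
Qed.

End Tails.

Lemma theta_decomposition {R : realType} {n : nat} (theta : R -> R[i]) (m : nat)
    (F : R -> 'M[R[i]]_n) : inner_fun theta -> HpM 2%:E F ->
  exists C Z, [/\ forall i, (i < m)%N -> model_space theta (C i), HpM 2%:E Z &
    forall t, F t = \sum_(0 <= i < m) theta t ^+ i *: C i t + theta t ^+ m *: Z t].
Proof.
move=> thI FH; elim: m => [|m [C [Z [CM ZH FE]]]].
  by exists (fun _ => F), F; split=> // t; rewrite big_geq// expr0 scale1r add0r.
have [k [Z' [kM Z'H ZE]]] := model_split thI ZH.
exists (fun i => if i == m then k else C i), Z'; split=> // [i|t].
  by rewrite ltnS leq_eqVlt; case: eqP => //= _ im; exact: CM.
rewrite big_nat_recr//= eqxx FE ZE scalerDr scalerA -exprSr addrA; congr (_ + _ + _).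
by apply: eq_big_nat => i /andP[_ im]; rewrite ltn_eqF.
Qed.

(** * The Toeplitz system *)

Section Toeplitz.
Context {R : realType} {n : nat}.
Variables (theta : R -> R[i]) (m : nat).
Variables (A_ B_ K_ : nat -> R -> 'M[R[i]]_n) (A' L' A B L : R -> 'M[R[i]]_n).
Local Notation mu := (circ R).
Hypotheses (thI : inner_fun theta)
  (A_M : forall i, (i < m)%N -> model_space theta (A_ i))
  (B_M : forall i, (i < m)%N -> model_space theta (B_ i))
  (K_M : forall i, (i < m)%N -> model_space theta (K_ i))
  (A'H : HpM 2%:E A') (L'H : HpM 2%:E L')
  (AH : HpM 2%:E A) (BH : HpM 2%:E B) (LH : HpM +oo L).
Let At := tail theta m A_ A'.
Let Bt := tail theta m B_ (fun=> 0).
Let Lt := tail theta m K_ L'.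
Hypotheses (AE : A = At 0%N %[ae mu]) (BE : B = Bt 0%N %[ae mu]) (LE : L = Lt 0%N %[ae mu]).
Implicit Types (i k : nat) (t : R) (a b : 'I_n).

Let X k t := \sum_(0 <= i < k) K_ i t *m A_ (k.-1 - i)%N t.
(** Y_k and W_k are the quotients of L A and B - L A left after k digits: by [YS] and [WS], almost
    everywhere L A = sum_(i<k) theta^i X_(i+1) + theta^k Y_k and B - L A = sum_(i<k) theta^i D_i +
    theta^k W_k. Thus W_k is the H^1 function separating Q_k from e_k, and defining e_k as Q_k - W_k
    gives its recursion without handling the explicit sum. *)
Let Y k t := \sum_(0 <= i < k) K_ i t *m At (k - i)%N t + Lt k t *m At 0%N t.
Let D k t := B_ k t - X k.+1 t.
Let W k t := Bt k t - Y k t.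
Let Q k t := conjc (theta t) ^+ k *: (B t - L t *m A t).
Let e k a b t := Q k t a b - W k t a b.

Let thH : Hp +oo theta := thI.1.
Let thy : Lp +oo theta := thI.1.1.
Let cthy := Lpy_innerJ thI.
Let th1 := inner_mulJ thI.

Let A_H i : (i < m)%N -> HpM 2%:E (A_ i). Proof. by move=> /A_M[]. Qed.
Let B_H i : (i < m)%N -> HpM 2%:E (B_ i). Proof. by move=> /B_M[]. Qed.
Let K_H i : (i < m)%N -> HpM 2%:E (K_ i). Proof. by move=> /K_M[]. Qed.
Let AtH k : HpM 2%:E (At k). Proof. exact: tailH. Qed.
Let BtH k : HpM 2%:E (Bt k). Proof. by apply: tailH => //; exact/HpMyW2/HpM_cst. Qed.
Let LtH k : HpM 2%:E (Lt k). Proof. exact: tailH. Qed.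

Let subE (F G : 'M[R[i]]_n) a b : (F - G) a b = F a b - G a b.
Proof. by rewrite !mxE. Qed.

Let H1_mulmx (F G : R -> 'M[R[i]]_n) a b : HpM 2%:E F -> HpM 2%:E G ->
  H1 (fun t => (F t *m G t) a b).
Proof.
move=> FH GH; under eq_fun do rewrite mxE; apply: H1_sum => c _.
by apply: H1_mul2; [exact: FH|exact: GH].
Qed.

(** Each At_(k-i) releases its digit A_(k-i); in Lt_k At_0 the digit K_k is released first, then
    A_0. The released products form the antidiagonal sum X_(k+1). *)
Let YS k t : (k < m)%N -> Y k t = X k.+1 t + theta t *: Y k.+1 t.
Proof.
move=> km; rewrite /Y /X [in RHS]big_nat_recr// [X in _ + _ *: (X + _)]big_nat_recr//=.
rewrite subSnn subnn.
have -> : \sum_(0 <= i < k) K_ i t *m At (k - i)%N t =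
    \sum_(0 <= i < k) K_ i t *m A_ (k - i)%N t +
    theta t *: \sum_(0 <= i < k) K_ i t *m At (k.+1 - i)%N t.
  rewrite scaler_sumr -big_split; apply: eq_big_nat => i /andP[_ ik] /=.
  rewrite /At tailS ?(leq_ltn_trans (leq_subr _ _))//.
  by rewrite mulmxDr scalemxAr subSn// ltnW.
rewrite /Lt tailS// mulmxDl.
have {1}-> : At 0%N t = A_ 0%N t + theta t *: At 1%N t by rewrite /At tailS// (leq_ltn_trans _ km).
rewrite (mulmxDr (K_ k t) (A_ 0%N t)) -scalemxAr -scalemxAl.
rewrite -!addrA; congr (_ + _); rewrite [LHS]addrCA; congr (_ + _).
by rewrite -!scalerDr.
Qed.

Let WS k t : (k < m)%N -> W k t = D k t + theta t *: W k.+1 t.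
Proof.
move=> km; rewrite /W /D (YS _ km) /Bt tailS// scalerBr.
by rewrite opprD addrACA.
Qed.

Let WSe k t a b : (k < m)%N -> W k t a b = D k t a b + theta t * W k.+1 t a b.
Proof. by move=> km; rewrite (WS _ km) [LHS]mxE [X in _ + X]mxE. Qed.

Let XH k a b : (k <= m)%N -> H1 (fun t => X k t a b).
Proof.
move=> km; rewrite (_ : (fun t => _) = (fun t =>
    \sum_(0 <= i < k | (i < k)%N) (K_ i t *m A_ (k.-1 - i)%N t) a b)).
  apply: H1_sum => i ik; apply: H1_mulmx; first by apply: K_H; exact: leq_trans km.
  by apply: A_H; rewrite (leq_ltn_trans (leq_subr _ _))// (leq_trans _ km)// prednK// (leq_ltn_trans _ ik).
apply/funext => t; rewrite /X summxE big_nat_cond [RHS]big_nat_cond; apply: eq_bigl => i.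
by case: (i < k)%N; rewrite ?andbT ?andbF.
Qed.

Let YH k a b : (k <= m)%N -> H1 (fun t => Y k t a b).
Proof.
move=> km; under eq_fun do rewrite mxE; apply: H1D; last exact: H1_mulmx.
rewrite (_ : (fun t => _) = (fun t =>
    \sum_(0 <= i < k | (i < k)%N) (K_ i t *m At (k - i)%N t) a b)).
  apply: H1_sum => i ik; apply: H1_mulmx => //; apply: K_H; exact: leq_trans km.
apply/funext => t; rewrite summxE big_nat_cond [RHS]big_nat_cond; apply: eq_bigl => i.
by case: (i < k)%N; rewrite ?andbT ?andbF.
Qed.

Let WH k a b : (k <= m)%N -> H1 (fun t => W k t a b).
Proof.
move=> km; rewrite /W; under eq_fun do rewrite subE; apply: H1D; first exact/H1_Hp2/BtH.
exact/H1N/YH.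
Qed.

Let Q2 k : LpM 2%:E (Q k).
Proof.
apply: LpM2Z.
  rewrite (_ : (fun t => _) = (fun t => conjc (theta t ^+ k))).
    by apply: Lp_conj; [exact: le1_y|exact: (HpyX k thH).1].
  by apply/funext => t; rewrite conjcX.
apply: LpMB; [exact: le1_2|exact: HpM_LpM|].
by apply: LpMyM2; exact: HpM_LpM.
Qed.

Let Q1 k a b : Lp 1 (fun t => Q k t a b). Proof. exact/Lp2W1/Q2. Qed.

Let e1 k a b : (k <= m)%N -> Lp 1 (e k a b).
Proof. by move=> km; apply: LpB; [exact: lexx|exact: Q1|exact: (WH _ _ km).1]. Qed.

Let D1 k a b : (k < m)%N -> Lp 1 (fun t => D k t a b).
Proof.
move=> km; rewrite /D; under eq_fun do rewrite subE.
by apply: LpB; [exact: lexx|exact/Lp2W1/(HpM_LpM (B_H km))|exact: (XH _ _ km).1].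
Qed.

Let e0 a b : e 0 a b = cst 0 %[ae mu].
Proof.
apply: filterS3 AE BE LE => t /(_ Logic.I) Et /(_ Logic.I) Bt0 /(_ Logic.I) Lt0 _.
by rewrite /e /Q /W /Y expr0 scale1r big_geq// add0r Et Bt0 Lt0 subrr.
Qed.

Let thQ k a b : (fun t => theta t * Q k.+1 t a b) = (fun t => Q k t a b) %[ae mu].
Proof.
apply: filterS th1 => t h _.
by rewrite /Q !mxE exprS -!mulrA mulrA h mul1r.
Qed.

Let the_alg (h q q' w w' d : R[i]) : h * q' = q -> w = d + h * w' ->
  h * (q' - w') = d + (q - w).
Proof. by move=> <- ->; ring. Qed.

Let the k a b : (k < m)%N ->
  (fun t => theta t * e k.+1 a b t) = (fun t => D k t a b + e k a b t) %[ae mu].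
Proof.
move=> km; apply: filterS (thQ k a b) => t /(_ Logic.I) h _.
exact: the_alg h (WSe t a b km).
Qed.

(** One factor conj(theta) goes to K_i and the other to A_(k-i); each becomes antianalytic because
    both lie in the model space. *)
Let coX k a b : (k < m)%N -> coH1 (fun t => conjc (theta t) * (conjc (theta t) * X k.+1 t a b)).
Proof.
move=> km; rewrite (_ : (fun t => _) = (fun t => \sum_(0 <= i < k.+1 | (i < k.+1)%N) \sum_c
    (conjc (theta t) * K_ i t a c) * (conjc (theta t) * A_ (k - i)%N t c b))).
  apply: coH1_sum => i ik; apply: coH1_sum => c _; apply: coH1_mul2.
    by apply: model_coana => //; apply: K_M; exact: leq_trans km.
  by apply: model_coana => //; apply: A_M; rewrite (leq_ltn_trans (leq_subr _ _)).
apply/funext => t; rewrite mulrA /X summxE mulr_sumr big_nat_cond [RHS]big_nat_cond.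
apply: eq_big => [i|i _]; first by case: (i < k.+1)%N; rewrite ?andbT ?andbF.
by rewrite mxE mulr_sumr; apply: eq_bigr => c _; ring.
Qed.

Let coB k a b : (k < m)%N -> coH1 (fun t => conjc (theta t) * B_ k t a b).
Proof. by move=> km; apply/H1_Hp2/model_coana => //; exact: B_M. Qed.

Let cth_inv : {ae mu, forall t, conjc (theta t) * theta t = 1}.
Proof. by apply: filterS th1 => t; rewrite mulrC. Qed.

(** Induction through a e_(k+1) = a (a B_k) - a^2 X_(k+1) + a (a e_k), where a = conj(theta):
    multiplication by a preserves the antianalytic class. *)
Let coe k a b : (k <= m)%N -> coH1 (fun t => conjc (theta t) * e k a b t).
Proof.
elim: k a b => [|k IH] a b km.
  apply: (ae_coH1 (g := fun=> 0)).
  - by apply: LpyM1 => //; exact: e1.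
  - by apply: filterS (e0 a b) => t /(_ Logic.I) -> _; rewrite /cst mulr0.
  - rewrite /coH1; under eq_fun do rewrite conjc0 mul0r.
    exact/H1_Hp2/HpW2/Hpy_cst.
apply: (ae_coH1 (g := fun t => conjc (theta t) * (conjc (theta t) * B_ k t a b) -
    conjc (theta t) * (conjc (theta t) * X k.+1 t a b) +
    conjc (theta t) * (conjc (theta t) * e k a b t))).
- by apply: LpyM1 => //; exact: e1.
- apply: filterS2 cth_inv (the a b km) => t h /(_ Logic.I) hk _.
  have : conjc (theta t) * (theta t * e k.+1 a b t) = e k.+1 a b t by rewrite mulrA h mul1r.
  by rewrite hk => <-; rewrite /D subE; ring.
- apply: coH1D; last by apply: coH1M => //; exact: (IH _ _ (ltnW km)).
  apply: coH1D; first by apply: coH1M => //; exact: coB.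
  exact/coH1N/coX.
Qed.

(** In e_(k+1) = a B_k - a X_(k+1) + a e_k, with a = conj(theta), the outer terms have no
    coefficient of index >= 0. Both projections in G_k thereby become coefficients of e_k and
    e_(k+1). *)
Let fourier_X k a b (j : int) : (k <= m)%N -> 0 <= j ->
  fourier (fun t => conjc (theta t) * X k t a b) j = - fourier (e k a b) j.
Proof.
case: k => [|k] km j0.
  rewrite (ae_fourier _ (e1 a b km) (LpyW1 (Lp_cst 0)) (e0 a b)) fourier_cst if_same oppr0.
  rewrite (_ : (fun t => _) = (fun=> 0)) ?fourier_cst ?if_same//.
  by apply/funext => t; rewrite /X big_geq// mxE mulr0.
have L1 f : Lp 1 f -> Lp 1 (fun t => conjc (theta t) * f t) by exact: LpyM1.
have B1 : Lp 1 (fun t => B_ k t a b) by exact/Lp2W1/(HpM_LpM (B_H km)).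
rewrite (@ae_fourier _ _ (fun t => conjc (theta t) * B_ k t a b - e k.+1 a b t +
    conjc (theta t) * e k a b t)).
- rewrite fourierD; [|by apply: LpB; [exact: lexx|exact: L1|exact: e1]|exact/L1/e1/ltnW].
  rewrite fourierB; [|exact: L1|exact: e1].
  rewrite (coH1_fourier _ (coB a b km)); [|exact: L1|exact: j0].
  rewrite (coH1_fourier _ (coe a b (ltnW km))); [|exact/L1/e1/ltnW|exact: j0].
  by rewrite addr0 sub0r.
- exact/L1/(XH _ _ km).1.
- apply: LpD; [exact: lexx| |exact/L1/e1/ltnW].
  by apply: LpB; [exact: lexx|exact: L1|exact: e1].
- apply: filterS2 cth_inv (the a b km) => t h /(_ Logic.I) hk _.
  have : conjc (theta t) * (theta t * e k.+1 a b t) = e k.+1 a b t by rewrite mulrA h mul1r.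
  by rewrite hk => <-; rewrite /D subE; ring.
Qed.

(** One scalar equation of the Toeplitz system: block row k, matrix entry (a, b), Taylor index j.
    The triangular sum is X_(k+1), and the two projections in G_k act on conj(theta) X_k and
    conj(theta) X_(k+1). *)
Let row k a b (j : nat) :=
  fourier (fun t => B_ k t a b) j%:Z = fourier (fun t => X k.+1 t a b) j%:Z +
  (fourier (fun t => conjc (theta t) * X k t a b) j%:Z -
   \sum_(i < j.+1) fourier theta i%:Z *
     fourier (fun t => conjc (theta t) * X k.+1 t a b) (j%:Z - i%:Z)).

Let row_alg (x y z s : R[i]) : x = y + (- z + s) <-> x - y + z = s.
Proof. by split=> [->|<-]; ring. Qed.

Let rowE k a b (j : nat) : (k < m)%N -> row k a b j <->
  fourier (fun t => theta t * e k.+1 a b t) j%:Z =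
  \sum_(i < j.+1) fourier theta i%:Z * fourier (e k.+1 a b) (j%:Z - i%:Z).
Proof.
move=> km.
have B1 : Lp 1 (fun t => B_ k t a b) by exact/Lp2W1/(HpM_LpM (B_H km)).
have X1 := (XH a b km).1.
rewrite (ae_fourier _ _ _ (the a b km)); last 2 first.
- by apply: LpyM1 => //; exact: e1.
- by apply: LpD; [exact: lexx|exact: D1|exact/e1/ltnW].
rewrite fourierD; [|exact: D1|exact/e1/ltnW].
rewrite (_ : (fun t => D k t a b) = (fun t => B_ k t a b - X k.+1 t a b)); last first.
  by apply/funext => t; rewrite /D subE.
rewrite fourierB// /row fourier_X; [|exact: ltnW|by []].
have -> : \sum_(i < j.+1) fourier theta i%:Z *
    fourier (fun t => conjc (theta t) * X k.+1 t a b) (j%:Z - i%:Z) =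
    - \sum_(i < j.+1) fourier theta i%:Z * fourier (e k.+1 a b) (j%:Z - i%:Z).
  rewrite -sumrN; apply: eq_bigr => i _; rewrite fourier_X ?mulrN//.
  by rewrite subr_ge0 lez_nat -ltnS.
rewrite opprK.
exact: row_alg.
Qed.

Lemma toeplitz_rows :
  (forall a b, analytic (fun t => (conjc (theta t) ^+ m *: (B t - L t *m A t)) a b)) <->
  (forall k, (k < m)%N -> forall a b j, row k a b j).
Proof.
split=> [Qm k km a b j|H].
  apply/(rowE _ _ _ km).
  (* Analyticity descends from Q_m, since Q_k = theta Q_(k+1) almost everywhere. Then e_(k+1) =
     Q_(k+1) - W_(k+1) is in H^1 and obeys the Cauchy product formula. *)
  have QA k' : (k' <= m)%N -> forall a b, analytic (fun t => Q k' t a b).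
    move=> k'm; rewrite -(subKn k'm); move: (m - k')%N (leq_subr k' m) => i.
    elim: i => [|i IH] im a' b'; first by rewrite subn0; exact: Qm.
    have im' := ltnW im.
    have := thQ (m - i.+1) a' b'; rewrite subnSK// => h.
    apply: (ae_analytic _ _ h); [exact/LpyM1/Q1|exact: Q1|].
    by apply: (HpyM2 thH _).2; split; [exact: Q2|exact: IH].
  have eH : H1 (e k.+1 a b).
    apply: H1D; last exact/H1N/WH.
    by apply: H1_Hp2; split; [exact: Q2|exact: QA].
  exact: fourierM_cauchy.
(* Analyticity ascends from Q_0 = B - L A: row k carries it from Q_k = theta Q_(k+1) to Q_(k+1),
   with W_(k+1) as the H^1 correction in [analytic_of_cauchy]. *)
have QA k : (k <= m)%N -> forall a b, analytic (fun t => Q k t a b).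
  elim: k => [_ a b|k IH km a b].
    rewrite (_ : (fun t => _) = (fun t => (B t - L t *m A t) a b)).
      have : HpM 2%:E (fun t => B t - L t *m A t) by apply: HpM2B => //; exact: HpMyM2.
      by move=> /(_ a b)[].
    by apply/funext => t; rewrite /Q expr0 scale1r.
  apply: (analytic_of_cauchy thI (Q2 k.+1 a b) (WH a b km)).
    apply: (ae_analytic (f := fun t => Q k t a b)); [exact: Q1|exact/LpyM1/Q1| |exact/IH/ltnW].
    by apply: filterS (thQ k a b) => t h u; rewrite h.
  by move=> j; apply/(rowE _ _ _ km)/H.
exact: QA.
Qed.

Lemma toeplitz_systemE :
  toeplitz_system theta m A_ B_ K_ <-> (forall k, (k < m)%N -> forall a b j, row k a b j).
Proof.
have XE k t : (k < m)%N -> \sum_(l < m) toeplitz_block K_ k l t *m A_ l t = X k.+1 t.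
  move=> km; rewrite -(big_mkord xpredT (fun l => toeplitz_block K_ k l t *m A_ l t)).
  rewrite (big_cat_nat _ (n := k.+1))//= (_ : \sum_(k.+1 <= i < m) _ = 0) ?addr0; last first.
    rewrite big_nat_cond; apply: big1 => i /andP[/andP[ki _] _].
    by rewrite /toeplitz_block leqNgt ki/= mul0mx.
  rewrite big_nat_rev /X; apply: eq_big_nat => i /andP[_ ik].
  rewrite add0n subSS /toeplitz_block leq_subr subKn//.
have entries (M N : 'M[R[i]]_n) : (M = N) <-> (forall a b, M a b = N a b).
  by split=> [->//|h]; apply/matrixP.
have rowM k (j : nat) : (k < m)%N ->
    (proj_H2 (B_ k) j =
     proj_H2 (fun t => \sum_(l < m) toeplitz_block K_ k l t *m A_ l t) j
     + Gcoef theta A_ K_ k j) <-> (forall a b, row k a b j).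
  move=> km; rewrite entries.
  have E a b : (proj_H2 (fun t => \sum_(l < m) toeplitz_block K_ k l t *m A_ l t) j
     + Gcoef theta A_ K_ k j) a b = fourier (fun t => X k.+1 t a b) j%:Z +
  (fourier (fun t => conjc (theta t) * X k t a b) j%:Z -
   \sum_(i < j.+1) fourier theta i%:Z *
     fourier (fun t => conjc (theta t) * X k.+1 t a b) (j%:Z - i%:Z)).
    rewrite /Gcoef /proj_thetaH2 /proj_H2 !mxE.
    congr (_ + (_ - _)).
    - by congr fourier; apply/funext => t; rewrite XE.
    - by congr fourier; apply/funext => t; rewrite mxE.
    - rewrite summxE; apply: eq_bigr => i _; rewrite !mxE subzn; last by rewrite -ltnS.
      by congr (_ * _); congr fourier; apply/funext => t; rewrite mxE.
  by split=> h a b; have := h a b; rewrite E mxE.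
split=> h k km; last by move=> j; apply/(rowM _ _ km) => a b; exact: h.
by move=> a b j; have /(rowM _ _ km) := h k km j.
Qed.

Lemma toeplitz_iff :
  (forall a b, analytic (fun t => (conjc (theta t) ^+ m *: (B t - L t *m A t)) a b)) <->
  toeplitz_system theta m A_ B_ K_.
Proof. by rewrite toeplitz_rows -toeplitz_systemE. Qed.

End Toeplitz.

(** * The class C(Phi) *)

Section CriterionC.
Context {R : realType} {n : nat}.
Variables (theta : R -> R[i]) (N m : nat).
Local Notation mu := (circ R).
Hypothesis thI : inner_fun theta.
Implicit Types (F G K : R -> 'M[R[i]]_n) (t : R).

Lemma ae_inner_prod F F' G : LpM 2%:E F -> LpM 2%:E F' -> LpM 2%:E G ->
  F = F' %[ae mu] -> inner_prod F G = inner_prod F' G.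
Proof.
move=> F2 F'2 G2 FF'; rewrite !inner_prodE//; apply: eq_bigr => b _; apply: eq_bigr => a _.
apply: ae_cintegral; [exact: LpM2_ip|exact: LpM2_ip|].
by apply: filterS FF' => t /(_ Logic.I) ->.
Qed.

Lemma plus_part_unique F P P' : LpM 2%:E F -> plus_part F P -> plus_part F P' ->
  P = P' %[ae mu].
Proof.
move=> F2 [PH PE] [P'H P'E].
have P2 := HpM_LpM PH; have P'2 := HpM_LpM P'H.
have DH := HpM2B PH P'H; have D2 := HpM_LpM DH.
have FP2 := LpMB le1_2 F2 P2; have FP'2 := LpMB le1_2 F2 P'2.
have D0 : inner_prod (fun t => P t - P' t) (fun t => P t - P' t) = 0.
  rewrite [X in inner_prod X _](_ : _ = (fun t => (F t - P' t) - (F t - P t))).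
    by rewrite (inner_prodBl FP'2 FP2 D2) PE// P'E// subrr.
  by apply/funext => t; rewrite opprB [RHS]addrC subrKA.
apply: filterS (inner_prod_eq0 D2 D0) => t /(_ Logic.I) /eqP.
by rewrite subr_eq0 => /eqP ->.
Qed.

Lemma minus_part_analytic F P : LpM 2%:E F -> plus_part F P ->
  HpM 2%:E (fun t => (F t - P t)^t*).
Proof.
move=> F2 [PH PE] a b; have U2 := LpMB le1_2 F2 (HpM_LpM PH).
split; first exact: (LpM_adj le1_2 U2).
move=> j j0; under eq_fun do rewrite adjmxE.
rewrite fourier_conj; last exact/Lp2W1/U2.
rewrite -inner_prod_char PE ?conjc0//.
by apply: HpM2Z; [apply: Hpy_zpow; rewrite oppr_ge0 ltW|exact/HpMyW2/HpM_cst].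
Qed.

Let cthy := Lpy_innerJ thI.
Let thH := thI.1.

Lemma Lpy_innerJX k : Lp +oo (fun t => conjc (theta t) ^+ k).
Proof.
rewrite (_ : (fun t => _) = (fun t => conjc (theta t ^+ k))).
  by apply: Lp_conj; [exact: le1_y|exact: (HpyX k thH).1].
by apply/funext => t; rewrite conjcX.
Qed.

Let th1 := inner_mulJ thI.
Let cthX := Lpy_innerJX.

Definition defect (A B K : R -> 'M[R[i]]_n) t : 'M[R[i]]_n :=
  conjc (theta t) ^+ m *: B t - conjc (theta t) ^+ N *: (K t *m A t).

Lemma calC_iff Phi P A B K :
  LpM +oo Phi -> plus_part Phi P -> HpM 2%:E A -> HpM 2%:E B ->
  P = (fun t => theta t ^+ N *: (A t)^t*) %[ae mu] ->
  (fun t => (Phi t - P t)^t*) = (fun t => theta t ^+ m *: (B t)^t*) %[ae mu] ->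
  HpM +oo K ->
  calC Phi K <-> forall a b, analytic (fun t => defect A B K t a b).
Proof.
move=> Phiy PhiP AH BH PA UB KH.
have Phi2 := LpMyW2 Phiy.
have UH := minus_part_analytic Phi2 PhiP.
have GH := HpM2B PhiP.1 (HpMyM2 KH UH).
have Cy : LpM +oo (fun t => Phi t - K t *m (Phi t)^t*).
  apply: LpMB => //; first exact: le1_y.
  by apply: LpMyM; [exact: HpM_LpM|exact: LpM_adj le1_y Phiy].
have E2 : LpM 2%:E (defect A B K).
  apply: LpMB; [exact: le1_2|apply: LpM2Z => //; exact: HpM_LpM|].
  by apply: LpM2Z => //; apply: LpMyM2; exact: HpM_LpM.
(* Splitting Phi into P and Phi - P leaves P - K (Phi - P)^* in H^2; the other two terms, Phi - P =
   conj(theta)^m B and K P^* = conj(theta)^N K A, form the defect. *)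
have CE : (fun t => Phi t - K t *m (Phi t)^t*) =
    (fun t => (P t - K t *m (Phi t - P t)^t*) + defect A B K t) %[ae mu].
  apply: filterS2 PA UB => t /(_ Logic.I) PAt /(_ Logic.I) UBt _.
  have Us : Phi t - P t = conjc (theta t) ^+ m *: B t.
    by rewrite -[LHS]adjmxK UBt adjmxZ adjmxK conjcX.
  have Ps : (P t)^t* = conjc (theta t) ^+ N *: A t by rewrite PAt adjmxZ adjmxK conjcX.
  rewrite /defect -Us scalemxAr -Ps.
  have -> : (Phi t)^t* = (P t)^t* + (Phi t - P t)^t* by rewrite -adjmxD addrC subrK.
  rewrite mulmxDr; move: (K t *m (P t)^t*) (K t *m (Phi t - P t)^t*) => x y.
  by rewrite addrACA [P t + _]addrC subrK opprD [- x - y]addrC.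
have E1 a b := Lp2W1 (E2 a b).
have G1 a b := Lp2W1 (HpM_LpM GH a b).
have CEe a b : (fun t => (Phi t - K t *m (Phi t)^t*) a b) =
    (fun t => (P t - K t *m (Phi t - P t)^t*) a b + defect A B K t a b) %[ae mu].
  by apply: filterS CE => t /(_ Logic.I) -> _; rewrite [LHS]mxE.
have S1 a b := LpD (lexx _) (G1 a b) (E1 a b).
split=> [[_ CH] a b|EA].
  have GEA := ae_analytic (LpyW1 (Cy a b)) (S1 a b) (CEe a b) (CH a b).2.
  have := analyticB (S1 a b) (G1 a b) GEA (GH a b).2; congr analytic.
  by apply/funext => t; rewrite addrAC subrr add0r.
split=> [|a b]; first exact: KH.
split; first exact: Cy.
apply: (ae_analytic (S1 a b) (LpyW1 (Cy a b))).
  by apply: filterS (CEe a b) => t h _; exact: esym (h Logic.I).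
exact: analyticD (G1 a b) (E1 a b) (GH a b).2 (EA a b).
Qed.

Lemma defectE A B K t : (m <= N)%N -> defect A B K t =
  conjc (theta t) ^+ m *: (B t - (conjc (theta t) ^+ (N - m) *: K t) *m A t).
Proof.
by move=> mN; rewrite scalerBr -scalemxAl scalerA -exprD subnKC.
Qed.

Lemma cancel_power A B K p : left_coprime A (fun t => (theta t)%:M) ->
  HpM 2%:E A -> HpM 2%:E B -> HpM +oo K ->
  (forall a b, analytic (fun t => defect A B K t a b)) -> (p + m <= N)%N ->
  HpM +oo (fun t => conjc (theta t) ^+ p *: K t).
Proof.
move=> coprA AH BH KH EA.
have E2 : LpM 2%:E (defect A B K).
  apply: LpMB; [exact: le1_2|apply: LpM2Z => //; exact: HpM_LpM|].
  by apply: LpM2Z => //; apply: LpMyM2; exact: HpM_LpM.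
have EH : HpM 2%:E (defect A B K) by move=> a b; split; [exact: E2|exact: EA].
elim: p => [_|p IH pN].
  by rewrite (_ : (fun t => _) = K)//; apply/funext => t; rewrite expr0 scale1r.
have KpH := IH (ltnW pN).
rewrite (_ : (fun t => _) = (fun t => conjc (theta t) *: (conjc (theta t) ^+ p *: K t))).
  apply: (coprime_cancel thI AH coprA KpH) => a b.
  (* C is theta^(N-p-1) times the difference of conj(theta)^m B and the defect, hence equals
     conj(theta)^(p+1) K A. Both terms are in H^2, the first because p + 1 + m <= N. *)
  pose C t := theta t ^+ (N - p.+1 - m) *: B t - theta t ^+ (N - p.+1) *: defect A B K t.
  have CH : HpM 2%:E C.
    by apply: HpM2B; apply: HpM2Z => //; exact: HpyX.
  apply: (@ae_analytic _ (fun t => C t a b)).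
  - exact/Lp2W1/(CH a b).1.
  - by apply: LpyM1 => //; apply: Lp2W1; apply: (LpMyM2 (HpM_LpM KpH) (HpM_LpM AH)).
  - apply: filterS th1 => t h _.
    have red k l : theta t ^+ k * conjc (theta t) ^+ (k + l) = conjc (theta t) ^+ l.
      by rewrite exprD mulrA -exprMn h expr1n mul1r.
    have red' k l : theta t ^+ (k + l) * conjc (theta t) ^+ l = theta t ^+ k.
      by rewrite exprD -mulrA -exprMn h expr1n mulr1.
    have e1 : (N - p.+1 = (N - p.+1 - m) + m)%N by lia.
    have e2 : (N = (N - p.+1) + p.+1)%N by lia.
    have -> : C t = conjc (theta t) *: ((conjc (theta t) ^+ p *: K t) *m A t).
      rewrite /C /defect scalerBr !scalerA [in X in _ - (X *: _ - _)]e1 red'.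
      rewrite [X in _ ^+ _ * _ ^+ X]e2 red opprB addrCA subrr addr0.
      by rewrite -scalemxAl scalerA -exprS.
    by rewrite mxE.
  - exact: (CH a b).2.
by apply/funext => t; rewrite scalerA -exprS.
Qed.

(** Both sides say that K - T is theta^N times an H^2 function, T being the proposed projection. If
    T is the projection, split K - T as k + theta^N F with k in the model space; orthogonality to k
    gives <k, k> = 0. Conversely theta^N L' is orthogonal to the model space, and it remains to see
    that T belongs to it. *)
Lemma orth_proj_expansionP (K_ : nat -> R -> 'M[R[i]]_n) K :
  (0 < m <= N)%N -> (forall i, (i < m)%N -> model_space theta (K_ i)) -> HpM +oo K ->
  orth_proj (model_space (fun t => theta t ^+ N)) K
    (fun t => theta t ^+ (N - m) *: theta_expansion theta m K_ t) <->
  exists2 L', HpM 2%:E L' &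
    (fun t => conjc (theta t) ^+ (N - m) *: K t) = tail theta m K_ L' 0 %[ae mu].
Proof.
move=> /andP[m0 mN] KM KH.
have KiH i : (i < m)%N -> HpM 2%:E (K_ i) by move=> /KM[].
have thNI := inner_funX N thI; have thNH := thNI.1.
have TE : (fun t => theta t ^+ (N - m) *: theta_expansion theta m K_ t) =
    (fun t => theta t ^+ (N - m) *: \sum_(0 <= i < m) theta t ^+ (i - 0) *: K_ i t).
  apply/funext => t; rewrite theta_expansionE//; congr (_ *: _).
  by apply: eq_bigr => i _; rewrite subn0.
rewrite TE.
set T := (fun t => theta t ^+ (N - m) *: _).
have TH : HpM 2%:E T.
  by apply: HpM2Z; [exact: HpyX|exact: HpM2_bignat].
have K2 := HpM_LpM (HpMyW2 KH); have T2 := HpM_LpM TH.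
have VH := HpM2B (HpMyW2 KH) TH; have V2 := HpM_LpM VH.
have T_eq t L' : theta t * conjc (theta t) = 1 ->
    conjc (theta t) ^+ (N - m) *: (T t + theta t ^+ N *: L' t) = tail theta m K_ L' 0 t.
  move=> h; have h' k : conjc (theta t) ^+ k * theta t ^+ k = 1.
    by rewrite -exprMn mulrC h expr1n.
  rewrite /tail subn0 /T scalerDr !scalerA h' scale1r; congr (_ + _ *: _).
  by rewrite -{2}(subnK mN) exprD mulrA h' mul1r.
split=> [[_ orth]|[L' L'H LE]].
  have [k [F [kM FH VE]]] := model_split thNI VH.
  have kH := kM.1; have k2 := HpM_LpM kH.
  have thF2 : LpM 2%:E (fun t => theta t ^+ N *: F t) by exact: HpM_LpM (HpM2Z thNH FH).
  have kk : inner_prod k k = 0.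
    have := orth k kM.
    rewrite [X in inner_prod X _](_ : _ = (fun t => k t + theta t ^+ N *: F t)); last first.
      by apply/funext => t; rewrite VE.
    rewrite (inner_prodDl k2 thF2 k2) (inner_prod_conj k2 thF2) kM.2// conjc0 addr0.
    by [].
  exists F => //.
  apply: filterS2 th1 (inner_prod_eq0 k2 kk) => t h /(_ Logic.I) k0 _.
  rewrite -(T_eq t F h); congr (_ *: _).
  by have := VE t; rewrite k0 add0r => <-; rewrite addrC subrK.
have thL2 : LpM 2%:E (fun t => theta t ^+ N *: L' t) by exact: HpM_LpM (HpM2Z thNH L'H).
have VE : (fun t => K t - T t) = (fun t => theta t ^+ N *: L' t) %[ae mu].
  apply: filterS2 th1 LE => t h /(_ Logic.I) + _.
  rewrite -(T_eq t L' h) => /(congr1 (fun M => theta t ^+ (N - m) *: M)).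
  by rewrite !scalerA -exprMn h expr1n !scale1r => ->; rewrite addrC addKr.
split; last first.
  move=> H HM; have H2 := HpM_LpM HM.1.
  by rewrite (ae_inner_prod V2 thL2 H2 VE) (inner_prod_conj H2 thL2) HM.2// conjc0.
(* The i-th term of conj(theta)^N T is conj(theta)^(m-i) K_i, the conjugate of the bounded analytic
   theta^(m-i-1) times the antianalytic conj(theta) K_i. *)
apply/(model_spaceP _ thNH); split=> // a b j j0.
have cK2 i : (i < m)%N -> Lp 2%:E (fun t => conjc (theta t) * K_ i t a b).
  by move=> im; apply: LpyM2 => //; exact: (HpM_LpM (KiH i im)).
have cKi1 i : (i < m)%N ->
    Lp 1 (fun t => conjc (theta t ^+ (m - i.+1)) * (conjc (theta t) * K_ i t a b)).
  move=> im; apply: LpyM1; last exact/Lp2W1/cK2.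
  by apply: Lp_conj; [exact: le1_y|exact: (HpyX _ thH).1].
rewrite (@ae_fourier _ _ (fun t => \sum_(0 <= i < m | (i < m)%N)
    conjc (theta t ^+ (m - i.+1)) * (conjc (theta t) * K_ i t a b))).
- rewrite fourier_sum//; apply: big1 => i im.
  apply: fourier_adj_orth => //; [exact: HpyX|exact: cK2|].
  by have [_ +] := (model_spaceP _ thH).1 (KM i im); exact.
- apply: LpyM1; last exact/Lp2W1/T2.
  by apply: Lp_conj; [exact: le1_y|exact: thNH.1].
- by apply: Lp_sum => //; exact: lexx.
- apply: filterS th1 => t h _.
  rewrite /T mxE summxE mulrA mulr_sumr big_nat_cond [RHS]big_nat_cond.
  apply: eq_big => [i|i /andP[/andP[_ im] _]]; first by case: (i < m)%N; rewrite ?andbT ?andbF.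
  rewrite mxE subn0 !mulrA; congr (_ * _); rewrite !conjcX.
  have {1}-> : (N = (m - i.+1).+1 + (i + (N - m)))%N by lia.
  rewrite exprD -!mulrA [_ ^+ (N - m) * _]mulrC -exprD -exprMn [conjc _ * _]mulrC h.
  by rewrite expr1n mulr1 exprSr.
Qed.

End CriterionC.

Theorem theorem6p4 (R : realType) (n : nat) (N m : nat)
    (Phi Phip Phim A B : R -> 'M[R[i]]_n) (theta : R -> R[i])
    (A_ B_ : nat -> R -> 'M[R[i]]_n)
    (n_gt0 : (0 < n)%N)
    (mN : (1 <= m <= N)%N)
    (PhiLoo : LpM +oo Phi)
    (Phi_bt : bounded_type Phi)
    (PhipE : plus_part Phi Phip)
    (PhimE : minus_part Phi Phim)
    (Phip0 : fourierM Phip 0 = 0)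
    (Phim0 : fourierM Phim 0 = 0)
    (theta_inner : inner_fun theta)
    (A_H2 : HpM 2%:E A)
    (B_H2 : HpM 2%:E B)
    (PhipA : Phip = (fun t => theta t ^+ N *: (A t)^t*) %[ae circ R])
    (PhimB : Phim = (fun t => theta t ^+ m *: (B t)^t*) %[ae circ R])
    (A_Ktheta : forall i, (i < m)%N -> model_space theta (A_ i))
    (Am_K : model_space (fun t => theta t ^+ (N - m)) (A_ m))
    (B_Ktheta : forall i, (i < m)%N -> model_space theta (B_ i))
    (AE : A = (fun t => theta_expansion theta m A_ t + theta t ^+ m *: A_ m t)
            %[ae circ R])
    (BE : B = theta_expansion theta m B_ %[ae circ R])
    (A_coprime : left_coprime A (fun t => (theta t)%:M)) :
  forall K : R -> 'M[R[i]]_n, HpM +oo K ->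
    (calC Phi K <->
     exists K_ : nat -> R -> 'M[R[i]]_n,
       [/\ forall i, (i < m)%N -> model_space theta (K_ i),
           orth_proj (model_space (fun t => theta t ^+ N)) K
             (fun t => theta t ^+ (N - m) *: theta_expansion theta m K_ t) &
           toeplitz_system theta m A_ B_ K_]).
Proof.
case/andP: mN => m0 le_mN K KH.
have mN' : (0 < m <= N)%N by rewrite m0.
have Phi2 := LpMyW2 PhiLoo.
have [Phim2 [P PhiP PhimP]] := PhimE.
(* [minus_part] comes with its own analytic projection P, which agrees with [Phip] only almost
   everywhere. *)
have PE : P = (fun t => theta t ^+ N *: (A t)^t*) %[ae circ R].
  apply: filterS2 (plus_part_unique Phi2 PhiP PhipE) PhipA => t h h' _.
  by rewrite (h Logic.I) (h' Logic.I).
have UE : (fun t => (Phi t - P t)^t*) = (fun t => theta t ^+ m *: (B t)^t*) %[ae circ R].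
  apply: filterS2 PhimP PhimB => t h h' _.
  by rewrite -(h Logic.I) (h' Logic.I).
have A0 : A = tail theta m A_ (A_ m) 0%N %[ae circ R].
  apply: filterS AE => t h _.
  by rewrite tail0 -theta_expansionE//; exact: h.
have B0 : B = tail theta m B_ (fun=> 0) 0%N %[ae circ R].
  apply: filterS BE => t h _.
  by rewrite tail0 -theta_expansionE// scaler0 addr0; exact: h.
pose L t := conjc (theta t) ^+ (N - m) *: K t.
have dE a b : (fun t => defect theta N m A B K t a b) =
    (fun t => (conjc (theta t) ^+ m *: (B t - L t *m A t)) a b).
  by apply/funext => t; rewrite defectE.
have calCE := calC_iff theta_inner PhiLoo PhiP A_H2 B_H2 PE UE KH.
have toep K_ L' : (forall i, (i < m)%N -> model_space theta (K_ i)) -> HpM 2%:E L' ->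
    HpM +oo L -> L = tail theta m K_ L' 0%N %[ae circ R] ->
    calC Phi K <-> toeplitz_system theta m A_ B_ K_.
  move=> KiM L'H LH LE; rewrite calCE.
  rewrite -(toeplitz_iff theta_inner A_Ktheta B_Ktheta KiM Am_K.1 L'H A_H2 B_H2 LH A0 B0 LE).
  by split=> h a b; have := h a b; rewrite dE.
split=> [KC|[K_ [KiM KP KT]]].
  have LH : HpM +oo L.
    apply: (cancel_power theta_inner A_coprime A_H2 B_H2 KH (calCE.1 KC)).
    by rewrite subnK.
  have [K_ [L' [KiM L'H LE]]] := theta_decomposition m theta_inner (HpMyW2 LH).
  have LE' : L = tail theta m K_ L' 0%N %[ae circ R].
    by apply/aeW => t _; rewrite LE tail0.
  exists K_; split; first exact: KiM.
    by apply: (orth_proj_expansionP theta_inner mN' KiM KH).2; exists L'.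
  exact: (toep K_ L' KiM L'H LH LE').1.
have [L' L'H LE] := (orth_proj_expansionP theta_inner mN' KiM KH).1 KP.
(* In this direction L is analytic because it agrees almost everywhere with its expansion, whose
   terms are in H^2. *)
have LiH : HpM 2%:E (tail theta m K_ L' 0%N).
  by apply: tailH => // i /KiM[].
have Ly : LpM +oo L.
  by apply: LpMyZ; [exact: Lpy_innerJX|exact: HpM_LpM].
apply: (toep K_ L' KiM L'H _ LE).2 => // a b; split; first exact: Ly.
apply: (ae_analytic (Lp2W1 (LiH a b).1) (LpyW1 (Ly a b)) _ (LiH a b).2).
by apply: filterS LE => t h _; rewrite -h.
Qed.
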